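(* Let $G$ be a uniform pro-$2$-group and $\mathfrak g=\operatorname{Lie}(G)$. For every $G$-orbit $\Omega\subset(2\mathfrak g)^*$, let $e'_\Omega\in\operatorname{Fun}(2\mathfrak g)^G$ denote the inverse Fourier transform of the characteristic function of $\Omega$, i.e. $e'_\Omega(x)=\sum_{f\in\Omega}f(x)$ for $x\in 2\mathfrak g$; put $e_\Omega=\log^*(e'_\Omega)=e'_\Omega\circ\log\in\operatorname{Fun}(G^2)^G$; and define $\widehat G_\Omega\subset\widehat G$ to be the collection of those $\rho\in\widehat G$ on which $e_\Omega$ acts nontrivially, i.e. for which the linear operator $\rho(e_\Omega):=\int_G\overline{e_\Omega(g)}\,\rho(g)\,d\mu_G(g)$ is nonzero, where $e_\Omega$ is extended by zero from $G^2$ to $G$. Then the following statements hold: (a) each $\widehat G_\Omega$ is finite, and $\widehat G$ is the disjoint union of the subsets $\widehat G_\Omega$ (over all $G$-orbits $\Omega\subset(2\mathfrak g)^*$); (b) if $\rho\in\widehat G_\Omega$ and $\chi_\rho$ is its character, then $\chi_\rho\big|_{G^2}$ is a multiple of $e_\Omega$.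
   Context: For $p=2$, a uniform Lie algebra is a Lie algebra $\mathfrak g$ over $\mathbb Z_2$ that is free of finite rank as a $\mathbb Z_2$-module and satisfies $[\mathfrak g,\mathfrak g]\subseteq 4\cdot\mathfrak g$, with the topology induced from $\mathbb Z_2$. By Lazard, the Campbell–Hausdorff series $CH(x,y)=\log(\exp(x)\exp(y))$ can be evaluated term-by-term in $\mathfrak g$, converges uniformly, and makes $\mathfrak g$ a topological group $\exp\mathfrak g$. A uniform pro-$2$-group is a profinite group $G$ isomorphic to $\exp\mathfrak g$ for some uniform Lie algebra $\mathfrak g$; one fixes such an isomorphism and writes $\mathfrak g=\operatorname{Lie}(G)$, $\exp:\mathfrak g\to G$ for the underlying map and $\log=\exp^{-1}$. $G$ acts on $\mathfrak g$ by $(\operatorname{Ad}g)(x)=\log(g\exp(x)g^{-1})$, preserving $2\mathfrak g$. $G^2=\exp(2\mathfrak g)$, an open normal subgroup of $G$. For a profinite group $\Pi$, $\mu_\Pi$ is the Haar measure of total mass $1$, and $\operatorname{Fun}(\Pi)$ is the space of functions $\Pi\to\mathbb C$ bi-invariant under some open subgroup. $\operatorname{Fun}(G^2)^G$ is the space of functions in $\operatorname{Fun}(G^2)$ invariant under conjugation by $G$; $\operatorname{Fun}(2\mathfrak g)^G$ is the space of $\operatorname{Ad}(G)$-invariant functions in $\operatorname{Fun}(2\mathfrak g)$. $(2\mathfrak g)^*$ is the group of continuous homomorphisms from the additive group $2\mathfrak g$ to $\mathbb C^\times$, with the induced action of $G$ (orbits are finite). $\widehat G$ is the set of isomorphism classes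 of continuous complex irreducible representations of $G$. *)

(* Defs.v *)
From HB Require Import structures.
From mathcomp Require Import all_boot all_order all_algebra.
From mathcomp Require Import all_classical all_reals all_analysis.
From mathcomp Require Import complex.

Set Implicit Arguments.
Unset Strict Implicit.
Unset Printing Implicit Defensive.

Import Order.TTheory GRing.Theory Num.Theory.
Import numFieldNormedType.Exports.

Local Open Scope classical_set_scope.
Local Open Scope ring_scope.

(* The ring of 2-adic integers, as the inverse limit of the rings Z/2^n.      *)
(* [res x n] is the residue of x modulo 2^n, normalized to 0 <= _ < 2^n; the  *)
(* equation in [Z2_coherent] enforces both the normalization and the          *)
(* compatibility of successive residues.                                      *)

Definition Z2_coherent (a : nat -> int) :=
  `[< forall n, a n = (a n.+1 %% 2 ^+ n)%Z >].

Record Z2 := MkZ2 { res : nat -> int; _ : Z2_coherent res }.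

HB.instance Definition _ := [isSub for res].
HB.instance Definition _ := [Choice of Z2 by <:].

Section Z2_ring.
Implicit Types x y z : Z2.

Lemma resS x n : (res x n.+1 %% 2 ^+ n)%Z = res x n.
Proof. by case: x => a /= /asboolP aS; rewrite -aS. Qed.

Lemma res_mod x n : (res x n %% 2 ^+ n)%Z = res x n.
Proof. by rewrite -resS modz_mod. Qed.

Lemma Z2P x y : (forall n, res x n = res y n) -> x = y.
Proof. by move=> xy; apply: val_inj; apply/funext. Qed.

Lemma modz_exp2S (m : int) n : ((m %% 2 ^+ n.+1)%Z %% 2 ^+ n)%Z = (m %% 2 ^+ n)%Z.
Proof.
by rewrite [in RHS](divz_eq m (2 ^+ n.+1)) [X in _ * X + _]exprS mulrA modzMDl.
Qed.

Lemma Z2_reduce_subproof (a : nat -> int) :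
  (forall n, (a n.+1 %% 2 ^+ n)%Z = (a n %% 2 ^+ n)%Z) ->
  Z2_coherent (fun n => (a n %% 2 ^+ n)%Z).
Proof. by move=> aS; apply/asboolP => n; rewrite modz_exp2S aS. Qed.

Definition Z2_reduce a aS := MkZ2 (@Z2_reduce_subproof a aS).

Fact Z2_const_subproof (m : int) n : (m %% 2 ^+ n)%Z = (m %% 2 ^+ n)%Z.
Proof. by []. Qed.
Fact Z2_opp_subproof x n :
  ((- res x n.+1) %% 2 ^+ n)%Z = ((- res x n) %% 2 ^+ n)%Z.
Proof. by rewrite -[in RHS]resS modzNm. Qed.
Fact Z2_add_subproof x y n :
  ((res x n.+1 + res y n.+1) %% 2 ^+ n)%Z = ((res x n + res y n) %% 2 ^+ n)%Z.
Proof. by rewrite -[in RHS]resS -[in RHS](resS y) modzDm. Qed.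
Fact Z2_mul_subproof x y n :
  ((res x n.+1 * res y n.+1) %% 2 ^+ n)%Z = ((res x n * res y n) %% 2 ^+ n)%Z.
Proof. by rewrite -[in RHS]resS -[in RHS](resS y) modzMm. Qed.

Definition Z2_const (m : int) := @Z2_reduce (fun=> m) (Z2_const_subproof m).
Definition Z2_opp x := @Z2_reduce (fun n => - res x n) (Z2_opp_subproof x).
Definition Z2_add x y :=
  @Z2_reduce (fun n => res x n + res y n) (Z2_add_subproof x y).
Definition Z2_mul x y :=
  @Z2_reduce (fun n => res x n * res y n) (Z2_mul_subproof x y).

Fact Z2_addA : associative Z2_add.
Proof. by move=> x y z; apply: Z2P => n /=; rewrite modzDmr modzDml addrA. Qed.
Fact Z2_addC : commutative Z2_add.
Proof. by move=> x y; apply: Z2P => n /=; rewrite addrC. Qed.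
Fact Z2_add0 : left_id (Z2_const 0) Z2_add.
Proof. by move=> x; apply: Z2P => n /=; rewrite mod0z add0r res_mod. Qed.
Fact Z2_addN : left_inverse (Z2_const 0) Z2_opp Z2_add.
Proof. by move=> x; apply: Z2P => n /=; rewrite modzDml addNr. Qed.

HB.instance Definition _ :=
  GRing.isZmodule.Build Z2 Z2_addA Z2_addC Z2_add0 Z2_addN.

Fact Z2_mulA : associative Z2_mul.
Proof. by move=> x y z; apply: Z2P => n /=; rewrite modzMmr modzMml mulrA. Qed.
Fact Z2_mulC : commutative Z2_mul.
Proof. by move=> x y; apply: Z2P => n /=; rewrite mulrC. Qed.
Fact Z2_mul1 : left_id (Z2_const 1) Z2_mul.
Proof. by move=> x; apply: Z2P => n /=; rewrite modzMml mul1r res_mod. Qed.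
Fact Z2_mulDl : left_distributive Z2_mul +%R.
Proof.
by move=> x y z; apply: Z2P => n /=; rewrite modzMml modzDm mulrDl.
Qed.
Fact Z2_1neq0 : Z2_const 1 != 0.
Proof. by apply/eqP => /(congr1 (fun x => res x 1)). Qed.

HB.instance Definition _ := GRing.Zmodule_isComNzRing.Build Z2
  Z2_mulA Z2_mulC Z2_mul1 Z2_mulDl Z2_1neq0.

End Z2_ring.

Section Z2_topology.
Implicit Types x y z : Z2.

Definition Z2_nbhs x : set_system Z2 :=
  filter_from [set: nat] (fun n => [set y | res y n = res x n]).

HB.instance Definition _ := hasNbhs.Build Z2 Z2_nbhs.

Lemma res_le x y m n : (m <= n)%N -> res x n = res y n -> res x m = res y m.
Proof.
elim: n => [|n IHn]; first by rewrite leqn0 => /eqP ->.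
rewrite leq_eqVlt ltnS => /orP[/eqP -> //|mn xy].
by apply: IHn => //; rewrite -resS xy resS.
Qed.

Fact Z2_nbhs_filter x : ProperFilter (nbhs x).
Proof.
apply: filter_from_proper => [|n _]; last by exists x.
apply: filter_from_filter; first by exists 0%N.
move=> i j _ _; exists (maxn i j) => // y xy.
by split; apply: res_le xy; rewrite (leq_maxl, leq_maxr).
Qed.
Fact Z2_nbhs_singleton x (A : set Z2) : nbhs x A -> A x.
Proof. by case=> n _; apply. Qed.
Fact Z2_nbhs_nbhs x (A : set Z2) : nbhs x A -> nbhs x (nbhs^~ A).
Proof.
case=> n _ nA; exists n => // y /= yx; exists n => // z /= zy.
by apply: nA; rewrite /= zy.
Qed.

HB.instance Definition _ := Nbhs_isNbhsTopological.Build Z2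
  Z2_nbhs_filter Z2_nbhs_singleton Z2_nbhs_nbhs.

End Z2_topology.

(* A vectType over Z2 is a free Z2-module of finite rank: it comes with a     *)
(* linear bijection v2r onto the row vectors 'rV[Z2]_n for some n.            *)

HB.mixin Record isUniformLie V of Vector Z2 V := {
  lieb : V -> V -> V;
  liebl : forall y (a : Z2) x x',
    lieb (a *: x + x') y = a *: lieb x y + lieb x' y;
  liebr : forall x (a : Z2) y y',
    lieb x (a *: y + y') = a *: lieb x y + lieb x y';
  liebxx : forall x, lieb x x = 0;
  lieb_jacobi : forall x y z,
    lieb x (lieb y z) + lieb y (lieb z x) + lieb z (lieb x y) = 0;
  lieb_uniform : forall x y, exists z, lieb x y = 4%:R *: z
}.

#[short(type="uniformLieType")]
HB.structure Definition UniformLie := {V of Vector Z2 V & isUniformLie V}.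

(* V with the topology induced from the product topology of Z2^n through the  *)
(* coordinates v2r.                                                           *)
Notation ltop V := (initial_topology (@VectorInternalTheory.v2r Z2 V)).

(* A formal power series over rat in two noncommuting variables X (= false)   *)
(* and Y (= true) is the function giving the coefficient of each word.        *)
(* CHseries below is log (exp X * exp Y).                                     *)

Definition ncseries := seq bool -> rat.

Definition nc1 : ncseries := fun w => (w == [::])%:R.

Definition ncmul (f h : ncseries) : ncseries := fun w =>
  \sum_(i < (size w).+1) f (take i w) * h (drop i w).

Definition ncpow (f : ncseries) (k : nat) : ncseries := iter k (ncmul f) nc1.

Definition ncexp (b : bool) : ncseries := fun w =>
  if w == nseq (size w) b then (size w)`!%:R^-1 else 0.

(* log f = sum_(k >= 1) (-1)^(k-1) (f - 1)^k / k for f of constant term 1;    *)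
(* the terms with k > size w do not contribute to the coefficient of w.       *)
Definition nclog (f : ncseries) : ncseries := fun w =>
  \sum_(1 <= k < (size w).+1)
     (-1) ^+ k.-1 / k%:R * ncpow (fun v => f v - nc1 v) k w.

Definition CHseries : ncseries := nclog (ncmul (ncexp false) (ncexp true)).

Inductive lie_word := LieGen of bool | LieBr of lie_word & lie_word.

Fixpoint lie_expand (t : lie_word) : ncseries :=
  match t with
  | LieGen b => fun w => (w == [:: b])%:R
  | LieBr s t => fun w =>
      ncmul (lie_expand s) (lie_expand t) w -
      ncmul (lie_expand t) (lie_expand s) w
  end.

Fixpoint lie_eval (V : uniformLieType) (x y : V) (t : lie_word) : V :=
  match t with
  | LieGen b => if b then y else x
  | LieBr s t => lieb (lie_eval x y s) (lie_eval x y t)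
  end.

(* z is the value at (x, y) of the homogeneous component of degree n of       *)
(* CHseries.  That component is a Lie polynomial with rational coefficients;  *)
(* N clears the denominators of an expression of it in Lie words, and z is    *)
(* determined by N z since V is torsion free.                                 *)
Definition CH_term (V : uniformLieType) (n : nat) (x y z : V) : Prop :=
  exists (N : nat) (s : seq (int * lie_word)),
    [/\ (0 < N)%N,
        forall w, \sum_(p <- s) p.1%:~R * lie_expand p.2 w =
                  if size w == n then N%:R * CHseries w else 0 &
        z *+ N = \sum_(p <- s) lie_eval x y p.2 *~ p.1].

Definition CH_value (V : uniformLieType) (x y z : V) : Prop :=
  exists u : nat -> V, (forall n, CH_term n x y (u n)) /\
    (\sum_(0 <= n < N) u n : ltop V) @[N --> \oo] --> (z : ltop V).

HB.mixin Record isTopGroup G of Group G & PointedTopological G := {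
  topmulg_continuous : continuous (fun x : G * G => (x.1 * x.2)%g);
  topinvg_continuous : continuous (fun x : G => (x^-1)%g)
}.

(* The base point of the pointed type G plays no role; it is required by      *)
(* g_sigma_algebraType.                                                       *)
#[short(type="topGroupType")]
HB.structure Definition TopGroup :=
  {G of Group G & PointedTopological G & isTopGroup G}.

Definition profinite (G : topGroupType) : Prop :=
  [/\ compact [set: G], hausdorff_space G & totally_disconnected [set: G]].

(* (exp, log) is an isomorphism of topological groups, with its inverse,      *)
(* between the group (V, CH) and G.                                           *)
Definition lie_chart (V : uniformLieType) (G : topGroupType)
    (exp : V -> G) (log : G -> V) : Prop :=
  [/\ cancel exp log /\ cancel log exp,
      continuous (exp : ltop V -> G), continuous (log : G -> ltop V) &
      forall x y, CH_value x y (log (exp x * exp y)%g)].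

Notation borel G := (g_sigma_algebraType (@open G)).

Definition is_haar (R : realType) (G : topGroupType)
    (mu : probability (borel G) R) : Prop :=
  forall (h : G) (A : set (borel G)), measurable A ->
    mu [set (h * x)%g | x in (A : set G)] = mu A.

Definition cintegral (R : realType) (G : topGroupType)
    (mu : probability (borel G) R) (f : G -> R[i]) : R[i] :=
  Complex (Rintegral mu setT (fun x : borel G => complex.Re (f x)))
          (Rintegral mu setT (fun x : borel G => complex.Im (f x))).

Record crep (R : realType) (G : topGroupType) := CRep {
  rdim : nat;
  rmx :> G -> 'M[R[i]]_rdim;
  rmx1 : rmx 1%g = 1%:M;
  rmxM : forall x y, rmx (x * y)%g = rmx x *m rmx y;
  rmx_continuous : forall i j,
    continuous (fun x => rmx x i j : (R[i] : numFieldType))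
}.

Section Representations.
Variables (R : realType) (G : topGroupType).
Implicit Types rho : crep R G.

Definition irreducible_rep rho : Prop :=
  (0 < rdim rho)%N /\
  forall U : {vspace 'cV[R[i]]_(rdim rho)},
    (forall h u, u \in U -> rho h *m u \in U) -> U = 0%VS \/ U = fullv.

Definition iso_rep rho1 rho2 : Prop :=
  exists (P : 'M[R[i]]_(rdim rho2, rdim rho1))
         (Q : 'M[R[i]]_(rdim rho1, rdim rho2)),
    [/\ P *m Q = 1%:M, Q *m P = 1%:M &
        forall h, P *m rho1 h = rho2 h *m P].

Definition iso_class rho : set (crep R G) := [set rho' | iso_rep rho rho'].

Definition Ghat : set (set (crep R G)) :=
  [set iso_class rho | rho in irreducible_rep].

Definition rchar rho (h : G) : R[i] := \tr (rho h).

Definition rep_op (mu : probability (borel G) R) (e : G -> R[i]) rho :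
    'M[R[i]]_(rdim rho) :=
  \matrix_(i, j) cintegral mu (fun h => (e h)^*%C * rho h i j).

End Representations.

Arguments Ghat R G : clear implicits.

Section OrbitMethod.
Variables (R : realType) (V : uniformLieType) (G : topGroupType).
Variables (exp : V -> G) (log : G -> V).
Implicit Types (f : V -> R[i]) (Omega : set (V -> R[i])).

Definition twoV : set V := [set x *+ 2 | x in [set: V]].

Definition Gsq : set G := exp @` twoV.

Definition Ad (h : G) (x : V) : V := log (h * exp x * h^-1)%g.

(* A continuous homomorphism 2V -> C^* is represented by its extension by     *)
(* zero to V.                                                                 *)
Definition dual2V : set (V -> R[i]) := [set f |
  [/\ forall x, f x != 0 <-> twoV x,
      forall x y, twoV x -> twoV y -> f (x + y) = f x * f y &
      {within (twoV : set (ltop V)),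
         continuous (f : ltop V -> (R[i] : numFieldType))}]].

Definition coAd (h : G) f : V -> R[i] := fun x => f (Ad h^-1%g x).

Definition orbits : set (set (V -> R[i])) :=
  [set [set coAd h f | h in [set: G]] | f in dual2V].

Definition eOmega' Omega (x : V) : R[i] := \sum_(f \in Omega) f x.

Definition eOmega Omega (h : G) : R[i] :=
  if h \in Gsq then eOmega' Omega (log h) else 0.

Definition Ghat_orbit (mu : probability (borel G) R) Omega :
    set (set (crep R G)) :=
  [set iso_class rho | rho in
    [set rho | irreducible_rep rho /\ rep_op mu (eOmega Omega) rho != 0]].

End OrbitMethod.

(* Main.v *)
Require Import Defs.
From HB Require Import structures.
From mathcomp Require Import all_boot all_order all_algebra.
From mathcomp Require Import finmap all_classical all_reals all_analysis.
From mathcomp Require Import complex.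
From mathcomp Require Import zify ring lra.

Set Implicit Arguments.
Unset Strict Implicit.
Unset Printing Implicit Defensive.

Import Order.TTheory GRing.Theory Num.Theory.
Import numFieldNormedType.Exports.

Local Open Scope classical_set_scope.
Local Open Scope ring_scope.

Import VectorInternalTheory.

(** Everything rests on one fact about the group law: for x and y in 2V,

      log (exp x exp y) = Ad (a) x + Ad (b) y

    for suitable a and b in G depending on x and y, where moreover the map
    (x, y) -> (Ad (a) x, Ad (b) y) is a bijection preserving congruences. Hence
    on Ad(G)-invariant functions on 2V the convolution of G and the convolution
    of the additive group coincide [sum_hmul]. The functions e'_Omega are, up to
    scalars, the orthogonal idempotents of the additive convolution algebra of
    invariant functions, so that of two distinct e_Omega at least one acts by
    zero on any given irreducible representation [rep_op_orthogonal].

    The elements a and b are found modulo each 2^k by successive approximation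
    [hmul_conjugates]. Dividing the bracket by 4 gives an integral bracket
    {x, y}, and on 2V the Campbell-Hausdorff series reads, after halving,
    x + y + 4 ({x, P} + {y, Q}) with P and Q integral Lie polynomials [hmul_lie].
    A conjugation of x according to P and of y according to Q removes the
    correction up to an error of the same shape with one more factor 2
    [conjugation_step]. Two estimates make this work. The integrality of the
    series comes from Dynkin's formula and a bound for the denominators of its
    coefficients [CH_term_size]. The expansion Ad (exp a) x = x + 4 {a, x} +
    8 {a, {a, F}} [Ad_lie] is obtained without the exponential series: Ad is
    additive, being compatible with the rescaled group law, Ad (exp (2^m a)) is
    known to first order, and comparing it with the 2^m-th power of Ad (exp a)
    determines the latter.

    On the side of representations, each rho is trivial on some exp (2^k V), as
    small neighbourhoods of 1 in GL_n(C) contain no nontrivial subgroup, so that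
    integrals are finite sums over V / 2^k V. By Schur's lemma e_Omega acts on
    an irreducible rho by a scalar, a nonzero multiple of the Fourier
    coefficient of the character of rho on 2V at any member of Omega [rep_op_eq0]. By Fourier
    inversion some coefficient is nonzero, so some e_Omega acts nontrivially, by
    orthogonality only one does, and the character restricted to G^2 is a
    multiple of e_Omega [character_formula]. If e_Omega acts nontrivially on rho,
    then rho is trivial on the subgroup exp (2^k V) under which e_Omega is
    invariant, and the finite quotient of G by it has finitely many irreducible
    representations [finite_irreducible]. *)

(** * Divisibility by powers of two in Z_2-lattices *)

Lemma res_mulrn (x : Z2) N n : res (x *+ N) n = ((res x n * N%:Z) %% 2 ^+ n)%Z.
Proof.
elim: N => [|N IHN]; first by rewrite mulr0n /= mulr0 mod0z.
rewrite mulrS /= IHN modzDmr; congr (_ %% _)%Z.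
by rewrite intS mulrDr mulr1.
Qed.

Lemma res_modle (x : Z2) m n : (m <= n)%N -> (res x n %% 2 ^+ m)%Z = res x m.
Proof.
elim: n => [|n IHn]; first by rewrite leqn0 => /eqP ->; rewrite res_mod.
rewrite leq_eqVlt ltnS => /orP[/eqP -> |mn]; first by rewrite res_mod.
rewrite -(IHn mn) -(resS x n) {1}(divz_eq (res x n.+1) (2 ^+ n)).
by rewrite -(subnK mn) exprD mulrA modzMDl.
Qed.

Lemma res_ge0 (x : Z2) n : 0 <= res x n.
Proof. by rewrite -res_mod modz_ge0 // expf_neq0. Qed.

Lemma res_lt (x : Z2) n : res x n < 2 ^+ n.
Proof. by rewrite -res_mod ltz_pmod // exprn_gt0. Qed.

Lemma Posz_exp2 n : ((2 ^ n)%N : int) = 2 ^+ n.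
Proof. by rewrite -[LHS]natz natrX. Qed.

Lemma dvdz_exp2_nat (z : int) n : (2 ^+ n %| z)%Z = (2 ^ n %| `|z|)%N.
Proof. by rewrite dvdzE abszX. Qed.

Lemma Z2_torsion_free (x : Z2) N : (0 < N)%N -> x *+ N = 0 -> x = 0.
Proof.
move=> N0 xN; apply: Z2P => n /=; rewrite mod0z.
have := congr1 (fun y => res y (N + n)) xN; rewrite res_mulrn /= mod0z.
move/dvdz_mod0P; rewrite dvdz_exp2_nat abszM /=.
have [m m1 NE] := @pfactor_coprime 2 N isT N0.
have vN : (logn 2 N <= N)%N by rewrite ltnW // ltn_logl.
have -> : (N + n = logn 2 N + (N - logn 2 N + n))%N by lia.
rewrite [X in (_ %| _ * X)%N]NE mulnA expnD [X in (_ %| X)%N]mulnC.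
rewrite dvdn_pmul2l ?expn_gt0 // Gauss_dvdl ?coprimeXl // => d.
rewrite -(@res_modle x n (logn 2 N + (N - logn 2 N + n))); last by lia.
apply/dvdz_mod0P; rewrite dvdz_exp2_nat.
by apply: dvdn_trans d; rewrite dvdn_exp2l //; lia.
Qed.

Lemma Z2_div (x : Z2) k : res x k = 0 -> exists y, x = y *+ 2 ^ k.
Proof.
move=> xk.
have dv n : (2 ^+ k %| res x (n + k))%Z.
  by apply/dvdz_mod0P; rewrite res_modle ?xk // leq_addl.
have co n : (divz (res x (n.+1 + k)) (2 ^+ k) %% 2 ^+ n)%Z
            = (divz (res x (n + k)) (2 ^+ k) %% 2 ^+ n)%Z.
  rewrite -(@res_modle x (n + k) (n.+1 + k)) ?leq_add2r //.
  have /dvdzP[q ->] := dv n.+1.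
  by rewrite exprD -mulz_modl ?exprn_gt0 // !mulzK ?expf_neq0 // modz_mod.
exists (Z2_reduce co); apply: Z2P => n; rewrite res_mulrn /=.
rewrite modzMml; have /dvdzP[q qE] := dv n.
rewrite qE mulzK ?expf_neq0 // Posz_exp2 -qE.
by rewrite res_modle // leq_addr.
Qed.

Section Lattice.
Variable V : vectType Z2.
Implicit Types x y z : V.

Lemma lattice_torsion_free x N : (0 < N)%N -> x *+ N = 0 -> x = 0.
Proof.
move=> N0 xN; apply: v2r_inj; rewrite raddf0.
apply/rowP => i; rewrite mxE; apply: (Z2_torsion_free N0).
have /rowP /(_ i) := congr1 v2r xN.
by rewrite raddf0 raddfMn /= mulmxnE mxE.
Qed.

Lemma mulrnI x y N : (0 < N)%N -> x *+ N = y *+ N -> x = y.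
Proof.
move=> N0 xy; apply/eqP; rewrite -subr_eq0; apply/eqP.
by apply: (lattice_torsion_free N0); rewrite mulrnBl xy subrr.
Qed.

(** Kept as a relation on V rather than as equality in a quotient: congruences
    are derived for all k at once, and the finite quotients only serve to sum. *)
Definition eqm k x y := exists z, x - y = z *+ 2 ^ k.

Lemma eqm_refl k x : eqm k x x.
Proof. by exists 0; rewrite subrr mul0rn. Qed.

Lemma eqm_eq k x y : x = y -> eqm k x y.
Proof. by move=> ->; apply: eqm_refl. Qed.

Lemma eqm_sym k x y : eqm k x y -> eqm k y x.
Proof. by case=> z xy; exists (- z); rewrite mulNrn -xy opprB. Qed.

Lemma eqm_trans k y x z : eqm k x y -> eqm k y z -> eqm k x z.
Proof.
by case=> a xy [b yz]; exists (a + b); rewrite mulrnDl -xy -yz addrA subrK.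
Qed.

Lemma eqmD k x y x' y' : eqm k x x' -> eqm k y y' -> eqm k (x + y) (x' + y').
Proof.
by case=> a xy [b yz]; exists (a + b); rewrite mulrnDl -xy -yz opprD addrACA.
Qed.

Lemma eqmN k x x' : eqm k x x' -> eqm k (- x) (- x').
Proof. by case=> a xy; exists (- a); rewrite mulNrn -xy opprD. Qed.

Lemma eqmB k x y x' y' : eqm k x x' -> eqm k y y' -> eqm k (x - y) (x' - y').
Proof. by move=> h1 h2; apply: eqmD => //; apply: eqmN. Qed.

Lemma eqmMn k x x' n : eqm k x x' -> eqm k (x *+ n) (x' *+ n).
Proof. by case=> a xy; exists (a *+ n); rewrite mulrnAC -xy mulrnBl. Qed.

Lemma eqmMz k x x' n : eqm k x x' -> eqm k (x *~ n) (x' *~ n).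
Proof.
case: n => n h; first exact: eqmMn.
by rewrite !NegzE !mulrNz; apply/eqmN/eqmMn.
Qed.

Lemma eqm_sum k (I : Type) (r : seq I) (P : pred I) (F F' : I -> V) :
  (forall i, P i -> eqm k (F i) (F' i)) ->
  eqm k (\sum_(i <- r | P i) F i) (\sum_(i <- r | P i) F' i).
Proof.
move=> h; apply: (big_ind2 (eqm k)) => //; first exact: eqm_refl.
by move=> *; apply: eqmD.
Qed.

Lemma eqm_le k j x y : (j <= k)%N -> eqm k x y -> eqm j x y.
Proof.
move=> jk [z xy]; exists (z *+ 2 ^ (k - j)).
by rewrite xy -mulrnA -expnD subnK.
Qed.

Lemma eqm_0 x y : eqm 0 x y.
Proof. by exists (x - y); rewrite expn0 mulr1n. Qed.

Lemma eqm_mul k j x y : eqm k x y -> eqm (k + j) (x *+ 2 ^ j) (y *+ 2 ^ j).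
Proof. by case=> z xy; exists z; rewrite -mulrnBl xy -mulrnA -expnD. Qed.

Lemma eqm_div k j x y : eqm (k + j) (x *+ 2 ^ j) (y *+ 2 ^ j) -> eqm k x y.
Proof.
case=> z; rewrite -mulrnBl expnD mulrnA => h.
by exists z; apply: mulrnI h; rewrite expn_gt0.
Qed.

Lemma eqm_dvd k x j : (k <= j)%N -> eqm k (x *+ 2 ^ j) 0.
Proof. by move=> kj; exists (x *+ 2 ^ (j - k)); rewrite subr0 -mulrnA -expnD subnK. Qed.

Lemma eqm_addr k x y : eqm k y 0 -> eqm k (x + y) x.
Proof. by case=> z; rewrite subr0 => ->; exists z; rewrite addrC addrA addNr add0r. Qed.

Lemma eqm0P k x : eqm k x 0 -> exists z, x = z *+ 2 ^ k.
Proof. by case=> z; rewrite subr0; exists z. Qed.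

(** Lets the odd denominators of the series be cleared modulo each power of two
    separately, without division in Z_2. *)
Lemma odd_inverse M k : odd M ->
  exists c : int, forall x y, x *+ M = y -> eqm k x (y *~ c).
Proof.
move=> oM; have cM : coprime M (2 ^ k) by rewrite coprimeXr // coprimen2.
case: k cM => [|k] cM; first by exists 0 => x y _; apply: eqm_0.
have M0 : (0 < M)%N by case: M oM {cM}.
have [u v uv _] := egcdnP (2 ^ k.+1) M0.
exists u%:Z => x y <-; rewrite -pmulrn -mulrnA mulnC uv.
rewrite (eqP cM) mulrnDr mulr1n.
by apply: eqm_sym; rewrite addrC; apply: eqm_addr; rewrite mulrnA; apply: eqm_dvd.
Qed.

Lemma eqm_resP k x y :
  eqm k x y <-> forall i, res (v2r x 0 i) k = res (v2r y 0 i) k.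
Proof.
split=> [[z xy] i|h].
  have -> : x = y + z *+ 2 ^ k by rewrite -xy addrC subrK.
  rewrite raddfD raddfMn /= mxE mulmxnE /=.
  rewrite -[X in (_ + X)%R]res_mod res_mulrn Posz_exp2.
  by rewrite modz_mod modzMl addr0 res_mod.
have dv i : exists w : Z2, v2r (x - y) 0 i = w *+ 2 ^ k.
  apply: Z2_div; rewrite raddfB /= !mxE /= h modzDmr.
  by rewrite subrr mod0z.
have {}dv i := cid (dv i).
exists (r2v (\row_i sval (dv i))).
apply: v2r_inj.
rewrite raddfMn /= r2vK.
by apply/rowP => i; rewrite mulmxnE mxE; exact: (svalP (dv i)).
Qed.

Lemma eqm_separated x y : (forall k, eqm k x y) -> x = y.
Proof.
move=> h; apply: v2r_inj; apply/rowP => i.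
by apply: Z2P => k; have /eqm_resP := h k.
Qed.

(** The quotient V / 2^k V, encoded by coordinates so that it is a finite type. *)
Definition quo k := {ffun 'I_(dim V) -> 'I_(2 ^ k)}.

Fact absz_res_lt (z : Z2) k : (`|res z k| < 2 ^ k)%N.
Proof.
have := res_lt z k; have := res_ge0 z k; case: (res z k) => // m _.
by rewrite -Posz_exp2.
Qed.

Definition quo_pi k x : quo k := [ffun i => Ordinal (absz_res_lt (v2r x 0 i) k)].

Lemma quo_piP k x y : quo_pi k x = quo_pi k y <-> eqm k x y.
Proof.
rewrite eqm_resP; split=> [/ffunP h i|h].
  have := h i; rewrite !ffunE => /(congr1 (@nat_of_ord _)) /=.
  by rewrite -{2}(gez0_abs (res_ge0 _ _)) => ->; rewrite gez0_abs ?res_ge0.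
by apply/ffunP => i; rewrite !ffunE; apply: val_inj; rewrite /= h.
Qed.

Definition quo_repr k (q : quo k) : V :=
  r2v (\row_i Z2_const (q i)).

Lemma quo_reprK k q : quo_pi k (quo_repr q) = q.
Proof.
apply/ffunP => i; apply: val_inj; rewrite ffunE /= r2vK mxE /=.
by rewrite modz_small // -Posz_exp2 ltz_nat ltn_ord.
Qed.

Lemma quo_pi_repr k x : eqm k (quo_repr (quo_pi k x)) x.
Proof. by apply/quo_piP; rewrite quo_reprK. Qed.

Lemma quo_repr_inj k (p q : quo k) : eqm k (quo_repr p) (quo_repr q) -> p = q.
Proof. by move/quo_piP; rewrite !quo_reprK. Qed.

End Lattice.

(** * The Dynkin form of the Campbell-Hausdorff components *)

Section LieBracket.
Variable V : uniformLieType.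
Implicit Types x y z : V.

Lemma liebDr x y y' : lieb x (y + y') = lieb x y + lieb x y'.
Proof. by have := liebr x 1 y y'; rewrite !scale1r. Qed.

Lemma liebDl x x' y : lieb (x + x') y = lieb x y + lieb x' y.
Proof. by have := liebl y 1 x x'; rewrite !scale1r. Qed.

Lemma lieb_zmod_morphism x : zmod_morphism (lieb x : V -> V).
Proof.
by move=> y y'; have := liebr x (-1) y' y; rewrite !scaleN1r addrC => ->; rewrite addrC.
Qed.

HB.instance Definition _ x := GRing.isZmodMorphism.Build V V (lieb x) (@lieb_zmod_morphism x).

Lemma liebC x y : lieb y x = - lieb x y.
Proof.
have := liebxx (x + y); rewrite liebDr !liebDl !liebxx add0r addr0.
by move/eqP; rewrite addr_eq0 => /eqP.
Qed.

Lemma lieb_ad x y z : lieb (lieb x y) z = lieb x (lieb y z) - lieb y (lieb x z).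
Proof.
have /eqP := lieb_jacobi x y z.
rewrite addr_eq0 => /eqP e; rewrite (liebC z (lieb x y)) -e.
by rewrite (liebC x z) raddfN.
Qed.

Definition gen x y (b : bool) := if b then y else x.

Definition adw x y (w : seq bool) z := foldr (fun b => lieb (gen x y b)) z w.

(** The right-normed bracket [w_1, [w_2, ... [w_(n-1), w_n]]]. *)
Fixpoint rnorm x y (w : seq bool) : V :=
  if w is b :: w' then
    if w' is [::] then gen x y b else lieb (gen x y b) (rnorm x y w')
  else 0.

Lemma rnorm_cat x y u v : v != [::] -> rnorm x y (u ++ v) = adw x y u (rnorm x y v).
Proof.
move=> v0; elim: u => //= b u IHu; rewrite -IHu.
by case: u {IHu} => //=; case: v v0.
Qed.

Lemma adw_zmod_morphism x y w : zmod_morphism (adw x y w).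
Proof. elim: w => [//|b w IHw] u v.
by rewrite /adw /= -![foldr _ _ w]/(adw x y w _) IHw raddfB. Qed.

HB.instance Definition _ x y w := GRing.isZmodMorphism.Build V V (adw x y w)
  (@adw_zmod_morphism x y w).

End LieBracket.

Fixpoint lie_deg (t : lie_word) : nat :=
  match t with LieGen _ => 1 | LieBr s t => lie_deg s + lie_deg t end.

(** A list of signed words instead of a series: it can be summed over in any
    module, in particular against brackets of V. *)
Fixpoint lie_terms (t : lie_word) : seq (int * seq bool) :=
  match t with
  | LieGen b => [:: (1, [:: b])]
  | LieBr s t =>
      [seq (p.1 * q.1, p.2 ++ q.2) | p <- lie_terms s, q <- lie_terms t] ++
      [seq (- (p.1 * q.1), p.2 ++ q.2) | p <- lie_terms t, q <- lie_terms s]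
  end.

Lemma lie_deg_gt0 t : (0 < lie_deg t)%N.
Proof. by elim: t => //= s IHs t IHt; rewrite addn_gt0 IHs. Qed.

Lemma size_lie_terms t p : p \in lie_terms t -> size p.2 = lie_deg t.
Proof.
elim: t p => [b|s IHs t IHt] p /=; first by rewrite inE => /eqP ->.
rewrite mem_cat => /orP[] /allpairsP[[q r] /= [qs rt ->]] /=; rewrite size_cat.
  by rewrite IHs // IHt.
by rewrite IHt // IHs // addnC.
Qed.

Lemma sum_split_word (u v w : seq bool) :
  \sum_(i < (size w).+1) ((u == take i w)%:R * (v == drop i w)%:R : rat)
  = (u ++ v == w)%:R.
Proof.
have [<-|uvw] := eqVneq (u ++ v) w.
  have lt : (size u < (size (u ++ v)).+1)%N by rewrite size_cat ltnS leq_addr.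
  rewrite (bigD1 (Ordinal lt)) //= take_size_cat // drop_size_cat // !eqxx mulr1.
  rewrite big1 ?addr0 // => i; rewrite -val_eqE /= => iu.
  case: eqP => [uE|]; last by rewrite mul0r.
  case/eqP: iu; rewrite [in RHS]uE size_take_min.
  by apply/esym/minn_idPl; rewrite -ltnS.
rewrite big1 // => i _.
have [uE|] := eqVneq u; last by rewrite mul0r.
have [vE|] := eqVneq v; last by rewrite mulr0.
by case/eqP: uvw; rewrite uE vE cat_take_drop.
Qed.

Lemma ncmul_terms (a b : seq (int * seq bool)) w :
  ncmul (fun w => \sum_(p <- a) p.1%:~R * (p.2 == w)%:R)
        (fun w => \sum_(p <- b) p.1%:~R * (p.2 == w)%:R) w =
  \sum_(p <- [seq (p.1 * q.1, p.2 ++ q.2) | p <- a, q <- b])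
     p.1%:~R * (p.2 == w)%:R.
Proof.
rewrite big_allpairs_dep /ncmul /=.
under eq_bigr => i _ do rewrite mulr_suml.
rewrite exchange_big; apply: eq_bigr => p _ /=.
under eq_bigr => i _ do rewrite mulr_sumr.
rewrite exchange_big; apply: eq_bigr => q _ /=.
rewrite intrM -sum_split_word mulr_sumr; apply: eq_bigr => i _.
by rewrite mulrACA.
Qed.

Lemma lie_expandE t w :
  lie_expand t w = \sum_(p <- lie_terms t) p.1%:~R * (p.2 == w)%:R.
Proof.
elim: t w => [b|s IHs t IHt] w /=.
  by rewrite big_seq1 mul1r eq_sym.
rewrite (_ : lie_expand s = fun w => \sum_(p <- lie_terms s) p.1%:~R * (p.2 == w)%:R); last exact/funext.
rewrite (_ : lie_expand t = fun w => \sum_(p <- lie_terms t) p.1%:~R * (p.2 == w)%:R); last exact/funext.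
rewrite !ncmul_terms big_cat /=; congr (_ + _).
rewrite !big_allpairs_dep /= -sumrN; apply: eq_bigr => p _.
by rewrite -sumrN; apply: eq_bigr => q _; rewrite mulrNz mulNr.
Qed.

Lemma sum_one_value (U : nmodType) (I : Type) (r : seq I) (f : I -> nat) (F : I -> U) n :
  (forall d, d != n -> \sum_(i <- r | f i == d) F i = 0) ->
  \sum_(i <- r) F i = \sum_(i <- r | f i == n) F i.
Proof.
move=> h; pose D := \max_(i < size r) f (tnth (in_tuple r) i).
have fD i : (f (tnth (in_tuple r) i) < D.+1)%N by rewrite ltnS; exact: leq_bigmax.
have E d : \sum_(i < size r | inord (f (tnth (in_tuple r) i)) == d :> 'I_D.+1)
    F (tnth (in_tuple r) i) = \sum_(i <- r | f i == d) F i.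
  rewrite [RHS]big_tnth; apply: eq_bigl => i.
  by rewrite -val_eqE /= inordK.
rewrite big_tnth (partition_big (fun i => inord (f (tnth (in_tuple r) i)) : 'I_D.+1) xpredT) //=.
rewrite (eq_bigr _ (fun d _ => E d)).
have [nD|Dn] := ltnP n D.+1.
  rewrite (bigD1 (Ordinal nD)) //= [X in _ + X]big1 ?addr0 // => d.
  by rewrite -val_eqE /= => dn; apply: h.
rewrite big1 => [|d _]; last by rewrite h // neq_ltn (leq_trans (ltn_ord d)).
rewrite big_tnth big_pred0 // => i.
by apply/eqP => fn; move: (fD i); rewrite fn ltnNge Dn.
Qed.

Section Dynkin.
Variables (V : uniformLieType) (x y : V).

Lemma sum_adw t z :
  \sum_(p <- lie_terms t) adw x y p.2 z *~ p.1 = lieb (lie_eval x y t) z.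
Proof.
elim: t z => [b|s IHs t IHt] z /=; first by rewrite big_seq1 mulr1z.
have E (a b : lie_word) : (forall z, \sum_(p <- lie_terms a) adw x y p.2 z *~ p.1 = lieb (lie_eval x y a) z) ->
  (forall z, \sum_(p <- lie_terms b) adw x y p.2 z *~ p.1 = lieb (lie_eval x y b) z) ->
  \sum_(p <- lie_terms a) \sum_(q <- lie_terms b) adw x y (p.2 ++ q.2) z *~ (p.1 * q.1)
   = lieb (lie_eval x y a) (lieb (lie_eval x y b) z).
  move=> Ha Hb; rewrite -Ha; apply: eq_bigr => p _.
  rewrite -Hb raddf_sum /= mulrz_suml; apply: eq_bigr => q _.
  by rewrite raddfMz /= -mulrzA mulrC /adw foldr_cat.
rewrite big_cat /= !big_allpairs_dep /= lieb_ad -(E s t) // -(E t s) //; congr (_ + _).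
rewrite -sumrN; apply: eq_bigr => p _; rewrite -sumrN; apply: eq_bigr => q _.
by rewrite mulrNz.
Qed.

(** Dynkin's theorem. Right-normed bracketing of a product u v is the adjoint
    action of the letters of u on the bracketing of v; by [sum_adw] the words of
    a Lie element s act as the bracket with s, so that the two halves of the
    expansion of [s, t] contribute deg t and deg s copies of it. *)
Lemma sum_rnorm t :
  \sum_(p <- lie_terms t) rnorm x y p.2 *~ p.1 = lie_eval x y t *+ lie_deg t.
Proof.
elim: t => [b|s IHs t IHt] /=; first by rewrite big_seq1 mulr1z.
have E (a b : lie_word) :
  \sum_(p <- lie_terms b) rnorm x y p.2 *~ p.1 = lie_eval x y b *+ lie_deg b ->
  \sum_(p <- lie_terms a) \sum_(q <- lie_terms b) rnorm x y (p.2 ++ q.2) *~ (p.1 * q.1)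
   = lieb (lie_eval x y a) (lie_eval x y b) *+ lie_deg b.
  move=> Hb; rewrite -raddfMn /= -Hb -sum_adw; apply: eq_bigr => p _.
  rewrite raddf_sum /= mulrz_suml big_seq [in RHS]big_seq; apply: eq_bigr => q qb.
  rewrite rnorm_cat; last first.
    by rewrite -size_eq0 (size_lie_terms qb) -lt0n lie_deg_gt0.
  by rewrite raddfMz /= -mulrzA mulrC.
rewrite big_cat /= !big_allpairs_dep /= addnC mulrnDr -(E s t) //; congr (_ + _).
rewrite (liebC (lie_eval x y t)) mulNrn -(E t s) //.
rewrite -sumrN; apply: eq_bigr => p _; rewrite -sumrN; apply: eq_bigr => q _.
by rewrite mulrNz.
Qed.

(** The combination defining a component need not be homogeneous, as terms of
    other degrees may cancel; Dynkin's operator isolates each degree. *)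
Lemma lie_combination_degree (s : seq (int * lie_word)) d :
  (\sum_(p <- s | lie_deg p.2 == d) lie_eval x y p.2 *~ p.1) *+ d =
  \sum_(w : d.-tuple bool) rnorm x y w *~
     (\sum_(p <- s) p.1 * \sum_(q <- lie_terms p.2) q.1 * (q.2 == w)%:R).
Proof.
under [RHS]eq_bigr => w _ do rewrite mulrz_sumr.
rewrite exchange_big /= -sumrMnl big_mkcond /=; apply: eq_bigr => p _.
case: eqP => [<-|pd]; last first.
  apply/esym; rewrite big1 // => w _; rewrite big_seq big1 ?mulr0 ?mulr0z // => q qp.
  case: eqP => [qw|]; last by rewrite mulr0.
  by case: pd; rewrite -(size_lie_terms qp) qw size_tuple.
rewrite pmulrn -mulrzA mulrC mulrzA -pmulrn -sum_rnorm.
under [RHS]eq_bigr => w _ do rewrite mulrC mulrzA mulrz_sumr.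
rewrite -[RHS]mulrz_suml; congr (_ *~ _).
rewrite exchange_big /= big_seq [in RHS]big_seq; apply: eq_bigr => q qp.
have sq : size q.2 == lie_deg p.2 by rewrite (size_lie_terms qp).
rewrite (bigD1 (Tuple sq)) //= eqxx mulr1 big1 ?addr0 // => w.
rewrite -val_eqE /= eq_sym => /negbTE ->; by rewrite mulr0 mulr0z.
Qed.

(** The homogeneous components of the series in terms of the coefficients of
    the series itself, whatever expression by Lie words was chosen for them. *)
Lemma CH_term_dynkin n z : CH_term n x y z ->
  (n = 0%N -> z = 0) /\
  exists (N : nat) (e : seq bool -> int),
    [/\ (0 < N)%N,
        forall w, size w = n -> (e w)%:~R = N%:R * CHseries w &
        z *+ (N * n) = \sum_(w : n.-tuple bool) rnorm x y w *~ e w].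
Proof.
case=> N [s [N0 sE zE]].
pose e w := \sum_(p <- s) p.1 * \sum_(q <- lie_terms p.2) q.1 * (q.2 == w)%:R.
have eE w : (e w)%:~R = \sum_(p <- s) p.1%:~R * lie_expand p.2 w.
  rewrite raddf_sum; apply: eq_bigr => p _ /=; rewrite intrM lie_expandE.
  by rewrite raddf_sum /=; congr (_ * _); apply: eq_bigr => q _; rewrite intrM; case: eqP.
pose T d := \sum_(p <- s | lie_deg p.2 == d) lie_eval x y p.2 *~ p.1.
have T0 d : d != n -> T d = 0.
  move=> dn; case: d => [|d] in dn *.
    by rewrite /T big_pred0 // => p; rewrite eqn0Ngt lie_deg_gt0.
  apply: (@lattice_torsion_free _ _ d.+1) => //; rewrite lie_combination_degree.
  rewrite big1 // => w _; rewrite (_ : \sum_(p <- s) _ = 0) ?mulr0z //.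
  by apply: (intr_inj (R := rat)); rewrite -[LHS]/((e w)%:~R) eE sE size_tuple (negbTE dn).
have TE : z *+ N = T n by rewrite zE; apply: sum_one_value.
split=> [n0|].
  apply: (lattice_torsion_free N0); rewrite TE /T n0 big_pred0 // => p.
  by rewrite eqn0Ngt lie_deg_gt0.
exists N, e; split=> // [w wn|]; first by rewrite eE sE wn eqxx.
by rewrite mulrnA TE lie_combination_degree.
Qed.

End Dynkin.

(** * The 2-adic size of the Campbell-Hausdorff coefficients *)

(** Membership of the rational x in 2^k Z_(2). *)
Definition pow2 (k : nat) (x : rat) :=
  exists (M : nat) (c : int), odd M /\ x * M%:R = 2 ^+ k * c%:~R.

Lemma pow2_int k (c : int) : pow2 k (2 ^+ k * c%:~R).
Proof. by exists 1%N, c; rewrite mulr1. Qed.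

Lemma pow20 k : pow2 k 0.
Proof. by exists 1%N, 0; rewrite mul0r mulr0. Qed.

Lemma pow2D k x y : pow2 k x -> pow2 k y -> pow2 k (x + y).
Proof.
move=> [M [c [oM xM]]] [N [d [oN yN]]].
exists (M * N)%N, (c * N%:Z + d * M%:Z); rewrite oddM oM oN; split=> //.
rewrite natrM intrD !intrM mulrDr mulrDl !mulrA xM -!pmulrn.
by rewrite [y * _ * _]mulrAC yN.
Qed.

Lemma pow2M j k x y : pow2 j x -> pow2 k y -> pow2 (j + k) (x * y).
Proof.
move=> [M [c [oM xM]]] [N [d [oN yN]]].
exists (M * N)%N, (c * d); rewrite oddM oM oN; split=> //.
by rewrite natrM mulrACA xM yN intrM mulrACA exprD.
Qed.

Lemma pow2_le j k x : (j <= k)%N -> pow2 k x -> pow2 j x.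
Proof.
move=> jk [M [c [oM xM]]]; exists M, (2 ^+ (k - j) * c); split=> //.
by rewrite xM intrM rmorphXn /= mulrA -exprD subnKC.
Qed.

Lemma pow2N k x : pow2 k x -> pow2 k (- x).
Proof.
move=> [M [c [oM xM]]]; exists M, (- c); split=> //.
by rewrite mulNr xM intrN mulrN.
Qed.

Lemma pow2_sum k (I : Type) (r : seq I) (P : pred I) F :
  (forall i, P i -> pow2 k (F i)) -> pow2 k (\sum_(i <- r | P i) F i).
Proof.
by move=> h; apply: (big_ind (pow2 k)) => //; [exact: pow20|exact: pow2D].
Qed.

Lemma pow2_div k v m x : odd m -> pow2 (k + v) x -> pow2 k (x / (2 ^ v * m)%:R).
Proof.
move=> om [M [c [oM xM]]]; exists (M * m)%N, c; rewrite oddM oM om; split=> //.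
have m0 : m%:R != 0 :> rat by rewrite pnatr_eq0; case: m om.
have v0 : (2 : rat) ^+ v != 0 by rewrite expf_neq0.
rewrite !natrM natrX.
have -> : x / (2 ^+ v * m%:R) * (M%:R * m%:R) = (x * M%:R) / 2 ^+ v.
  by field; rewrite m0 v0.
by rewrite xM exprD; field.
Qed.

Lemma pow2_divn k n x : (0 < n)%N -> pow2 (k + logn 2 n) x -> pow2 k (x / n%:R).
Proof.
move=> n0; have [m om nE] := @pfactor_coprime 2 n isT n0 => h.
by rewrite nE mulnC; apply: pow2_div => //; rewrite -coprime2n.
Qed.

Lemma logn2_lt n : (0 < n)%N -> (logn 2 n < n)%N.
Proof. by move=> n0; apply: ltn_logl. Qed.

(** Legendre's formula: adding n / 2^(m+1) to the partial sum costs at most the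
    drop from n / 2^m to n / 2^(m+1), until the quotient has reached 1. *)
Lemma logn2_fact n : (0 < n)%N -> (logn 2 n`! < n)%N.
Proof.
move=> n0; rewrite logn_fact //.
suff h m : ((\sum_(1 <= k < m.+1) n %/ 2 ^ k) + maxn 1 (n %/ 2 ^ m) <= n)%N.
  by have := h n; lia.
elim: m => [|m IHm]; first by rewrite big_geq // expn0 divn1; lia.
rewrite big_nat_recr //= expnSr divnMA.
move: IHm; move: (\sum_(_ <= _ < _) _)%N (n %/ 2 ^ m)%N => S q.
lia.
Qed.

(** The factor 2 ^+ size w makes the condition multiplicative: no truncated
    subtraction of degrees is needed. *)
Definition pow2_series k (f : ncseries) :=
  forall w, pow2 k (f w * 2 ^+ size w).

Lemma pow2_ncmul j k f h :
  pow2_series j f -> pow2_series k h -> pow2_series (j + k) (ncmul f h).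
Proof.
move=> jf kh w; rewrite /ncmul mulr_suml; apply: pow2_sum => i _.
have -> : f (take i w) * h (drop i w) * 2 ^+ size w =
  (f (take i w) * 2 ^+ size (take i w)) * (h (drop i w) * 2 ^+ size (drop i w)).
  by rewrite mulrACA -exprD -size_cat cat_take_drop.
exact: pow2M.
Qed.

Lemma pow2_nc1 : pow2_series 0 nc1.
Proof.
move=> w; rewrite /nc1; case: eqP => [->|_]; last by rewrite mul0r; exact: pow20.
by have := pow2_int 0 1; rewrite expr0 mul1r.
Qed.

Lemma pow2_ncpow k f n : pow2_series k f -> pow2_series (n * k) (ncpow f n).
Proof.
move=> kf; elim: n => [|n IHn]; first exact: pow2_nc1.
by rewrite mulSn; apply: pow2_ncmul.
Qed.

Lemma pow2_ncexp b w : w != [::] -> pow2 1 (ncexp b w * 2 ^+ size w).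
Proof.
rewrite -size_eq0 -lt0n /ncexp; case: eqP => _ w0; last by rewrite mul0r; exact: pow20.
rewrite mulrC; apply: pow2_divn; first exact: fact_gt0.
apply: (@pow2_le _ (size w)); first exact: logn2_fact.
by have := pow2_int (size w) 1; rewrite mulr1.
Qed.

Lemma pow2_ncexp0 b : pow2_series 0 (ncexp b).
Proof.
move=> w; have [->|w0] := eqVneq w [::]; last exact: pow2_le (pow2_ncexp b w0).
by rewrite /ncexp /=; have := pow2_int 0 1; rewrite !expr0 fact0 invr1.
Qed.

Lemma pow2_expXexpY :
  pow2_series 1 (fun w => ncmul (ncexp false) (ncexp true) w - nc1 w).
Proof.
move=> w; have [->|w0] := eqVneq w [::].
  rewrite /ncmul big_ord_recl big_ord0 /ncexp /nc1 /= fact0 invr1.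
  by rewrite (_ : (_ + _ - _) * _ = 0) //; exact: pow20.
rewrite /nc1 (negbTE w0) subr0 /ncmul mulr_suml; apply: pow2_sum => i _.
have -> : ncexp false (take i w) * ncexp true (drop i w) * 2 ^+ size w =
  (ncexp false (take i w) * 2 ^+ size (take i w)) *
  (ncexp true (drop i w) * 2 ^+ size (drop i w)).
  by rewrite mulrACA -exprD -size_cat cat_take_drop.
have [t0|t0] := eqVneq (take i w) [::].
  apply: (@pow2M 0 1); first exact: pow2_ncexp0.
  by apply: pow2_ncexp; move: w0; rewrite -{1}(cat_take_drop i w) t0.
by apply: (@pow2M 1 0); [exact: pow2_ncexp|exact: pow2_ncexp0].
Qed.

(** The k-th power in the logarithm has coefficients in 2^(k - n) Z_(2) in
    degree n, and the division by k costs at most 2^(k - 1). *)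
Lemma pow2_CHseries : pow2_series 1 CHseries.
Proof.
move=> w; rewrite /CHseries /nclog mulr_suml big_seq; apply: pow2_sum => k.
rewrite mem_index_iota => /andP[k1 _].
have := pow2_ncpow k pow2_expXexpY w; rewrite muln1.
set c := ncpow _ _ _; move=> h.
have -> : (-1) ^+ k.-1 / k%:R * c * 2 ^+ size w
   = (-1) ^+ k.-1 * ((c * 2 ^+ size w) / k%:R).
  by field; rewrite pnatr_eq0 -lt0n.
rewrite -signr_odd; set y := _ / _.
have {h} : pow2 1 y.
  by apply: pow2_divn => //; apply: pow2_le h; rewrite add1n logn2_lt.
by case: odd => h; rewrite ?expr1 ?mulN1r ?expr0 ?mul1r //; exact: pow2N.
Qed.

(** * Low-degree components of the series *)

(** The big operators do not reduce; this recursive form does, and yields the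
    coefficients of the words of length 1, 2 and 4 by evaluation. *)
Fixpoint wordmul (f h : seq bool -> rat) (w : seq bool) : rat :=
  f [::] * h w + if w is b :: w' then wordmul (fun v => f (b :: v)) h w' else 0.

Lemma ncmulE f h : ncmul f h = wordmul f h.
Proof.
apply/funext => w; rewrite /ncmul; elim: w f => [|b w IHw] f.
  by rewrite big_ord_recl big_ord0.
by rewrite big_ord_recl /=; congr (_ + _); rewrite -IHw.
Qed.

Definition CHcoef (w : seq bool) : rat :=
  foldr (fun k s => (-1) ^+ k.-1 / k%:R *
      iter k (wordmul (fun v => wordmul (ncexp false) (ncexp true) v - nc1 v)) nc1 w + s)
    0 (iota 1 (size w)).

Lemma CHseriesE w : CHseries w = CHcoef w.
Proof.
rewrite /CHseries /nclog /CHcoef /index_iota subn1 /= unlock /=.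
rewrite /reducebig; elim: (iota 1 (size w)) => //= k s ->; congr (_ * _ + _).
by rewrite /ncpow; congr (iter _ _ _ _); rewrite !ncmulE; apply/funext => g; rewrite ncmulE.
Qed.


Lemma sum_tuple_cons (U : nmodType) n (F : seq bool -> U) :
  \sum_(w : n.+1.-tuple bool) F w = \sum_b \sum_(w : n.-tuple bool) F (b :: w).
Proof.
rewrite pair_big /=.
rewrite (reindex (fun p : bool * n.-tuple bool => cons_tuple p.1 p.2)) //=.
exists (fun w : n.+1.-tuple bool => (thead w, behead_tuple w)) => [[b w] _|w _] /=.
  by congr pair; apply: val_inj.
by apply: val_inj => /=; rewrite [in RHS](tuple_eta w).
Qed.

Lemma sum_tuple0 (U : nmodType) (F : seq bool -> U) :
  \sum_(w : 0.-tuple bool) F w = F [::].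
Proof.
rewrite (bigD1 [tuple]) //= big1 ?addr0 // => w /eqP []; exact: tuple0.
Qed.

Lemma pow2_common n : exists (M : nat) (c : seq bool -> int), odd M /\
  forall w, size w = n -> CHseries w * 2 ^+ n * M%:R = 2 * (c w)%:~R.
Proof.
pose D w := cid2 (let: ex_intro M (ex_intro c (conj o h)) := pow2_CHseries w in
  ex_intro2 (fun M : nat => odd M) (fun M : nat => exists c : int,
     CHseries w * 2 ^+ size w * M%:R = 2 ^+ 1 * c%:~R) M o (ex_intro _ c h)).
pose m w := s2val (D w); pose c w := s2valP' (D w).
have {}c w : exists c : int, CHseries w * 2 ^+ size w * (m w)%:R = 2 * c%:~R.
  by have [c0 h] := c w; exists c0; rewrite h expr1.
pose M := (\prod_(w : n.-tuple bool) m w)%N.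
have oM : odd M.
  by rewrite /M; elim/big_ind: _ => // [a b oa ob|w _]; [rewrite oddM oa|exact: (s2valP (D w))].
have h w : exists d : int, size w = n -> CHseries w * 2 ^+ n * M%:R = 2 * d%:~R.
  have [wn|wn] := eqVneq (size w) n; last by exists 0 => /eqP; rewrite (negbTE wn).
  have [d dE] := c w; have sw : size w == n by apply/eqP.
  exists (d * (\prod_(v : n.-tuple bool | v != Tuple sw) m v)%N%:Z) => _.
  rewrite /M (bigD1 (Tuple sw)) //= natrM mulrA.
  by rewrite -[X in 2 ^+ X]wn dE intrM -!mulrA -pmulrn.
exists M, (fun w => sval (cid (h w))); split=> // w; exact: (svalP (cid (h w))).
Qed.

Section CurlyBracket.
Variable V : uniformLieType.
Implicit Types x y z : V.

Lemma lieb4 x y : exists z, lieb x y = z *+ 4.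
Proof. by have [z ->] := lieb_uniform x y; exists z; rewrite scaler_nat. Qed.

(** One quarter of the Lie bracket, again a Lie bracket on V. Written with it,
    every bracket of the series contributes an explicit factor 4. *)
Definition cur x y : V := sval (cid (lieb4 x y)).

Lemma curE x y : lieb x y = cur x y *+ 4.
Proof. exact: (svalP (cid (lieb4 x y))). Qed.

Lemma cur_zmod_morphism x : zmod_morphism (cur x).
Proof.
move=> y y'; apply: (@mulrnI _ _ _ 4) => //.
by rewrite mulrnBl -!curE raddfB.
Qed.

HB.instance Definition _ x := GRing.isZmodMorphism.Build V V (cur x)
  (@cur_zmod_morphism x).

Lemma curC x y : cur y x = - cur x y.
Proof. by apply: (@mulrnI _ _ _ 4) => //; rewrite mulNrn -!curE liebC. Qed.

Lemma curxx x : cur x x = 0.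
Proof. by apply: (@mulrnI _ _ _ 4) => //; rewrite -curE liebxx mul0rn. Qed.

Lemma curDl x x' y : cur (x + x') y = cur x y + cur x' y.
Proof. by rewrite curC raddfD /= opprD -!(curC y). Qed.

Lemma curNl x y : cur (- x) y = - cur x y.
Proof. by rewrite curC raddfN /= -(curC y). Qed.

Lemma curMnl x y n : cur (x *+ n) y = cur x y *+ n.
Proof. by rewrite curC raddfMn /= -mulNrn -(curC y). Qed.

Lemma cur_ad x y z : cur (cur x y) z = cur x (cur y z) - cur y (cur x z).
Proof.
apply: (@mulrnI _ _ _ 16) => //.
have E a b c : lieb a (lieb b c) = cur a (cur b c) *+ 16.
  by rewrite !curE raddfMn /= -mulrnA.
rewrite mulrnBl -!E -lieb_ad !curE curMnl -mulrnA //.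
Qed.

Lemma eqm_cur k x x' y y' : eqm k x x' -> eqm k y y' -> eqm k (cur x y) (cur x' y').
Proof.
case=> a xE [b yE]; exists (cur a y + cur x' b).
rewrite mulrnDl -curMnl -xE -raddfMn -yE /= raddfB /= curDl curNl.
by rewrite addrA subrK.
Qed.

Fixpoint rcur x y (w : seq bool) : V :=
  if w is b :: w' then
    if w' is [::] then gen x y b else cur (gen x y b) (rcur x y w')
  else 0.

Lemma rnorm_rcur x y w : rnorm x y w = rcur x y w *+ 4 ^ (size w).-1.
Proof.
elim: w => [|b w IHw]; first by rewrite mul0rn.
case: w IHw => [|b' w] IHw; first by rewrite expn0.
rewrite [LHS]/= -/(rnorm x y (b' :: w)) IHw raddfMn /= curE -mulrnA.
by rewrite mulnC -expnSr.
Qed.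


Lemma CH_term1 x y z : CH_term 1 x y z -> z = x + y.
Proof.
move/CH_term_dynkin => [_ [N [e [N0 eE]]]]; rewrite muln1.
rewrite (sum_tuple_cons 0 (fun w => rnorm x y w *~ e w)) big_bool.
rewrite !(sum_tuple0 (fun w => rnorm x y (_ :: w) *~ e (_ :: w))).
have E b : e [:: b] = N%:Z.
  apply: (intr_inj (R := rat)); rewrite eE // CHseriesE.
  by rewrite (_ : CHcoef _ = 1) ?mulr1 ?pmulrn //; case: b; vm_compute.
by rewrite !E -!pmulrn /= -mulrnDl addrC => /(mulrnI N0).
Qed.

Lemma sum_words2 (U : nmodType) (F : seq bool -> U) :
  \sum_(w : 2.-tuple bool) F w =
  F [:: true; true] + F [:: true; false] + (F [:: false; true] + F [:: false; false]).
Proof.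
rewrite sum_tuple_cons big_bool; congr (_ + _);
  rewrite (sum_tuple_cons 0 (fun w => F (_ :: w))) big_bool;
  by rewrite !(sum_tuple0 (fun w => F [:: _, _ & w])).
Qed.

Lemma CH_term2 x y z : CH_term 2 x y z -> z = cur x y *+ 2.
Proof.
move/CH_term_dynkin => [_ [N [e [N0 eE]]]].
rewrite (sum_words2 (fun w => rnorm x y w *~ e w)) /= !liebxx !mul0rz add0r addr0.
have E1 : e [:: false; true] * 2 = N%:Z.
  apply: (intr_inj (R := rat)); rewrite intrM eE // CHseriesE.
  by rewrite (_ : CHcoef _ = 2^-1) ?mulfVK ?pmulrn //; vm_compute.
have E2 : e [:: true; false] * 2 = - N%:Z.
  apply: (intr_inj (R := rat)); rewrite intrM eE // CHseriesE intrN.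
  by rewrite (_ : CHcoef _ = - 2^-1) ?mulrN ?mulNr ?mulfVK ?pmulrn //; vm_compute.
move/(congr1 (fun u => u *~ 2)); rewrite mulrzDl -!mulrzA E1 E2.
rewrite mulrNz -mulNrz -(liebC y) -mulrzDl -mulr2n curE.
rewrite -!pmulrn -!mulrnA => h.
apply: (@mulrnI _ _ _ (N * 4)); first by rewrite muln_gt0 N0.
rewrite -[RHS]mulrnA (_ : N * 4 = N * 2 * (1 + 1))%N; last by lia.
by rewrite h; congr (_ *+ _); lia.
Qed.

(** The degree 4 component is - [y, [x, [x, y]]] / 24. Dynkin's formula spreads
    it over two words that are equal by the Jacobi identity and thereby loses a
    factor 2, which [Ad_mod4] cannot spare. *)
Lemma CH_term4 x y z : CH_term 4 x y z ->
  z *+ 3 = - cur y (cur x (cur x y)) *+ 8.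
Proof.
move/CH_term_dynkin => [_ [N [e [N0 eE]]]].
have sum4 (F : seq bool -> V) : \sum_(w : 4.-tuple bool) F w =
   \sum_a \sum_b (F [:: a; b; true; true] + F [:: a; b; true; false]
     + (F [:: a; b; false; true] + F [:: a; b; false; false])).
  rewrite sum_tuple_cons; apply: eq_bigr => a _.
  rewrite (sum_tuple_cons 2 (fun w => F (a :: w))); apply: eq_bigr => b _.
  by rewrite (sum_words2 (fun w => F [:: a, b & w])).
rewrite (sum4 (fun w => rnorm x y w *~ e w)) !big_bool /= !liebxx !raddf0 !mul0rz !add0r !addr0.
have E w k : size w = 4 -> CHcoef w = k%:~R / 12%:~R -> e w * 12 = N%:Z * k.
  move=> w4 wE; apply: (intr_inj (R := rat)); rewrite !intrM eE // CHseriesE wE.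
  by rewrite -mulrA mulfVK // -pmulrn.
move/(congr1 (fun u => u *~ 12)); rewrite !mulrzDl -!mulrzA.
rewrite (E [:: true; true; true; false] 0) // (E [:: true; true; false; true] 0) //.
rewrite (E [:: true; false; true; false] 1) // (E [:: true; false; false; true] 0) //.
rewrite (E [:: false; true; true; false] 0) // (E [:: false; true; false; true] (-1)) //.
rewrite (E [:: false; false; true; false] 0) // (E [:: false; false; false; true] 0) //.
all: try by vm_compute.
rewrite !mulr0 !mulr0z !add0r !addr0 mulr1 mulrN1 mulrNz.
have -> : lieb x (lieb y (lieb x y)) = lieb y (lieb x (lieb x y)).
  by apply/eqP; rewrite -subr_eq0 -lieb_ad liebxx.
rewrite -(opprK (lieb x (lieb y x))) -(raddfN (lieb x)) /= -(liebC y x).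
rewrite raddfN /= mulNrz -opprD -mulrzDl -mulr2n !curE !raddfMn /= -!pmulrn.
rewrite -!mulrnA => h.
apply: (@mulrnI _ _ _ (N * 16)); first by rewrite muln_gt0 N0.
rewrite -!mulrnA; transitivity (z *+ (N * 4 * 12)); first by congr (_ *+ _); lia.
by rewrite h; congr (_ *+ _); lia.
Qed.

(** Dynkin's formula loses a factor n, hence log n binary digits; the fourfold
    divisibility of the brackets wins 2 (n - 1) digits and the denominators of
    the series cost n - 1 of them. *)
Lemma CH_term_size n : (3 <= n)%N -> exists (M : nat) (c : seq bool -> int),
  odd M /\ forall x y z, CH_term n x y z ->
   z *+ M = (\sum_(w : n.-tuple bool) rcur x y w *~ c w) *+ 2 ^ maxn 2 (n./2).-1.
Proof.
move=> n3; have [->|n4] := eqVneq n 4.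
  exists 3, (fun w => if w == [:: true; false; false; true] then - 2 else 0).
  split=> // x y z /CH_term4 ->.
  have sw : size [:: true; false; false; true] == 4 by [].
  rewrite (bigD1 (Tuple sw)) //= big1 ?addr0 => [|w]; last first.
    by rewrite -val_eqE /= => /negbTE ->; rewrite mulr0z.
  by rewrite mulrNz -mulNrz -pmulrn -mulrnA.
have [M [c [oM cE]]] := pow2_common n.
have n0 : (0 < n)%N by lia.
have [m om nE] := @pfactor_coprime 2 n isT n0.
set v := logn 2 n in nE.
have v2 : (v <= n./2)%N.
  have : (2 ^ v <= n)%N by rewrite nE leq_pmull //; case: m om {nE}.
  case: v {nE} => // v; rewrite expnS => h.
  rewrite -ltnS; have := ltn_expl v (isT : 1 < 2)%N; lia.
have v3 : (v + 3 <= n)%N.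
  have : (2 ^ v <= n)%N by rewrite nE leq_pmull //; case: m om {nE}.
  move: nE; case: v {v2} => [|[|[|v]]]; rewrite ?expn0 ?expn1 ?expnS; try by lia.
  by have := ltn_expl v (isT : 1 < 2)%N; lia.
have ve : (maxn 2 (n./2).-1 + v <= n.-1)%N.
  by rewrite /maxn; case: ifP; lia.
set E := maxn _ _ in ve *.
exists (m * M)%N, (fun w => c w *+ 2 ^ (n.-1 - E - v)); split.
  by rewrite oddM oM andbT -coprime2n.
move=> x y z /CH_term_dynkin [_ [N [e [N0 eE zE]]]].
have ce w : size w = n -> e w * (2 ^ n.-1 * M)%N%:Z = c w * N%:Z.
  move=> wn; apply: (intr_inj (R := rat)); rewrite !intrM eE //.
  have := cE w wn; rewrite -{1}(prednK n0) exprS => h.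
  apply: (@mulfI _ (2 : rat)) => //.
  transitivity (N%:R * (CHseries w * (2 * 2 ^+ n.-1) * M%:R)); last by rewrite h -pmulrn; ring.
  rewrite -pmulrn natrM natrX; ring.
set W := \sum_(w : n.-tuple bool) _.
have zW : z *+ (N * n * M) = (\sum_(w : n.-tuple bool) rcur x y w *~ c w) *+ (N * 2 ^ n.-1).
  rewrite mulrnA zE -!sumrMnl; apply: eq_bigr => w _.
  apply: (@mulrnI _ _ _ (2 ^ n.-1)); first by rewrite expn_gt0.
  rewrite -mulrnA [LHS]pmulrn -mulrzA [(M * _)%N]mulnC ce ?size_tuple //.
  rewrite rnorm_rcur size_tuple mulrzA mulrnA [in RHS]mulrnAC.
  rewrite (_ : 4 ^ n.-1 = 2 ^ n.-1 * 2 ^ n.-1)%N; last by rewrite -expnMn.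
  by rewrite -!pmulrn mulrnA !(mulrnAC _ _ N) !(pmulrn _ N) !(pmulrn _ (2 ^ _)) -!mulrzA;
     congr (_ *~ _); lia.
have {}zW : z *+ (m * M) *+ (N * 2 ^ v) =
   (\sum_(w : n.-tuple bool) rcur x y w *~ c w) *+ 2 ^ (n.-1 - v) *+ (N * 2 ^ v).
  rewrite -!mulrnA; transitivity (z *+ (N * n * M)).
    by congr (_ *+ _); rewrite [in RHS]nE; lia.
  rewrite zW; congr (_ *+ _).
  by rewrite mulnCA -expnD; congr (_ * 2 ^ _)%N; lia.
have {}zW := mulrnI _ zW; rewrite {}zW; last by rewrite muln_gt0 N0 expn_gt0.
rewrite (_ : n.-1 - v = n.-1 - E - v + E)%N; last by lia.
rewrite expnD mulrnA; congr (_ *+ _); rewrite -sumrMnl; apply: eq_bigr => w _.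
by rewrite -mulr_natr natz mulrzA pmulrn.
Qed.

End CurlyBracket.

(** * Campbell-Hausdorff values modulo powers of two *)

Lemma eqm_nbhs (V : uniformLieType) k (z : V) :
  nbhs (z : ltop V) [set w : ltop V | eqm k (w : V) z].
Proof.
have h : nbhs (v2r z) [set M : 'rV[Z2]_(dim V) |
    forall i, res (M 0 i) k = res (v2r z 0 i) k].
  exists (fun i j => [set a | res a k = res (v2r z i j) k]).
    by move=> i j; exists k.
  by move=> M /= h i; apply: h.
have h2 : nbhs (z : ltop V) (fun w : ltop V => forall i,
    res (v2r (w : V) 0 i) k = res (v2r z 0 i) k).
  exact: (@initial_continuous _ _ (@v2r Z2 V) z _ h).
apply: filterS h2 => w /= hw.
by apply/(eqm_resP k w z).
Qed.

Section CHvalue.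
Variable V : uniformLieType.
Implicit Types x y z : V.

Lemma rcur_eqm k x x' y y' w : eqm k x x' -> eqm k y y' ->
  eqm k (rcur x y w) (rcur x' y' w).
Proof.
move=> hx hy; elim: w => [|b w IHw]; first exact: eqm_refl.
by case: w IHw => [|b' w] IHw; [case: b|apply: eqm_cur => //; case: b].
Qed.

Lemma rcurMn x y a w : rcur (x *+ a) (y *+ a) w = rcur x y w *+ a ^ size w.
Proof.
have gE b : gen (x *+ a) (y *+ a) b = gen x y b *+ a by case: b.
elim: w => [|b w IHw]; first by rewrite mul0rn.
case: w IHw => [|b' w] IHw; first by rewrite expn1 /= gE.
by rewrite [LHS]/= -/(rcur _ _ (b' :: w)) IHw gE raddfMn /= curMnl -mulrnA -expnS.
Qed.

Lemma rcur_commuting x y w : cur x y = 0 -> (2 <= size w)%N -> rcur x y w = 0.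
Proof.
move=> xy; elim: w => [|b w IHw] //.
case: w IHw => [|b' [|b'' w]] IHw // _; last first.
  by rewrite [LHS]/= -/(rcur _ _ (b'' :: w)) -/(rcur x y [:: b', b'' & w]) IHw // raddf0.
by case: b; case: b' {IHw} => /=; rewrite ?curxx ?xy // curC xy oppr0.
Qed.

Definition CH_words x y (c : seq bool -> int) n : V :=
  (\sum_(w : n.-tuple bool) rcur x y w *~ c w) *+ 2 ^ maxn 2 (n./2).-1.

Definition CH_poly k x y (c : seq bool -> int) : V :=
  x + y + cur x y *+ 2 + \sum_(3 <= n < k.*2 + 3) CH_words x y c n.

(** The component of degree n is divisible by 2^(n/2 - 1), uniformly in the
    arguments; hence finitely many degrees count modulo 2^k, and the odd
    denominators left in them can be inverted. *)
Lemma CH_mod k : exists c : seq bool -> int,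
  forall x y z, CH_value x y z -> eqm k z (CH_poly k x y c).
Proof.
have cP n : exists c : seq bool -> int, (3 <= n)%N -> forall x y z, CH_term n x y z ->
    eqm k z (CH_words x y c n).
  have [n3|] := leqP 3 n; last by exists (fun=> 0).
  have [M [c [oM cP]]] := CH_term_size V n3.
  have [i iP] := @odd_inverse V M k oM.
  exists (fun w => c w * i) => _ x y z /cP /iP.
  rewrite pmulrn -mulrzA mulrC mulrzA -pmulrn mulrz_suml => h; apply: (eqm_trans h).
  apply: eqm_eq; congr (_ *+ _).
  by apply: eq_bigr => w _; rewrite mulrzA.
pose c w := sval (cid (cP (size w))) w; exists c => x y z [u [uP uz]].
have uE n : (3 <= n)%N -> eqm k (u n) (CH_words x y c n).
  move=> n3; have := svalP (cid (cP n)) n3 _ _ _ (uP n).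
  move=> h; apply: (eqm_trans h); apply: eqm_eq; congr (_ *+ _); apply: eq_bigr => w _.
  by rewrite /c size_tuple.
have [N _ NP] := uz _ (eqm_nbhs k z).
pose N1 := maxn N (k.*2 + 3).
have /= h := NP N1 (leq_maxl _ _).
apply: (eqm_trans (eqm_sym h)) => {h NP uz}.
have N13 : (k.*2 + 3 <= N1)%N by rewrite leq_maxr.
rewrite (@big_cat_nat _ _ _ (k.*2 + 3)) //=.
apply: eqm_trans; first apply: eqm_addr.
  rewrite big_nat; apply: (big_ind (fun s => eqm k s 0)) => [|a b ha hb|n].
  - exact: eqm_refl.
  - by rewrite -[0]addr0; apply: eqmD.
  - move=> /andP[kn _]; apply: (eqm_trans (uE n _)); first by lia.
    by apply: eqm_dvd; rewrite /maxn; case: ifP; lia.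
rewrite big_ltn; last by lia.
rewrite big_ltn; last by lia.
rewrite big_ltn; last by lia.
rewrite (proj1 (CH_term_dynkin (uP 0%N))) // add0r.
rewrite (CH_term1 (uP 1%N)) (CH_term2 (uP 2%N)) /CH_poly addrA.
apply: eqmD; first exact: eqm_refl.
rewrite big_nat [X in eqm k _ X]big_nat; apply: eqm_sum => n /andP[n3 _].
exact: uE.
Qed.

Lemma CH_words_eqm k x y x' y' c n :
  eqm k x x' -> eqm k y y' -> eqm k (CH_words x y c n) (CH_words x' y' c n).
Proof.
by move=> hx hy; apply: eqmMn; apply: eqm_sum => w _; apply: eqmMz; apply: rcur_eqm.
Qed.

Lemma CH_value_eqm k x y z x' y' z' : eqm k x x' -> eqm k y y' ->
  CH_value x y z -> CH_value x' y' z' -> eqm k z z'.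
Proof.
move=> hx hy; have [c cP] := CH_mod k => /cP hz /cP hz'.
apply: (eqm_trans hz); apply: eqm_trans (eqm_sym hz').
apply: eqmD; last by apply: eqm_sum => n _; apply: CH_words_eqm.
by apply: eqmD; [apply: eqmD|apply: eqmMn; apply: eqm_cur].
Qed.

Lemma CH_value_commuting x y z : cur x y = 0 -> CH_value x y z -> z = x + y.
Proof.
move=> xy zP; apply: eqm_separated => k; have [c cP] := CH_mod k.
apply: (eqm_trans (cP _ _ _ zP)); apply: eqm_eq.
rewrite /CH_poly xy mul0rn addr0 big_nat big1 ?addr0 // => n /andP[n3 _].
rewrite /CH_words big1 ?mul0rn // => w _.
by rewrite rcur_commuting ?mul0rz // size_tuple; lia.
Qed.

Lemma CH_value_mod4 x y z : CH_value x y z -> eqm 2 z (x + y + cur x y *+ 2).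
Proof.
have [c cP] := CH_mod 2 => /cP h; apply: (eqm_trans h).
apply: eqm_addr; apply: (big_ind (fun s => eqm 2 s 0)) => [|a b ha hb|n _].
- exact: eqm_refl.
- by rewrite -[0]addr0; apply: eqmD.
- by apply: eqm_dvd; rewrite leq_max leqnn.
Qed.

Lemma CH_words_Mn a x y c n :
  CH_words (x *+ a) (y *+ a) c n = CH_words x y c n *+ a ^ n.
Proof.
rewrite /CH_words mulrnAC; congr (_ *+ _); rewrite -sumrMnl; apply: eq_bigr => w _.
by rewrite rcurMn size_tuple !pmulrn -!mulrzA mulrC.
Qed.

(** Rescaling by 2^m separates the degrees of the series. *)
Lemma CH_value_scale m x y z : CH_value (x *+ 2 ^ m) (y *+ 2 ^ m) z ->
  eqm (3 * m) z ((x + y) *+ 2 ^ m + cur x y *+ 2 ^ (m * 2 + 1)).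
Proof.
have [c cP] := CH_mod (3 * m) => /cP h; apply: (eqm_trans h).
apply: eqm_trans; first apply: eqm_addr.
  rewrite big_nat; apply: (big_ind (fun s => eqm (3 * m) s 0)) => [|a b ha hb|n /andP[n3 _]].
  - exact: eqm_refl.
  - by rewrite -[0]addr0; apply: eqmD.
  - by rewrite CH_words_Mn -expnM; apply: eqm_dvd; rewrite mulnC leq_mul2l n3 orbT.
apply: eqm_eq; rewrite mulrnDl raddfMn /= curMnl -!mulrnA; congr (_ + _ *+ _).
by rewrite mulnA -expnD -expnSr; congr (2 ^ _)%N; lia.
Qed.

(** The Lie polynomial functions for the bracket [cur], as a predicate on
    functions: closure properties and congruences are all that matters. *)
Inductive lie2 : (V -> V -> V) -> Prop :=
| lie2_X : lie2 (fun x y => x)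
| lie2_Y : lie2 (fun x y => y)
| lie2_0 : lie2 (fun x y => 0)
| lie2_D f g : lie2 f -> lie2 g -> lie2 (fun x y => f x y + g x y)
| lie2_N f : lie2 f -> lie2 (fun x y => - f x y)
| lie2_br f g : lie2 f -> lie2 g -> lie2 (fun x y => cur (f x y) (g x y)).

Lemma lie2_ext f g : (forall x y, f x y = g x y) -> lie2 f -> lie2 g.
Proof. by move=> fg; have -> : g = f by apply/funext => x; apply/funext => y. Qed.

Lemma lie2_Mn f n : lie2 f -> lie2 (fun x y => f x y *+ n).
Proof.
move=> hf; elim: n => [|n IHn]; first exact: lie2_0.
by apply: lie2_ext (lie2_D hf IHn) => x y /=; rewrite mulrS.
Qed.

Lemma lie2_eqm k f x y x' y' : lie2 f -> eqm k x x' -> eqm k y y' ->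
  eqm k (f x y) (f x' y').
Proof.
move=> hf hx hy; elim: hf => {f} //=.
- exact: eqm_refl.
- by move=> f g _ hf _ hg; apply: eqmD.
- by move=> f _; apply: eqmN.
- by move=> f g _ hf _ hg; apply: eqm_cur.
Qed.

Lemma lie2_comp f g h : lie2 f -> lie2 g -> lie2 h ->
  lie2 (fun x y => f (g x y) (h x y)).
Proof.
move=> hf hg hh; elim: hf => {f} //=.
- exact: lie2_0.
- by move=> f1 f2 _ ? _ ?; apply: lie2_D.
- by move=> f _; apply: lie2_N.
- by move=> f1 f2 _ ? _ ?; apply: lie2_br.
Qed.

(** The Lie polynomials without linear terms: by the Jacobi identity each of
    them is a bracket of x plus a bracket of y, which is the shape that a
    conjugation of x and one of y can absorb. *)
Definition br2 (f : V -> V -> V) := exists P Q, [/\ lie2 P, lie2 Q &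
  forall x y, f x y = cur x (P x y) + cur y (Q x y)].

Lemma br2_ext f g : (forall x y, f x y = g x y) -> br2 f -> br2 g.
Proof. by move=> fg; have -> : g = f by apply/funext => x; apply/funext => y. Qed.

Lemma br2_lie2 f : br2 f -> lie2 f.
Proof.
move=> [P [Q [hP hQ fE]]]; apply: lie2_ext (lie2_D (lie2_br lie2_X hP) (lie2_br lie2_Y hQ)).
by move=> x y; rewrite fE.
Qed.

Lemma br2_0 : br2 (fun _ _ => 0).
Proof.
exists (fun _ _ => 0), (fun _ _ => 0); split; try exact: lie2_0.
by move=> x y; rewrite !raddf0 addr0.
Qed.

Lemma br2_D f g : br2 f -> br2 g -> br2 (fun x y => f x y + g x y).
Proof.
move=> [P [Q [hP hQ fE]]] [P' [Q' [hP' hQ' gE]]].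
exists (fun x y => P x y + P' x y), (fun x y => Q x y + Q' x y).
split; try exact: lie2_D.
by move=> x y; rewrite fE gE !raddfD addrACA.
Qed.

Lemma br2_N f : br2 f -> br2 (fun x y => - f x y).
Proof.
move=> [P [Q [hP hQ fE]]].
exists (fun x y => - P x y), (fun x y => - Q x y); split; try exact: lie2_N.
by move=> x y; rewrite fE !raddfN opprD.
Qed.

Lemma br2_Mn f n : br2 f -> br2 (fun x y => f x y *+ n).
Proof.
move=> hf; elim: n => [|n IHn]; first exact: br2_0.
by apply: br2_ext (br2_D hf IHn) => x y /=; rewrite mulrS.
Qed.

Lemma br2_Mz f n : br2 f -> br2 (fun x y => f x y *~ n).
Proof.
case: n => n hf; first exact: br2_Mn.
apply: br2_ext (br2_N (br2_Mn n.+1 hf)) => x y /=.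
by rewrite NegzE mulrNz.
Qed.

Lemma br2_sum (I : Type) (r : seq I) (P : pred I) (F : I -> V -> V -> V) :
  (forall i, P i -> br2 (F i)) -> br2 (fun x y => \sum_(i <- r | P i) F i x y).
Proof.
move=> h; elim: r => [|i r IHr].
  by apply: br2_ext br2_0 => x y; rewrite big_nil.
case: (boolP (P i)) => Pi.
  by apply: br2_ext (br2_D (h _ Pi) IHr) => x y; rewrite big_cons Pi.
by apply: br2_ext IHr => x y; rewrite big_cons (negbTE Pi).
Qed.

Lemma br2_cur f g : lie2 f -> lie2 g -> br2 (fun x y => cur (f x y) (g x y)).
Proof.
move=> hf; elim: hf g => {f} /=.
- move=> g hg; exists g, (fun _ _ => 0); split=> //; first exact: lie2_0.
  by move=> x y; rewrite raddf0 addr0.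
- move=> g hg; exists (fun _ _ => 0), g; split=> //; first exact: lie2_0.
  by move=> x y; rewrite raddf0 add0r.
- by move=> g hg; apply: br2_ext br2_0 => x y; rewrite curC raddf0 oppr0.
- move=> f1 f2 _ h1 _ h2 g hg; apply: br2_ext (br2_D (h1 g hg) (h2 g hg)) => x y.
  by rewrite curDl.
- by move=> f _ h g hg; apply: br2_ext (br2_N (h g hg)) => x y; rewrite curNl.
- move=> f1 f2 l1 h1 l2 h2 g hg.
  apply: br2_ext (br2_D (h1 _ (lie2_br l2 hg)) (br2_N (h2 _ (lie2_br l1 hg)))) => x y.
  by rewrite cur_ad.
Qed.

Lemma lie2_rcur w : lie2 (fun x y => rcur x y w).
Proof.
have lg b : lie2 (fun x y => gen x y b) by case: b; [exact: lie2_Y|exact: lie2_X].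
elim: w => [|b [|b' w] IHw]; [exact: lie2_0|exact: lg|exact: lie2_br].
Qed.

Lemma br2_rcur w : (2 <= size w)%N -> br2 (fun x y => rcur x y w).
Proof.
have lg b : lie2 (fun x y => gen x y b) by case: b; [exact: lie2_Y|exact: lie2_X].
case: w => [|b [|b' w]] // _; apply: br2_cur; first exact: lg.
exact: (lie2_rcur (b' :: w)).
Qed.

(** Doubled arguments contribute 2^n in degree n, which makes everything beyond
    the quadratic term divisible by 16. *)
Lemma CH_value_half k : exists F, br2 F /\
  forall x y z, CH_value (x *+ 2) (y *+ 2) z ->
    eqm k.+1 z ((x + y + cur x y *+ 4 + F x y *+ 8) *+ 2).
Proof.
have [c cP] := CH_mod k.+1.
exists (fun x y => \sum_(3 <= n < k.+1.*2 + 3) (if (3 <= n)%N then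
   (\sum_(w : n.-tuple bool) rcur x y w *~ c w) *+ 2 ^ (n + maxn 2 (n./2).-1 - 4) else 0)).
split.
  apply: br2_sum => n _; case: (leqP 3 n) => n3; last exact: br2_0.
  apply: br2_Mn; apply: br2_sum => w _; apply: br2_Mz; apply: br2_rcur.
  by rewrite size_tuple ltnW.
move=> x y z /cP h; apply: (eqm_trans h); apply: eqm_eq.
rewrite /CH_poly raddfMn /= curMnl.
set S := \sum_(3 <= n < _) (if _ then _ else _).
rewrite (mulrnDl 2 (x + y + _)) (mulrnDl 2 (x + y)) (mulrnDl 2 x) -!mulrnA; congr (_ + _).
rewrite /S -sumrMnl big_nat [RHS]big_nat; apply: eq_bigr => n /andP[n3 _].
rewrite n3 CH_words_Mn /CH_words -!mulrnA; congr (_ *+ _).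
rewrite -[(8 * 2)%N]/(2 ^ 4)%N -!expnD; congr (2 ^ _)%N.
by rewrite /maxn; case: ifP; lia.
Qed.

End CHvalue.

Arguments lie2_X {V}.
Arguments lie2_Y {V}.
Arguments lie2_0 {V}.
Arguments br2_0 {V}.

(** * The adjoint action *)

Section Adjoint.
Variables (V : uniformLieType) (G : topGroupType) (exp : V -> G) (log : G -> V).
Hypothesis chart : lie_chart exp log.
Implicit Types (x y z a : V) (g h : G).

Local Notation mul x y := (log (exp x * exp y)%g).
Local Notation Ad := (Ad exp log).

Lemma expK x : log (exp x) = x.
Proof. by case: chart => [[eK _] _ _ _]; apply: eK. Qed.

Lemma logK g : exp (log g) = g.
Proof. by case: chart => [[_ lK] _ _ _]; apply: lK. Qed.

Lemma mulCH x y : CH_value x y (mul x y).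
Proof. by case: chart. Qed.

Lemma mul_commuting x y : cur x y = 0 -> exp (x + y) = (exp x * exp y)%g.
Proof. by move=> xy; rewrite -[RHS]logK (CH_value_commuting xy (mulCH x y)). Qed.

Lemma exp0 : exp 0 = 1%g.
Proof.
have := mul_commuting (curxx (0 : V)); rewrite addr0 => h.
by apply: (mulgI (exp 0)); rewrite mulg1.
Qed.

Lemma expN x : exp (- x) = (exp x)^-1%g.
Proof.
have := @mul_commuting x (- x); rewrite raddfN /= curxx oppr0 subrr exp0 => h.
by apply: (mulgI (exp x)); rewrite mulgV -h.
Qed.

Lemma expMn x n : exp (x *+ n) = (exp x ^+ n)%g.
Proof.
elim: n => [|n IHn]; first by rewrite exp0.
rewrite mulrS expgS -IHn mul_commuting // raddfMn /= curxx mul0rn //.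
Qed.

Lemma log1 : log 1%g = 0.
Proof. by rewrite -exp0 expK. Qed.

Lemma exp_Ad h x : exp (Ad h x) = (h * exp x * h^-1)%g.
Proof. exact: logK. Qed.

Lemma Ad1 x : Ad 1%g x = x.
Proof. by rewrite /Defs.Ad mul1g invg1 mulg1 expK. Qed.

Lemma AdM g h x : Ad (g * h)%g x = Ad g (Ad h x).
Proof. by rewrite /Defs.Ad logK invgM !mulgA. Qed.

Lemma AdK h : cancel (Ad h) (Ad h^-1%g).
Proof. by move=> x; rewrite -AdM mulVg Ad1. Qed.

Lemma AdVK h : cancel (Ad h^-1%g) (Ad h).
Proof. by move=> x; rewrite -AdM mulgV Ad1. Qed.

Lemma expg_conj h g n : ((h * g * h^-1) ^+ n = h * g ^+ n * h^-1)%g.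
Proof.
elim: n => [|n IHn]; first by rewrite !expg0 mulg1 mulgV.
by rewrite !expgS IHn !mulgA -[(h * g * h^-1 * h)%g]mulgA mulVg mulg1.
Qed.

Lemma AdMn h x n : Ad h (x *+ n) = Ad h x *+ n.
Proof.
apply: (can_inj expK).
by rewrite exp_Ad !expMn exp_Ad expg_conj.
Qed.

Lemma Ad_mul h x y : Ad h (mul x y) = mul (Ad h x) (Ad h y).
Proof.
rewrite /Defs.Ad !logK; congr log.
by rewrite !mulgA -[(h * exp x * h^-1 * h)%g]mulgA mulVg mulg1.
Qed.

Lemma Ad_exp a x : Ad (exp a) x = mul (mul a x) (- a).
Proof. by rewrite /Defs.Ad logK expN. Qed.

Lemma mul_eqm k x y x' y' : eqm k x x' -> eqm k y y' -> eqm k (mul x y) (mul x' y').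
Proof. by move=> hx hy; apply: (CH_value_eqm hx hy); exact: mulCH. Qed.

Lemma Ad_eqm k h x y : eqm k x y -> eqm k (Ad h x) (Ad h y).
Proof.
move=> xy; rewrite -[h]logK !Ad_exp; apply: mul_eqm; last exact: eqm_refl.
by apply: mul_eqm => //; exact: eqm_refl.
Qed.

Lemma mul_scale m x y : eqm (m * 2) (mul (x *+ 2 ^ m) (y *+ 2 ^ m)) ((x + y) *+ 2 ^ m).
Proof.
apply: (@eqm_trans _ _ ((x + y) *+ 2 ^ m + cur x y *+ 2 ^ (m * 2 + 1))).
  by apply: (@eqm_le _ (3 * m)); [lia|exact: CH_value_scale (mulCH _ _)].
by apply: eqm_addr; apply: eqm_dvd; lia.
Qed.

(** Addition is the limit of the rescaled group law, which conjugation
    respects. *)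
Lemma AdD h x y : Ad h (x + y) = Ad h x + Ad h y.
Proof.
apply: eqm_separated => m; apply: (@eqm_div _ _ m); rewrite addnn -muln2.
rewrite -AdMn; apply: eqm_trans (mul_scale _ _ _).
by rewrite -!AdMn -Ad_mul; apply: Ad_eqm; apply: eqm_sym; apply: mul_scale.
Qed.

Lemma Ad_zmod_morphism h : zmod_morphism (Ad h).
Proof.
move=> x y; apply: (@addIr _ (Ad h y)).
by rewrite -AdD !subrK.
Qed.

HB.instance Definition _ h := GRing.isZmodMorphism.Build V V (Ad h)
  (@Ad_zmod_morphism h).

(** Modulo 4 only the terms of degree at most two of the series survive, and the
    two contributions of the quadratic term add up to a multiple of 4. *)
Lemma Ad_mod4 a x : eqm 2 (Ad (exp a) x) x.
Proof.
rewrite Ad_exp; have h := CH_value_mod4 (mulCH a x).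
apply: (eqm_trans (CH_value_mod4 (mulCH _ _))).
set u := a + x + cur a x *+ 2 in h.
apply: (@eqm_trans _ _ (u - a + cur u (- a) *+ 2)).
  apply: eqmD; first by apply: eqmD => //; exact: eqm_refl.
  by apply: eqmMn; apply: eqm_cur => //; exact: eqm_refl.
set d := cur a x in u h *; pose c := cur d a.
have -> : u - a = x + d *+ 2 by rewrite /u -addrA [d *+ 2 - a]addrC addrA [a + x]addrC addrK.
have -> : cur u (- a) = d - c *+ 2.
  by rewrite raddfN /= /u (curDl (a + x)) (curDl a) curxx add0r curMnl (curC a x) opprD opprK.
exists (d - c); rewrite addrAC (addrC x) addrK.
by rewrite !mulrnBl -mulrnA addrA -mulrnDr.
Qed.

(** Since Ad is additive, x may be rescaled together with a, so that the terms
    of degree three and more become negligible. *)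
Lemma Ad_first_order m a x :
  eqm (m * 2) (Ad (exp (a *+ 2 ^ m)) x) (x + cur a x *+ 2 ^ (m + 2)).
Proof.
have [->|m0] := posnP m; first exact: eqm_0.
apply: (@eqm_div _ _ m); rewrite -AdMn Ad_exp -mulNrn.
have h := CH_value_scale (mulCH (a *+ 2 ^ m) (x *+ 2 ^ m)).
set v := mul _ _ in h *.
have [w vE wE] : exists2 w, v = w *+ 2 ^ m &
    eqm (m * 2) w (a + x + cur a x *+ 2 ^ (m + 1)).
  case: h => t tE.
  exists (a + x + cur a x *+ 2 ^ (m + 1) + t *+ 2 ^ (m * 2)).
    rewrite (mulrnDl _ (a + x + _)) (mulrnDl _ (a + x)) -!mulrnA -!expnD.
    apply/eqP; rewrite addrC -subr_eq; apply/eqP.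
    rewrite (_ : m * 2 + m = 3 * m)%N; last by lia.
    by rewrite -tE (_ : m + 1 + m = m * 2 + 1)%N; last by lia.
  by apply: eqm_addr; apply: eqm_dvd.
rewrite {}vE; apply: (@eqm_trans _ _ ((w - a) *+ 2 ^ m + cur w (- a) *+ 2 ^ (m * 2 + 1))).
  by apply: (@eqm_le _ (3 * m)); [lia|exact: CH_value_scale (mulCH _ _)].
apply: (@eqm_trans _ _
   ((x + cur a x *+ 2 ^ (m + 1)) *+ 2 ^ m + cur a x *+ 2 ^ (m * 2 + 1))).
  apply: eqmD.
    apply: eqm_mul; apply: (eqm_trans (eqmB wE (eqm_refl _ a))); apply: eqm_eq.
    by rewrite -addrA [_ - a]addrC addrA [a + x]addrC addrK.
  apply: (@eqm_le _ (m + 1 + (m * 2 + 1))); first by lia.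
  apply: eqm_mul; apply: (@eqm_trans _ _ (cur (a + x) (- a))).
    apply: eqm_cur; last exact: eqm_refl.
    apply: (@eqm_trans _ _ (a + x + cur a x *+ 2 ^ (m + 1))).
      by apply: eqm_le wE; lia.
    by apply: eqm_addr; apply: eqm_dvd.
  by apply: eqm_eq; rewrite raddfN /= curDl curxx add0r (curC a x) opprK.
apply: eqm_eq; rewrite !(mulrnDl _ x) -!mulrnA -!expnD -addrA -mulrnDr.
congr (_ + _ *+ _); rewrite (_ : m + 1 + m = m * 2 + 1)%N; last by lia.
by rewrite addnn -mul2n -expnS; congr (2 ^ _)%N; lia.
Qed.

Lemma Ad_divisible a x : exists y, Ad (exp a) x - x = y *+ 4.
Proof. exact: Ad_mod4. Qed.

(** The operator B(a) with Ad (exp a) = 1 + 4 B(a). *)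
Definition AdB a x : V := sval (cid (Ad_divisible a x)).

Lemma AdBE a x : Ad (exp a) x = x + AdB a x *+ 4.
Proof. by rewrite -(svalP (cid (Ad_divisible a x))) addrC subrK. Qed.

Lemma AdB_zmod_morphism a : zmod_morphism (AdB a).
Proof.
move=> x y; apply: (@mulrnI _ _ _ 4) => //; rewrite mulrnBl.
apply: (@addrI _ (x - y)); rewrite -AdBE raddfB /= !AdBE opprD.
by rewrite addrACA.
Qed.

HB.instance Definition _ a := GRing.isZmodMorphism.Build V V (AdB a)
  (@AdB_zmod_morphism a).

Lemma AdB_eqm k a x y : eqm k x y -> eqm k (AdB a x) (AdB a y).
Proof. by case=> z xy; exists (AdB a z); rewrite -raddfB xy raddfMn. Qed.

Lemma Ad_expMn n a x : Ad (exp (a *+ n)) x = iter n (Ad (exp a)) x.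
Proof.
elim: n => [|n IHn]; first by rewrite exp0 Ad1.
by rewrite expMn expgS AdM iterS -IHn expMn.
Qed.

Lemma iter_Ad_binomial n a x :
  iter n (Ad (exp a)) x = \sum_(i < n.+1) iter i (AdB a) x *+ ('C(n, i) * 4 ^ i).
Proof.
elim: n => [|n IHn]; first by rewrite big_ord_recl big_ord0 addr0.
rewrite iterS AdBE IHn raddf_sum /=.
rewrite big_ord_recl [in RHS]big_ord_recl -addrA; congr (_ + _).
  by rewrite !bin0.
rewrite [in RHS]big_ord_recr /= [X in _ + X *+ _]big_ord_recr /= mulrnDl addrA.
rewrite -sumrMnl -big_split /=; congr (_ + _); last first.
  rewrite raddfMn /= -mulrnA -iterS binn expnSr -mulnA; congr (_ *+ (_ * _)).
  by rewrite binn.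
apply: eq_bigr => i _; rewrite /bump /= !add1n raddfMn /= -mulrnA -mulrnDr.
by congr (_ *+ _); rewrite binS expnS; lia.
Qed.

(** Comparing Ad (exp (2^m a)) to first order with the 2^m-th power of
    1 + 4 B(a): in the binomial expansion each term of index at least two gains
    a factor 2 over the linear term. *)
Lemma AdB_equation k : exists (n : nat) (r : nat -> nat), forall a x,
  eqm k (AdB a x + (\sum_(2 <= i < n) iter i (AdB a) x *+ r i) *+ 2) (cur a x).
Proof.
(* The first-order formula is valid to 2 m digits, of which m + 2 are cancelled. *)
have [m mk] : exists m, m = k.+2 by exists k.+2.
have rP i : exists r, (2 <= i)%N -> ('C(2 ^ m, i) * 4 ^ i = r * (8 * 2 ^ m))%N.
  have [i2|] := leqP 2 i; last by exists 0%N.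
  suff /dvdnP [r rE] : (8 * 2 ^ m %| 'C(2 ^ m, i) * 4 ^ i)%N by exists r.
  case: i i2 => // i i2; have [j oj iE] := @pfactor_coprime 2 i.+1 isT isT.
  have vi : (logn 2 i.+1 + 3 <= i.+1 * 2)%N.
    by have := @ltn_logl 2 i.+1 isT; lia.
  have : (8 * 2 ^ m * 2 ^ (logn 2 i.+1) %| i.+1 * 'C(2 ^ m, i.+1) * 4 ^ i.+1)%N.
    rewrite -mul_bin_diag [X in (_ %| X)%N]mulnAC dvdn_mulr //.
    rewrite [(8 * _)%N]mulnC -mulnA dvdn_mul // -[8%N]/(2 ^ 3)%N -expnD.
    by rewrite -[4%N]/(2 ^ 2)%N -expnM dvdn_exp2l //; lia.
  rewrite {2}iE -!mulnA [(2 ^ _ * ('C(_, _) * _))%N]mulnC !mulnA dvdn_pmul2r ?expn_gt0 //.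
  by rewrite -mulnA Gauss_dvdr // coprimeMl !coprimeXl // -[8%N]/(2 ^ 3)%N coprimeXl.
pose r i := sval (cid (rP i)); exists (2 ^ m).+1, r => a x.
have rE i : (2 <= i)%N -> ('C(2 ^ m, i) * 4 ^ i = r i * (8 * 2 ^ m))%N.
  exact: (svalP (cid (rP i))).
apply: (@eqm_div _ _ (m + 2)).
have := Ad_first_order m a x; rewrite Ad_expMn iter_Ad_binomial.
rewrite -(big_mkord xpredT (fun i => iter i (AdB a) x *+ ('C(2 ^ m, i) * 4 ^ i))).
have m1 : (1 < 2 ^ m)%N by rewrite -[1%N]/(2 ^ 0)%N ltn_exp2l // mk.
rewrite big_ltn; last by lia.
rewrite big_ltn; last by lia.
rewrite bin0 bin1 expn0 expn1 muln1 /= (_ : 2 ^ m * 4 = 2 ^ (m + 2))%N; last by rewrite expnD.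
rewrite (_ : \sum_(2 <= i < _) _ =
   (\sum_(2 <= i < (2 ^ m).+1) iter i (AdB a) x *+ r i) *+ 2 *+ 2 ^ (m + 2)); last first.
  rewrite -!sumrMnl big_nat [RHS]big_nat; apply: eq_bigr => i /andP[i2 _].
  rewrite rE // -!mulrnA; congr (_ *+ _).
  by rewrite expnD; congr (_ * _)%N; lia.
rewrite mulr1n -mulrnDl => h; apply: (@eqm_le _ (m * 2)); first by lia.
have := eqmB h (eqm_refl (m * 2) x).
by rewrite ![x + _]addrC !addrK.
Qed.

(** Solves the previous equation for B by iteration, each round of which gains a
    factor 2. This stands in for Ad (exp a) = exp (ad a), of which only the
    linear term and the size and shape of the rest are needed. *)
Lemma AdB_lie k : exists F, lie2 F /\ forall a x,
  eqm k (AdB a x) (cur a x + cur a (cur a (F a x)) *+ 2).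
Proof.
have [n [r rP]] := AdB_equation k.
suff h i : (i <= k)%N -> exists F, lie2 F /\ forall a x,
    eqm i (AdB a x) (cur a x + cur a (cur a (F a x)) *+ 2) by apply: h.
elim: i => [|i IHi] ik.
  by exists (fun _ _ => 0); split; [exact: lie2_0|move=> a x; exact: eqm_0].
have [F [lF FE]] := IHi (ltnW ik).
pose gam a x := x + cur a (F a x) *+ 2.
have lgam : lie2 gam by apply: lie2_D; [exact: lie2_Y|apply/lie2_Mn/lie2_br => //; exact: lie2_X].
have FE' a x : eqm i (AdB a x) (cur a (gam a x)).
  by apply: (eqm_trans (FE a x)); rewrite /gam raddfD raddfMn; exact: eqm_refl.
pose bet j := iter j (fun f a x => cur a (gam a (f a x))) (fun a x => x).
have lbet j : lie2 (bet j).
  elim: j => [|j IHj]; first exact: lie2_Y.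
  have h := lie2_comp lgam lie2_X IHj.
  exact: (lie2_ext _ (lie2_br lie2_X h)).
have betE j a x : eqm i (iter j (AdB a) x) (bet j a x).
  elim: j => [|j IHj]; first exact: eqm_refl.
  exact: (eqm_trans (AdB_eqm a IHj) (FE' _ _)).
pose H j a x := gam a (bet j a x) + F a (cur a (gam a (bet j a x))) *+ 2.
have lH j : lie2 (H j).
  have l1 := lie2_comp lgam lie2_X (lbet j).
  apply: lie2_D => //; apply: lie2_Mn; apply: lie2_comp => //; first exact: lie2_X.
  by apply: lie2_br => //; exact: lie2_X.
have HE j a x : bet j.+2 a x = cur a (cur a (H j a x)).
  pose z := gam a (bet j a x).
  rewrite -[LHS]/(cur a (gam a (cur a z))) -[H j a x]/(z + F a (cur a z) *+ 2).
  have -> : gam a (cur a z) = cur a z + cur a (F a (cur a z)) *+ 2 by [].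
  by rewrite [in RHS]raddfD /= raddfMn.
exists (fun a x => - \sum_(2 <= j < n) H (j - 2)%N a x *+ r j); split.
  apply: lie2_N; elim: (index_iota 2 n) => [|j s IHs].
    by apply: lie2_ext lie2_0 => a x; rewrite big_nil.
  by apply: lie2_ext (lie2_D (lie2_Mn (r j) (lH (j - 2)%N)) IHs) => a x; rewrite big_cons.
move=> a x; have := eqmB (eqm_le ik (rP a x))
  (eqm_refl i.+1 ((\sum_(2 <= i < n) iter i (AdB a) x *+ r i) *+ 2)).
rewrite addrK => h; apply: (eqm_trans h); apply: eqmD; first exact: eqm_refl.
rewrite !raddfN /= mulNrn; apply: eqmN; rewrite -[i.+1]addn1; apply: eqm_mul.
rewrite !raddf_sum /= big_nat [X in eqm _ _ X]big_nat; apply: eqm_sum => j /andP[j2 _].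
rewrite !raddfMn /=; apply: eqmMn; rewrite -HE.
by rewrite (_ : (j - 2).+2 = j)%N; [exact: betE|lia].
Qed.

Lemma Ad_lie k : exists F, lie2 F /\ forall a x,
  eqm (k + 2) (Ad (exp a) x) (x + cur a x *+ 4 + cur a (cur a (F a x)) *+ 8).
Proof.
have [F [lF FE]] := AdB_lie k; exists F; split=> // a x.
rewrite AdBE -addrA; apply: eqmD; first exact: eqm_refl.
rewrite -[8%N]/(2 * 4)%N mulrnA -mulrnDl -[4%N]/(2 ^ 2)%N.
exact: eqm_mul.
Qed.

End Adjoint.

(** * From the group law to the addition by conjugating both arguments *)

Section Conjugation.
Variables (V : uniformLieType) (G : topGroupType) (exp : V -> G) (log : G -> V).
Hypothesis chart : lie_chart exp log.
Implicit Types (x y z a : V) (g h : G).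

Local Notation mul x y := (log (exp x * exp y)%g).
Local Notation Ad := (Ad exp log).

Lemma mul_double x y : exists z, mul (x *+ 2) (y *+ 2) = z *+ 2.
Proof.
have [F [_ FE]] := CH_value_half V 0.
by have [z] := FE _ _ _ (mulCH chart (x *+ 2) (y *+ 2)); move/eqP; rewrite subr_eq expn1
  -mulrnDl => /eqP ->; exists (z + (x + y + cur x y *+ 4 + F x y *+ 8)).
Qed.

(** The group law transported along x |-> exp (2 x). *)
Definition hmul x y : V := sval (cid (mul_double x y)).

Lemma hmulE x y : mul (x *+ 2) (y *+ 2) = hmul x y *+ 2.
Proof. exact: (svalP (cid (mul_double x y))). Qed.

(** The correction to the addition is divisible by 4, and by the Jacobi identity
    it has the shape that conjugations can absorb. *)
Lemma hmul_lie k : exists F, br2 F /\ forall x y,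
  eqm k (hmul x y) (x + y + F x y *+ 4).
Proof.
have [F [bF FE]] := CH_value_half V k.
exists (fun x y => cur x y + F x y *+ 2); split.
  by apply: br2_D; [apply: br2_cur; [exact: lie2_X|exact: lie2_Y]|exact: br2_Mn].
move=> x y; have := FE _ _ _ (mulCH chart (x *+ 2) (y *+ 2)).
rewrite hmulE -addn1 => /(@eqm_div _ _ 1) h; apply: (eqm_trans h); apply: eqm_eq.
by rewrite (mulrnDl 4 (cur x y)) -(mulrnA (F x y) 2 4) [RHS]addrA.
Qed.

(** Conjugation by exp a with a = - 2^(j-2) P: the linear term 4 {a, v} of
    [Ad_lie] is 2^j {v, P}, and the remainder, a double bracket with a and a
    factor 8, carries 2^(2j-1), which is at least 2^(j+1). *)
Lemma conjugation_step k j (v p p' P : V -> V -> V) :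
  (2 <= j)%N -> lie2 v -> lie2 p' -> lie2 P ->
  (forall x y, exists h, p x y = Ad h (v x y)) ->
  (forall x y, eqm k (p x y) (v x y + p' x y *+ 4)) ->
  exists pn pn' E, [/\ lie2 pn', br2 E,
    forall x y, exists h, pn x y = Ad h (v x y),
    forall x y, eqm k (pn x y) (v x y + pn' x y *+ 4) &
    forall x y, eqm k (pn x y)
      (p x y + cur (v x y) (P x y) *+ 2 ^ j + E x y *+ 2 ^ j.+1)].
Proof.
move=> j2 lv lp' lP pAd pE.
have [F [lF FE]] := Ad_lie chart k.
pose a x y := (- P x y) *+ 2 ^ (j - 2).
have la : lie2 a by apply: lie2_Mn; apply: lie2_N.
pose u x y := v x y + p' x y *+ 4.
have lu : lie2 u by apply: lie2_D => //; apply: lie2_Mn.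
pose D x y := cur (P x y) (cur (P x y) (F (a x y) (u x y))).
have lFau : lie2 (fun x y => F (a x y) (u x y)) by exact: lie2_comp.
have bD : br2 D by apply: br2_cur => //; apply: lie2_br.
pose E x y := cur (p' x y) (P x y) *+ 2 + D x y *+ 2 ^ (j - 2).
have bE : br2 E by apply: br2_D; apply: br2_Mn => //; apply: br2_cur.
pose pn x y := Ad (exp (a x y)) (p x y).
have pnE x y : eqm k (pn x y)
    (p x y + cur (v x y) (P x y) *+ 2 ^ j + E x y *+ 2 ^ j.+1).
  have := FE (a x y) (p x y) => /(eqm_le (leq_addr 2 k)) h; apply: (eqm_trans h).
  apply: (@eqm_trans _ _ (p x y + cur (a x y) (u x y) *+ 4
      + cur (a x y) (cur (a x y) (F (a x y) (u x y))) *+ 8)).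
    have hp : eqm k (p x y) (u x y) by exact: pE.
    apply: eqmD; last first.
      apply: eqmMn; apply: eqm_cur; first exact: eqm_refl.
      apply: eqm_cur; first exact: eqm_refl.
      by apply: lie2_eqm => //; exact: eqm_refl.
    apply: eqmD; first exact: eqm_refl.
    by apply: eqmMn; apply: eqm_cur => //; exact: eqm_refl.
  apply: eqm_eq.
  have -> : cur (a x y) (u x y) *+ 4 =
     cur (v x y) (P x y) *+ 2 ^ j + cur (p' x y) (P x y) *+ 2 ^ (j + 2).
    rewrite curMnl curNl (curC (u x y)) opprK /u curDl curMnl -mulrnA.
    have jE : (2 ^ (j - 2) * 4 = 2 ^ j)%N by rewrite -[4%N]/(2 ^ 2)%N -expnD subnK.
    by rewrite jE mulrnDl -mulrnA expnD mulnC.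
  have -> : cur (a x y) (cur (a x y) (F (a x y) (u x y))) *+ 8 =
     D x y *+ 2 ^ (j - 2) *+ 2 ^ j.+1.
    rewrite /D {1}/a curMnl curNl.
    rewrite -[X in - cur _ (cur X _)]/(- P x y *+ 2 ^ (j - 2)) curMnl curNl.
    rewrite raddfMn /= raddfN /= !mulNrn opprK -!mulrnA; congr (_ *+ _).
    rewrite -[8%N]/(2 ^ 3)%N -!expnD; congr (2 ^ _)%N; lia.
  rewrite /E mulrnDl -!mulrnA -expnS !addrA.
  by congr (_ + _ *+ _ + _); rewrite addn2.
exists pn, (fun x y => p' x y + cur (v x y) (P x y) *+ 2 ^ (j - 2) + E x y *+ 2 ^ (j - 1)), E.
split=> //.
- by apply: lie2_D; [apply: lie2_D => //; apply: lie2_Mn; apply: lie2_br|apply: lie2_Mn; apply: br2_lie2].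
- by move=> x y; have [h pnh] := pAd x y; exists (exp (a x y) * h)%g; rewrite AdM // -pnh.
- move=> x y; apply: (eqm_trans (pnE x y)).
  apply: (@eqm_trans _ _ (v x y + p' x y *+ 4 + cur (v x y) (P x y) *+ 2 ^ j + E x y *+ 2 ^ j.+1)).
    by apply: eqmD; [apply: eqmD|]; rewrite ?eqm_refl //; exact: eqm_refl.
  apply: eqm_eq; rewrite !(mulrnDl 4 (_ + _)) !(mulrnDl 4 (p' x y)) -!mulrnA -[4%N]/(2 ^ 2)%N.
  by rewrite -!expnD !addrA subnK // (_ : j - 1 + 2 = j.+1)%N //; lia.
Qed.

(** Successive approximation: an error 2^(j+2) ({x, P} + {y, Q}) is removed by
    conjugating p and q according to P and Q, and the new error has the same
    shape with one more factor 2. *)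
Lemma hmul_conjugates_approx k j : exists p q p' q' E,
  [/\ forall x y, exists h, p x y = Ad h x,
      forall x y, exists h, q x y = Ad h y,
      [/\ lie2 p', lie2 q' & br2 E],
      forall x y, eqm k (p x y) (x + p' x y *+ 4) /\ eqm k (q x y) (y + q' x y *+ 4) &
      forall x y, eqm k (hmul x y) (p x y + q x y + E x y *+ 2 ^ (j + 2))].
Proof.
elim: j => [|j [p [q [p' [q' [E [pAd qAd [lp' lq' bE] pqE SE]]]]]]].
  have [F [bF FE]] := hmul_lie k.
  exists (fun x y => x), (fun x y => y), (fun _ _ => 0), (fun _ _ => 0), F; split=> //.
  - by move=> x y; exists 1%g; rewrite Ad1.
  - by move=> x y; exists 1%g; rewrite Ad1.
  - by split; try exact: lie2_0.
  - by move=> x y; rewrite mul0rn !addr0; split; exact: eqm_refl.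
have [P [Q [lP lQ EE]]] := bE.
have j2 : (2 <= j + 2)%N by lia.
have [pn [pn' [Ep [lpn bEp pnAd pnE pnS]]]] :=
  conjugation_step j2 lie2_X lp' lP pAd (fun x y => proj1 (pqE x y)).
have [qn [qn' [Eq [lqn bEq qnAd qnE qnS]]]] :=
  conjugation_step j2 lie2_Y lq' lQ qAd (fun x y => proj2 (pqE x y)).
exists pn, qn, pn', qn', (fun x y => - (Ep x y + Eq x y)); split=> //.
  by split=> //; apply: br2_N; apply: br2_D.
move=> x y; apply: (eqm_trans (SE x y)); rewrite EE.
have := eqmD (pnS x y) (qnS x y) => h.
have h2 := eqmB h (eqm_refl k ((Ep x y + Eq x y) *+ 2 ^ (j + 2).+1)).
rewrite mulNrn; apply: eqm_trans (eqm_sym h2); apply: eqm_eq.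
by rewrite !(mulrnDl (2 ^ _)) [in RHS]addrACA addrK addrACA.
Qed.

(** After k steps the error is invisible modulo 2^k. *)
Lemma hmul_conjugates k : exists p q p' q',
  [/\ forall x y, exists h, p x y = Ad h x,
      forall x y, exists h, q x y = Ad h y,
      lie2 p' /\ lie2 q',
      forall x y, eqm k (p x y) (x + p' x y *+ 4) /\ eqm k (q x y) (y + q' x y *+ 4) &
      forall x y, eqm k (hmul x y) (p x y + q x y)].
Proof.
have [p [q [p' [q' [E [pAd qAd [lp' lq' _] pqE SE]]]]]] := hmul_conjugates_approx k k.
exists p, q, p', q'; split=> // x y; apply: (eqm_trans (SE x y)).
by apply: eqm_addr; apply: eqm_dvd; rewrite leq_addr.
Qed.

(** A map which is the identity plus 4 times a 1-Lipschitz map is an isometry: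
    agreement of the values modulo 2^k lifts agreement of the arguments from
    2^i to 2^(i+1). *)
Lemma near_identity_inj k (p q p' q' : V -> V -> V) : lie2 p' -> lie2 q' ->
  (forall x y, eqm k (p x y) (x + p' x y *+ 4) /\ eqm k (q x y) (y + q' x y *+ 4)) ->
  forall x y x1 y1, eqm k (p x y) (p x1 y1) -> eqm k (q x y) (q x1 y1) ->
  eqm k x x1 /\ eqm k y y1.
Proof.
move=> lp' lq' pqE x y x1 y1 pp qq.
suff h i : (i <= k)%N -> eqm i x x1 /\ eqm i y y1 by apply: h.
elim: i => [|i IHi] ik; first by split; exact: eqm_0.
have [hx hy] := IHi (ltnW ik).
have step (u u1 v v1 w w1 : V) : eqm k w w1 -> eqm k w (u + v *+ 4) ->
    eqm k w1 (u1 + v1 *+ 4) -> eqm i v v1 -> eqm i.+1 u u1.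
  move=> ww wE w1E vv.
  have h1 : eqm i.+1 (u + v *+ 4) (u1 + v1 *+ 4).
    apply: (eqm_le ik); apply: (eqm_trans (eqm_sym wE)).
    exact: (eqm_trans ww w1E).
  have h2 : eqm i.+1 (v *+ 4) (v1 *+ 4).
    by apply: (@eqm_le _ (i + 2)); [lia|exact: eqm_mul].
  by have := eqmB h1 h2; rewrite !addrK.
have [px qx] := pqE x y; have [px1 qx1] := pqE x1 y1.
by split; [apply: (step _ _ _ _ _ _ pp px px1)|apply: (step _ _ _ _ _ _ qq qx qx1)];
  apply: lie2_eqm.
Qed.

Definition level (T : Type) k (f : V -> T) := forall x y, eqm k x y -> f x = f y.

(** The substitution (x, y) -> (p, q) permutes the pairs modulo 2^k, moves each
    variable within its Ad-orbit, and turns the addition into the group law. *)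
Lemma sum_hmul (C : pzRingType) k (f1 f2 X : V -> C) :
  level k f1 -> level k f2 -> level k X ->
  (forall h x, f1 (Ad h x) = f1 x) -> (forall h x, f2 (Ad h x) = f2 x) ->
  \sum_(a : quo V k) \sum_(b : quo V k)
     f1 (quo_repr a) * f2 (quo_repr b) * X (hmul (quo_repr a) (quo_repr b)) =
  \sum_(a : quo V k) \sum_(b : quo V k)
     f1 (quo_repr a) * f2 (quo_repr b) * X (quo_repr a + quo_repr b).
Proof.
move=> k1 k2 kX i1 i2; have [p [q [p' [q' [pAd qAd [lp' lq'] pqE SE]]]]] := hmul_conjugates k.
rewrite !pair_big /=.
pose T (u : quo V k * quo V k) :=
  (quo_pi k (p (quo_repr u.1) (quo_repr u.2)), quo_pi k (q (quo_repr u.1) (quo_repr u.2))).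
have Tinj : injective T.
  move=> [a b] [a1 b1] [] /quo_piP h1 /quo_piP h2.
  have [h3 h4] := near_identity_inj lp' lq' pqE h1 h2.
  by rewrite (quo_repr_inj h3) (quo_repr_inj h4).
rewrite [RHS](reindex_inj Tinj) /=; apply: eq_bigr => [[a b]] _ /=.
have [h hE] := pAd (quo_repr a) (quo_repr b).
have [g gE] := qAd (quo_repr a) (quo_repr b).
rewrite (k1 _ _ (quo_pi_repr _ _)) (k2 _ _ (quo_pi_repr _ _)) hE gE i1 i2.
congr (_ * _); apply: kX; apply: (eqm_trans (SE _ _)); rewrite hE gE.
by apply: eqmD; apply: eqm_sym; apply: quo_pi_repr.
Qed.

End Conjugation.

(** * Continuous homomorphisms are locally constant *)

Lemma nbhs_eqm (V : uniformLieType) (z : V) (A : set (ltop V)) :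
  nbhs (z : ltop V) A -> exists k, forall x : V, eqm k x z -> A x.
Proof.
move=> zA; have : nbhs (z : ltop V) A° by exact: nbhs_interior.
move/nbhs_singleton => [_ [[B oB <-] Bz] BA].
have [P Pn PB] : nbhs (v2r z) B by exact: open_nbhs_nbhs.
have kP i : exists k : nat, [set a | res a k = res (v2r z 0 i) k] `<=` P 0 i.
  by have [k _ kP] := Pn 0 i; exists k.
pose k i := sval (cid (kP i)).
exists (\max_i k i)%N => x /eqm_resP xz; apply: BA; apply: PB => j i.
rewrite (ord1 j); apply: (svalP (cid (kP i))).
by apply: res_le (xz i); exact: leq_bigmax.
Qed.

Section EntrySum.
Variables (R : realType) (d : nat).
Local Notation C := R[i].
Implicit Types A B : 'M[C]_d.

Definition mxl1 A : R := \sum_i \sum_j Normc.normc (A i j).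

Lemma normc_ge0 (z : C) : 0 <= Normc.normc z.
Proof. by case: z => a b; exact: sqrtr_ge0. Qed.

Lemma mxl1_ge0 A : 0 <= mxl1 A.
Proof. by apply: sumr_ge0 => i _; apply: sumr_ge0 => j _; exact: normc_ge0. Qed.

Lemma mxl1_eq0 A : mxl1 A = 0 -> A = 0.
Proof.
move=> A0; apply/matrixP => i j; rewrite mxE.
have h0 : \sum_j Normc.normc (A i j) = 0.
  apply: (psumr_eq0P _ A0) => // i' _.
  by apply: sumr_ge0 => j' _; exact: normc_ge0.
apply: Normc.eq0_normc; apply: (psumr_eq0P _ h0) => // j' _; exact: normc_ge0.
Qed.

Lemma mxl1D A B : mxl1 (A + B) <= mxl1 A + mxl1 B.
Proof.
rewrite /mxl1 -big_split; apply: ler_sum => i _ /=; rewrite -big_split.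
by apply: ler_sum => j _ /=; rewrite mxE le_normcD.
Qed.

Lemma normc_sum (I : Type) (r : seq I) (F : I -> C) :
  Normc.normc (\sum_(i <- r) F i) <= \sum_(i <- r) Normc.normc (F i).
Proof.
elim: r => [|i r IHr]; first by rewrite !big_nil Normc.normc0.
by rewrite !big_cons (le_trans (le_normcD _ _)) // lerD2l.
Qed.

Lemma mxl1M A B : mxl1 (A *m B) <= mxl1 A * mxl1 B.
Proof.
rewrite /mxl1 mulr_suml; apply: ler_sum => i _.
apply: (@le_trans _ _ (\sum_j \sum_k Normc.normc (A i k) * Normc.normc (B k j))).
  apply: ler_sum => j _; rewrite mxE (le_trans (normc_sum _ _)) //.
  by apply: ler_sum => k _; rewrite Normc.normcM.
rewrite exchange_big mulr_suml; apply: ler_sum => k _ /=.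
rewrite -mulr_sumr ler_wpM2l ?normc_ge0 // [leRHS](bigD1 k) //= lerDl.
by apply: sumr_ge0 => l _; apply: sumr_ge0 => j _; exact: normc_ge0.
Qed.

Lemma mxl1_double A : mxl1 (A + A) = 2 * mxl1 A.
Proof.
rewrite /mxl1 mulr_sumr; apply: eq_bigr => i _; rewrite mulr_sumr.
by apply: eq_bigr => j _; rewrite mxE -mulr2n normcMn mulr_natl.
Qed.

(** The neighbourhood of 1 of radius 1/2 contains no element other than 1
    all of whose 2^n-th powers stay in it, as squaring there expands the distance to 1 by a
    factor at least 3/2. *)
Lemma no_small_squares (g : nat -> 'M[C]_d) :
  (forall n, g n.+1 = g n *m g n) -> (forall n, mxl1 (g n - 1%:M) <= 2^-1) ->
  g 0%N = 1%:M.
Proof.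
move=> gS g1; apply/eqP; rewrite -subr_eq0; apply/eqP/mxl1_eq0.
pose e n := mxl1 (g n - 1%:M).
have eS n : (3 / 2) * e n <= e n.+1.
  have h : (g n - 1%:M) + (g n - 1%:M) =
      (g n.+1 - 1%:M) + - ((g n - 1%:M) *m (g n - 1%:M)).
    rewrite gS mulmxBl !mulmxBr !mulmx1 !mul1mx.
    by apply/matrixP => i j; rewrite !mxE; ring.
  have := mxl1D (g n.+1 - 1%:M) (- ((g n - 1%:M) *m (g n - 1%:M))).
  rewrite -h mxl1_double -/(e n) -/(e n.+1).
  have -> : mxl1 (- ((g n - 1%:M) *m (g n - 1%:M))) = mxl1 ((g n - 1%:M) *m (g n - 1%:M)).
    by apply: eq_bigr => i _; apply: eq_bigr => j _; rewrite [in LHS]mxE normcN.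
  have := mxl1M (g n - 1%:M) (g n - 1%:M); rewrite -/(e n).
  have := g1 n; rewrite -/(e n); have := mxl1_ge0 (g n - 1%:M); rewrite -/(e n).
  move: (mxl1 _ ) => s; nra.
have eB n : (1 + n%:R / 2) * e 0%N <= e n.
  elim: n => [|n IHn]; first by rewrite mul0r addr0 mul1r.
  apply: le_trans (eS n); apply: (@le_trans _ _ (3 / 2 * ((1 + n%:R / 2) * e 0%N))).
    rewrite -natr1; have := mxl1_ge0 (g 0%N - 1%:M); rewrite -/(e 0%N).
    have : 0 <= n%:R :> R by []; nra.
  by rewrite ler_pM2l.
apply/eqP; rewrite eq_le mxl1_ge0 andbT leNgt; apply/negP => e0.
have := eB (Num.bound (e 0%N)^-1); have := g1 (Num.bound (e 0%N)^-1).
rewrite -/(e _); have /archi_boundP : 0 <= (e 0%N)^-1 by rewrite invr_ge0 ltW.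
rewrite -/(e 0%N) in e0 *.
move: (Num.Def.archi_bound _) => n; rewrite -(ltr_pM2r e0) mulVf ?gt_eqF //.
nra.
Qed.

End EntrySum.

Section LocallyConstant.
Variables (R : realType) (V : uniformLieType).
Local Notation C := R[i].

Lemma trivial_near0 d (phi : V -> 'M[C]_d) (A : set V) :
  (forall x, A x -> A (x *+ 2) /\ phi (x *+ 2) = phi x *m phi x) ->
  (forall i j (e : R), 0 < e -> exists k, forall x, A x -> eqm k x 0 ->
     Normc.normc ((phi x - 1%:M) i j) < e) ->
  exists k, forall x, A x -> eqm k x 0 -> phi x = 1%:M.
Proof.
move=> phi2 small.
(* With entries below e the d * d of them add up to less than 1/2. *)
pose e : R := (2 * (d * d).+1%:R)^-1.
have e0 : 0 < e by rewrite invr_gt0 mulr_gt0.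
pose K i j := sval (cid (small i j e e0)).
exists (\max_i \max_j K i j)%N => x Ax x0.
apply: (no_small_squares (g := fun n => phi (x *+ 2 ^ n))) => [n|n].
  have An : A (x *+ 2 ^ n).
    by elim: n => // n An; rewrite expnSr mulrnA; case: (phi2 _ An).
  by rewrite expnSr mulrnA; case: (phi2 _ An).
have An : A (x *+ 2 ^ n).
  by elim: n => // n An; rewrite expnSr mulrnA; case: (phi2 _ An).
apply: (@le_trans _ _ (\sum_(i < d) \sum_(j < d) e)).
  apply: ler_sum => i _; apply: ler_sum => j _; apply: ltW.
  apply: (svalP (cid (small i j e e0))) => //.
  apply: (@eqm_le _ (\max_i \max_j K i j)%N).
    by apply: leq_trans (leq_bigmax (F := fun i => \max_j K i j)%N i); exact: leq_bigmax.
  by rewrite -(mul0rn _ (2 ^ n)); exact: eqmMn.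
rewrite !sumr_const !card_ord -mulrnA -[X in X <= _]mulr_natr /e -(natr1 (d * d)).
have : 0 <= (d * d)%:R :> R by [].
move: (d * d)%:R => t t0; rewrite ler_pdivrMl; first by lra.
by apply: mulr_gt0 => //; rewrite ltr_wpDl.
Qed.

Lemma cvg_normc (T : Type) (F : set_system T) (FF : Filter F) (f : T -> C) (l : C) (e : R) :
  f @ F --> (l : (R[i] : numFieldType)) -> 0 < e -> \forall t \near F, Normc.normc (f t - l) < e.
Proof.
move=> fl e0; have e0' : 0 < (e%:C : C)%C by rewrite ltcR.
have := (@cvgrPdist_lt (R[i] : numFieldType) (R[i] : numFieldType) T F FF f l).1 fl _ e0'.
apply: filterS => t; rewrite distrC normc_def ltcR.
by case: (f t - l).
Qed.

Section Chart.
Variables (G : topGroupType) (exp : V -> G) (log : G -> V).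
Hypothesis chart : lie_chart exp log.

Lemma rep_trivial_near0 (rho : crep R G) :
  exists k, forall x, eqm k x 0 -> rho (exp x) = 1%:M.
Proof.
have [k kP] : exists k, forall x, setT x -> eqm k x 0 -> rho (exp x) = 1%:M.
  apply: (trivial_near0 (phi := fun x => rho (exp x))) => [x _|i j e e0].
    by split=> //; rewrite (expMn chart) expgS expg1 rmxM.
  have [_ cexp _ _] := chart.
  have cf : {for (0 : ltop V), continuous (fun x : ltop V => rho (exp x) i j : (R[i] : numFieldType))}.
    by apply: (@continuous_comp (ltop V) G (R[i] : numFieldType) exp (fun g => rho g i j)); [exact: cexp|exact: rmx_continuous].
  have [k kP] := nbhs_eqm (cvg_normc _ cf e0).
  exists k => x _ /kP /=; rewrite (exp0 chart) rmx1.
  by rewrite !mxE.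
by exists k => x; apply: kP.
Qed.

End Chart.

Lemma dual2V_trivial_near0 (f : V -> C) : dual2V f ->
  exists k, forall x, twoV x -> eqm k x 0 -> f x = 1.
Proof.
move=> [f0 fD fc]; have t0 : twoV (0 : V) by exists 0 => //; rewrite mul0rn.
have f01 : f 0 = 1.
  have := fD _ _ t0 t0; rewrite addr0 => h.
  have /f0 nz := t0; by apply: (mulfI nz); rewrite mulr1 -h.
have [k kP] : exists k, forall x, twoV x -> eqm k x 0 -> (f x)%:M = 1%:M :> 'M[C]_1.
  apply: trivial_near0 => [x tx|i j e e0].
    split; last by rewrite -scalar_mxM mulr2n fD.
    by case: tx => y _ <-; exists (y *+ 2).
  move/subspace_continuousP : fc => /(_ 0 t0) fc.
  have h := cvg_normc _ fc e0; rewrite near_withinE in h; have [k kP] := nbhs_eqm (h _).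
  exists k => x tx /kP /(_ tx); rewrite /from_subspace f01 !mxE (ord1 i) (ord1 j) eqxx.
  by rewrite !mulr1n.
by exists k => x tx /(kP _ tx) /matrixP /(_ 0 0); rewrite !mxE eqxx.
Qed.

End LocallyConstant.

(** * Haar integrals of locally constant functions *)

Section HaarSum.
Variables (R : realType) (V : uniformLieType) (G : topGroupType).
Variables (exp : V -> G) (log : G -> V) (mu : probability (borel G) R).
Hypothesis chart : lie_chart exp log.
Hypothesis haar : is_haar mu.
Implicit Types (x y : V) (g h : G).

(** The coset of exp (2^k V) through exp x, described by logarithms. *)
Definition coset k x : set (borel G) := [set g | eqm k (log g) x].

Lemma measurable_coset k x : measurable (coset k x).
Proof.
apply: sub_gen_smallest; rewrite openE => g /= gx; rewrite /interior.
have [_ _ clog _] := chart.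
have h1 : nbhs g (fun h => eqm k (log h : V) (log g)).
  exact: (clog g _ (eqm_nbhs k (log g))).
apply: filterS h1 => h /= hg.
exact: (eqm_trans hg gx).
Qed.

Lemma log_mul_eqm k x g : eqm k (log (exp x * g)%g) x <-> eqm k (log g) 0.
Proof.
have E h : log (exp (log h) * 1)%g = log h by rewrite (logK chart) mulg1.
split=> h.
  have -> : log g = log (exp (- x) * exp (log (exp x * g)))%g.
    by rewrite (logK chart) (expN chart) mulKg.
  apply: (eqm_trans (mul_eqm chart (eqm_refl k (- x)) h)).
  by rewrite (expN chart) mulVg (log1 chart); exact: eqm_refl.
rewrite -{1}(logK chart g); apply: (eqm_trans (mul_eqm chart (eqm_refl k x) h)).
by rewrite (exp0 chart) mulg1 (expK chart); exact: eqm_refl.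
Qed.

Lemma mu_coset k x : mu (coset k x) = mu (coset k 0).
Proof.
rewrite -(haar (exp x) (measurable_coset k 0)); congr (mu _).
apply/seteqP; split=> g /=.
  move=> gx; exists ((exp x)^-1 * g)%g; last by rewrite mulVKg.
  by apply/(log_mul_eqm k x); rewrite mulVKg.
by case=> h h0 <-; apply/log_mul_eqm.
Qed.

Definition mass k : R := fine (mu (coset k 0)).

Lemma mu_cosetE k x : mu (coset k x) = (mass k)%:E.
Proof. by rewrite mu_coset /mass fineK // fin_num_measure //; exact: measurable_coset. Qed.

(** Functions on G that factor through the cosets of exp (2^k V). *)
Definition glevel (T : Type) k (F : G -> T) :=
  forall g h, eqm k (log g) (log h) -> F g = F h.

Lemma glevelE k (F : G -> R) : glevel k F -> forall g,
  F g = \sum_(a : quo V k) F (exp (quo_repr a)) * \1_(coset k (quo_repr a)) (g : borel G).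
Proof.
move=> kF g; rewrite (bigD1 (quo_pi k (log g))) //= big1 ?addr0.
  rewrite indicE mem_set ?mulr1; last by apply: eqm_sym; exact: quo_pi_repr.
  by apply: kF; rewrite (expK chart); apply: eqm_sym; exact: quo_pi_repr.
move=> a aP; rewrite indicE memNset ?mulr0 // => h.
by move/eqP: aP; apply; rewrite -[a]quo_reprK; apply/quo_piP/eqm_sym.
Qed.

(** All cosets have the same measure by invariance, so the integral of a step
    function is a multiple of the sum of its values. *)
Lemma Rintegral_glevel k (F : G -> R) : glevel k F ->
  Rintegral mu setT (F : borel G -> R) = mass k * \sum_(a : quo V k) F (exp (quo_repr a)).
Proof.
move=> kF; rewrite /Rintegral.
have int a : mu.-integrable setT
    (fun g : borel G => (F (exp (quo_repr a)) * \1_(coset k (quo_repr a)) g)%:E).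
  under eq_fun do rewrite EFinM.
  by apply: integrableZl => //; apply: integrable_indic; exact: measurable_coset.
have -> : (\int[mu]_g (F g)%:E = \sum_(a : quo V k)
   \int[mu]_g (F (exp (quo_repr a)) * \1_(coset k (quo_repr a)) g)%:E)%E.
  rewrite -integral_sum //; apply: eq_integral => g _.
  by rewrite (glevelE kF) sumEFin.
rewrite (eq_bigr (fun a => (F (exp (quo_repr a)) * mass k)%:E)) => [|a _].
  by rewrite sumEFin /= -mulr_suml mulrC.
under eq_integral do rewrite EFinM.
rewrite integralZl //; last by apply: integrable_indic; exact: measurable_coset.
rewrite integral_indic //; last exact: measurable_coset.
by rewrite setIT EFinM; congr (_ * _)%E; exact: mu_cosetE.
Qed.

Lemma mass_gt0 k : 0 < mass k.
Proof.
have := @Rintegral_glevel k (fun=> 1) (fun _ _ _ => erefl).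
have -> : Rintegral mu setT (fun=> 1) = 1.
  by rewrite Rintegral_cst // mul1r; exact: (congr1 fine (probability_setT mu)).
rewrite sumr_const -mulr_natr mul1r => h.
by rewrite lt_neqAle /mass fine_ge0 // andbT eq_sym; apply/eqP => m0; move: h;
  rewrite -/(mass k) /mass m0 mul0r => /eqP; rewrite oner_eq0.
Qed.

Lemma cintegral_glevel k (F : G -> R[i]) : glevel k F ->
  cintegral mu F = (mass k)%:C%C * \sum_(a : quo V k) F (exp (quo_repr a)).
Proof.
move=> kF; rewrite /cintegral.
rewrite (@Rintegral_glevel k (fun g => complex.Re (F g))); last by move=> g h /kF ->.
rewrite (@Rintegral_glevel k (fun g => complex.Im (F g))); last by move=> g h /kF ->.
have sumC (I : Type) (s : seq I) (f : I -> R[i]) : \sum_(i <- s) f i =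
    Complex (\sum_(i <- s) complex.Re (f i)) (\sum_(i <- s) complex.Im (f i)).
  elim: s => [|i s IHs]; first by rewrite !big_nil.
  by rewrite !big_cons IHs; case: (f i).
by rewrite sumC; simpc.
Qed.

End HaarSum.

(** * Schur's lemma and the finiteness of the irreducible representations *)

Section Schur.
Variables (R : realType) (G : topGroupType).
Local Notation C := R[i].
Implicit Types rho sigma : crep R G.

Lemma iso_rep_refl rho : iso_rep rho rho.
Proof. by exists 1%:M, 1%:M; split=> [||h]; rewrite ?mulmx1 ?mul1mx. Qed.

Lemma iso_rep_sym rho sigma : iso_rep rho sigma -> iso_rep sigma rho.
Proof.
case=> P [Q [PQ QP E]]; exists Q, P; split=> // h.
by rewrite -[Q *m sigma h]mulmx1 -PQ mulmxA -(mulmxA Q) -E !mulmxA QP mul1mx.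
Qed.

Lemma iso_rep_trans rho sigma tau : iso_rep rho sigma -> iso_rep sigma tau -> iso_rep rho tau.
Proof.
case=> P [Q [PQ QP E]] [P' [Q' [PQ' QP' E']]]; exists (P' *m P), (Q *m Q').
split=> [||h].
- by rewrite mulmxA -(mulmxA P') PQ mulmx1.
- by rewrite mulmxA -(mulmxA Q) QP' mulmx1.
- by rewrite -mulmxA E mulmxA E' mulmxA.
Qed.

Lemma iso_class_eq rho sigma : iso_rep rho sigma -> iso_class rho = iso_class sigma.
Proof.
move=> h; apply/seteqP; split=> tau /= h'.
  exact: iso_rep_trans (iso_rep_sym h) h'.
exact: iso_rep_trans h h'.
Qed.

Lemma iso_class_iso rho sigma : iso_class rho = iso_class sigma -> iso_rep rho sigma.
Proof.
by move=> h; have : iso_class sigma sigma := iso_rep_refl sigma; rewrite -h.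
Qed.

Lemma col_mulmxl m n p (A : 'M[C]_(m, n)) (B : 'M[C]_(n, p)) j : col j (A *m B) = A *m col j B.
Proof. by apply/colP => i; rewrite !mxE; apply: eq_bigr => l _; rewrite mxE. Qed.

Lemma schur rho sigma (P : 'M[C]_(rdim sigma, rdim rho)) :
  irreducible_rep rho -> irreducible_rep sigma ->
  (forall h, P *m rho h = sigma h *m P) ->
  P = 0 \/ exists Q, P *m Q = 1%:M /\ Q *m P = 1%:M.
Proof.
move=> [_ irr1] [_ irr2] PE.
have mul0P : (forall u : 'cV[C]_(rdim rho), P *m u = 0) -> P = 0.
  move=> h; apply/matrixP => i j.
  have := h (delta_mx j 0) => /matrixP /(_ i 0); rewrite -colE !mxE //.
pose f : 'Hom('cV[C]_(rdim rho), 'cV[C]_(rdim sigma)) := linfun (mulmx P).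
have fE u : f u = P *m u by rewrite lfunE.
have kstab h u : u \in lker f -> rho h *m u \in lker f.
  by rewrite !memv_ker !fE mulmxA PE -mulmxA => /eqP ->; rewrite mulmx0.
have [k0|kf] := irr1 _ kstab; last first.
  left; apply: mul0P => u; apply/eqP; rewrite -fE -memv_ker kf; exact: memvf.
have istab h v : v \in limg f -> sigma h *m v \in limg f.
  move=> /memv_imgP [u _ ->]; rewrite fE mulmxA -PE -mulmxA -fE.
  by apply: memv_img; exact: memvf.
have [i0|i_full] := irr2 _ istab.
  left; apply: mul0P => u; apply/eqP; rewrite -fE -memv0 -i0.
  by apply: memv_img; exact: memvf.
right; have surj j : exists u : 'cV[C]_(rdim rho), P *m u = delta_mx j 0.
  have : (delta_mx j 0 : 'cV[C]__) \in limg f by rewrite i_full memvf.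
  by move=> /memv_imgP [u _ uE]; exists u; rewrite uE fE.
pose Q := \matrix_(i, j) (sval (cid (surj j))) i 0.
have colQ j : col j Q = sval (cid (surj j)).
  by apply/colP => i; rewrite !mxE.
have PQ : P *m Q = 1%:M.
  apply/matrixP => i j.
  have := congr1 (fun u : 'cV[C]_(rdim sigma) => u i 0) (svalP (cid (surj j))).
  rewrite -colQ -col_mulmxl !mxE => ->.
  by rewrite andbT.
exists Q; split=> //.
have inj (u : 'cV[C]_(rdim rho)) : P *m u = 0 -> u = 0.
  by move=> Pu; apply/eqP; rewrite -memv0 -k0 memv_ker fE Pu.
apply/eqP; rewrite -subr_eq0; apply/eqP/matrixP => i j.
have /colP /(_ i) : col j (Q *m P - 1%:M) = 0.
  apply: inj; rewrite -col_mulmxl mulmxBr mulmxA PQ mul1mx mulmx1 subrr.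
  by apply/colP => l; rewrite !mxE.
by rewrite !mxE.
Qed.

Lemma schur_scalar rho (P : 'M[C]_(rdim rho)) : irreducible_rep rho ->
  (forall h, P *m rho h = rho h *m P) -> exists a, P = a%:M.
Proof.
move=> irr PE; have [a /eigenvalueP [v vP v0]] := eigenvalue_closed P irr.1.
exists a; have [||] := @schur rho rho (P - a%:M) irr irr.
- by move=> h; rewrite mulmxBl mulmxBr PE scalar_mxC.
- by move/eqP; rewrite subr_eq0 => /eqP.
move=> [Q [PQ _]]; case/eqP: v0.
by rewrite -[v]mulmx1 -PQ mulmxA mulmxBr vP mul_mx_scalar subrr mul0mx.
Qed.

Lemma rmx_mulVg rho h : rho (h^-1)%g *m rho h = 1%:M.
Proof. by rewrite -rmxM mulVg rmx1. Qed.

End Schur.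

Section CosetSums.
Variables (R : realType) (V : uniformLieType) (G : topGroupType).
Variables (exp : V -> G) (log : G -> V).
Hypothesis chart : lie_chart exp log.
Local Notation C := R[i].
Implicit Types (rho sigma : crep R G).

Local Notation glevel := (glevel log).

Lemma log_mull_eqm k h g g' :
  eqm k (log g) (log g') -> eqm k (log (h * g)%g) (log (h * g')%g).
Proof.
move=> gg; have E a b : log (a * b)%g = log (exp (log a) * exp (log b))%g by rewrite !(logK chart).
rewrite (E h g) (E h g').
by apply: (mul_eqm chart) => //; exact: eqm_refl.
Qed.

Lemma log_inv g : log (g^-1)%g = - log g.
Proof. by rewrite -{1}(logK chart g) -(expN chart) (expK chart). Qed.

Lemma rep_glevel k rho :
  (forall x, eqm k x 0 -> rho (exp x) = 1%:M) -> glevel k (fun g => rho g).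
Proof.
move=> rk g h gh; have E : rho (h^-1 * g)%g = 1%:M.
  rewrite -(logK chart (h^-1 * g)%g); apply: rk.
  by have := log_mull_eqm h^-1%g gh; rewrite mulVg (log1 chart).
by rewrite -[g](mulVKg h) rmxM E mulmx1.
Qed.

Lemma sum_coset_mul k (U : nmodType) (F : G -> U) h : glevel k F ->
  \sum_(a : quo V k) F (h * exp (quo_repr a))%g = \sum_(a : quo V k) F (exp (quo_repr a)).
Proof.
move=> kF; pose t (a : quo V k) := quo_pi k (log (h * exp (quo_repr a))%g).
have tinj : injective t.
  move=> a b /quo_piP /(log_mull_eqm h^-1%g).
  by rewrite !mulKg !(expK chart); exact: quo_repr_inj.
rewrite [RHS](reindex_inj tinj); apply: eq_bigr => a _; apply: kF.
by rewrite (expK chart); apply: eqm_sym; exact: quo_pi_repr.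
Qed.

Section Averaging.
Variables (k : nat) (rho sigma : crep R G).
Hypothesis rk : forall x, eqm k x 0 -> rho (exp x) = 1%:M.
Hypothesis sk : forall x, eqm k x 0 -> sigma (exp x) = 1%:M.

(** Averaging over G / exp (2^k V) produces intertwiners, to which Schur's lemma
    applies; the orthogonality of the characters results. *)
Definition average (E : 'M[C]_(rdim sigma, rdim rho)) :=
  \sum_(a : quo V k) sigma (exp (quo_repr a)) *m E *m rho (exp (quo_repr a))^-1%g.

Lemma average_intertwines E h : average E *m rho h = sigma h *m average E.
Proof.
have kF : glevel k (fun g => sigma g *m E *m rho g^-1%g).
  move=> g g' gg; rewrite (rep_glevel sk gg); congr (_ *m _).
  by apply: (rep_glevel rk); rewrite !log_inv; exact: eqmN.
rewrite -{1}[average E](sum_coset_mul h kF) mulmx_suml mulmx_sumr.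
apply: eq_bigr => a _; rewrite invgM !rmxM -!mulmxA rmx_mulVg mulmx1.
by [].
Qed.

Lemma average_coef (i : 'I_(rdim sigma)) (l : 'I_(rdim rho)) j m :
  average (delta_mx j m) i l = \sum_(a : quo V k)
    sigma (exp (quo_repr a)) i j * rho (exp (quo_repr a))^-1%g m l.
Proof.
rewrite summxE; apply: eq_bigr => a _.
rewrite mxE (bigD1 m) //= [X in _ + X]big1 ?addr0 => [|m' m'm].
  rewrite mxE (bigD1 j) //= [X in _ + X]big1 ?addr0 => [|j' j'j].
    by rewrite !mxE !eqxx mulr1.
  by rewrite mxE (negbTE j'j) mulr0.
rewrite mxE big1 ?mul0r // => j' _.
by rewrite mxE (negbTE m'm) andbF mulr0.
Qed.

Lemma sum_rchar : \sum_(a : quo V k)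
    rchar sigma (exp (quo_repr a)) * rchar rho (exp (quo_repr a))^-1%g =
  \sum_i \sum_j average (delta_mx i j) i j.
Proof.
under [RHS]eq_bigr => i _ do under eq_bigr => j _ do rewrite average_coef.
under [RHS]eq_bigr => i _ do rewrite exchange_big.
rewrite [RHS]exchange_big; apply: eq_bigr => a _ /=.
by rewrite /rchar /mxtrace mulr_suml; apply: eq_bigr => i _; rewrite mulr_sumr.
Qed.

Lemma rchar_orthogonal : irreducible_rep rho -> irreducible_rep sigma ->
  ~ iso_rep rho sigma ->
  \sum_(a : quo V k) rchar sigma (exp (quo_repr a)) * rchar rho (exp (quo_repr a))^-1%g = 0.
Proof.
move=> irr1 irr2 niso; rewrite sum_rchar big1 // => i _; rewrite big1 // => j _.
have [->|[Q [PQ QP]]] := schur irr1 irr2 (average_intertwines (delta_mx i j)).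
  by rewrite mxE.
case: niso; exists (average (delta_mx i j)), Q; split=> //.
exact: average_intertwines.
Qed.

End Averaging.

Lemma rchar_norm k rho : (forall x, eqm k x 0 -> rho (exp x) = 1%:M) ->
  irreducible_rep rho ->
  \sum_(a : quo V k) rchar rho (exp (quo_repr a)) * rchar rho (exp (quo_repr a))^-1%g
    = #|quo V k|%:R.
Proof.
move=> rk irr; rewrite (sum_rchar k rho rho).
have E i j : average k (rho := rho) (sigma := rho) (delta_mx i j) i j =
    (i == j)%:R * (#|quo V k|%:R / (rdim rho)%:R).
  have [c cE] := schur_scalar irr (average_intertwines rk rk (delta_mx i j)).
  have d0 : (rdim rho)%:R != 0 :> C by rewrite pnatr_eq0 -lt0n; exact: irr.1.
  have : \tr (average k (rho := rho) (sigma := rho) (delta_mx i j)) =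
      #|quo V k|%:R * (i == j)%:R.
    rewrite /average raddf_sum /= (eq_bigr (fun=> (i == j)%:R)) => [|a _].
      by rewrite sumr_const mulr_natl.
    rewrite mxtrace_mulC mulmxA rmx_mulVg mul1mx /mxtrace (bigD1 i) //= big1 ?addr0.
      by rewrite mxE eqxx eq_sym.
    by move=> l li; rewrite mxE (negbTE li).
  rewrite cE mxtrace_scalar => h.
  have {h} -> : c = #|quo V k|%:R * (i == j)%:R / (rdim rho)%:R.
    by rewrite -h -[c *+ _]mulr_natr mulfK.
  rewrite !mxE; case: eqP => _; last by rewrite mul0r mulr0n.
  by rewrite mulr1 mulr1n mul1r.
under eq_bigr => i _ do (under eq_bigr => j _ do rewrite E; rewrite -mulr_suml).
under eq_bigr => i _.
  rewrite (_ : \sum_j (i == j)%:R = 1); last first.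
    rewrite (bigD1 i) //= eqxx big1 ?addr0 // => j; rewrite eq_sym => /negbTE ->.
    by [].
  over.
rewrite /= sumr_const card_ord mul1r -[LHS]mulr_natr mulfVK //.
by rewrite pnatr_eq0 -lt0n; exact: irr.1.
Qed.

(** By orthogonality the Gram matrix of n inequivalent irreducible characters is
    scalar of rank n, while it factors through functions on G / exp (2^k V). *)
Lemma finite_irreducible k : finite_set [set iso_class rho | rho in
  [set rho : crep R G | irreducible_rep rho /\ forall x, eqm k x 0 -> rho (exp x) = 1%:M]].
Proof.
apply: contrapT => /infiniteP /pcard_leP [f].
pose N := #|quo V k|.+1.
have fP (i : 'I_N) : exists rho, [/\ irreducible_rep rho,
    (forall x, eqm k x 0 -> rho (exp x) = 1%:M) & iso_class rho = f (i : nat)].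
  have [rho [irr rk] rE] : [set iso_class rho | rho in
  [set rho : crep R G | irreducible_rep rho /\ forall x, eqm k x 0 -> rho (exp x) = 1%:M]] (f (i : nat)).
    by apply: funS.
  by exists rho.
pose r i := sval (cid (fP i)).
have irr i : irreducible_rep (r i) by have [] := svalP (cid (fP i)).
have rk i x : eqm k x 0 -> r i (exp x) = 1%:M by have [_ + _] := svalP (cid (fP i)); apply.
have rE i : iso_class (r i) = f (i : nat) by have [] := svalP (cid (fP i)).
have niso i j : i != j -> ~ iso_rep (r j) (r i).
  move=> /eqP ij /iso_class_eq; rewrite !rE => /inj; rewrite !inE => /(_ Logic.I Logic.I) h.
  by apply: ij; apply: val_inj.
pose A : 'M[C]_(N, #|quo V k|) := \matrix_(i, a) rchar (r i) (exp (quo_repr (enum_val a))).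
pose B : 'M[C]_(#|quo V k|, N) := \matrix_(a, j) rchar (r j) (exp (quo_repr (enum_val a)))^-1%g.
have AB : A *m B = #|quo V k|%:R *: 1%:M.
  apply/matrixP => i j; rewrite !mxE.
  transitivity (\sum_(a : quo V k) rchar (r i) (exp (quo_repr a)) * rchar (r j) (exp (quo_repr a))^-1%g).
    rewrite [RHS]big_enum_val; apply: eq_bigr => a _; by rewrite !mxE.
  have [->|ij] := eqVneq i j; first by rewrite (rchar_norm (rk j) (irr j)) mulr1.
  by rewrite (rchar_orthogonal (rk j) (rk i) (irr j) (irr i) (niso _ _ ij)) mulr0.
have := mxrankM_maxl A B; rewrite AB mxrank_scale_nz ?mxrank1.
  by move=> /leq_trans /(_ (rank_leq_col A)); rewrite ltnn.
rewrite pnatr_eq0 -lt0n; apply/card_gt0P; exists (quo_pi k 0); by [].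
Qed.

End CosetSums.

(** * Fourier analysis on 2V / 2^(k+1) V *)

(** Iterated square roots of - 1. *)
Lemma root_of_unity (C : numClosedFieldType) K : exists w : C, w ^+ (2 ^ K) = 1 /\
  forall i j, (i < 2 ^ K)%N -> (j < 2 ^ K)%N -> w ^+ i = w ^+ j -> i = j.
Proof.
pose u := iter K (fun z : C => sqrtC z) (-1).
have uK : u ^+ (2 ^ K) = -1.
  rewrite /u; elim: {u} K => [|K IHK]; first by rewrite expr1.
  by rewrite iterS expnS exprM sqrtCK.
have u0 : u != 0.
  by apply/eqP => u0; move: uK; rewrite u0 expr0n expn_eq0 /= => /eqP; rewrite eq_sym oppr_eq0 oner_eq0.
(* u has order 2^(K + 1). *)
exists (u ^+ 2); split; first by rewrite -exprM mulnC exprM uK sqrrN expr1n.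
have key n : (0 < n)%N -> (n < 2 ^ K)%N -> (u ^+ 2) ^+ n != 1.
  move=> n0 nK; have [m om nE] := @pfactor_coprime 2 n isT n0.
  have vK : (logn 2 n < K)%N.
    by rewrite -(ltn_exp2l _ _ (isT : 1 < 2)%N) (leq_ltn_trans _ nK) // dvdn_leq // pfactor_dvdnn.
  apply/eqP => /(congr1 (fun z => z ^+ (2 ^ (K - (logn 2 n).+1)))).
  move: nE vK; move: (logn 2 n) => v nE vK.
  have E : (2 * n * 2 ^ (K - v.+1) = 2 ^ K * m)%N.
    rewrite -{2}(subnKC vK) expnD expnS nE; lia.
  rewrite expr1n -!exprM mulnA E.
  rewrite exprM uK -signr_odd; have -> : odd m by rewrite -coprime2n.
  by rewrite expr1 => /eqP; rewrite eq_sym -subr_eq0 opprK -mulr2n pnatr_eq0.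
have main i j : (i <= j)%N -> (j < 2 ^ K)%N -> (u ^+ 2) ^+ i = (u ^+ 2) ^+ j -> i = j.
  move=> ij jK; rewrite -(subnKC ij) exprD -{1}[_ ^+ i]mulr1 => /mulfI h.
  have {h} /esym/eqP := h (expf_neq0 _ (expf_neq0 _ u0)).
  case: (posnP (j - i)) => [->|ji]; first by rewrite addn0.
  by rewrite (negbTE (key _ ji _)) // (leq_ltn_trans (leq_subr _ _)).
move=> i j iK jK; case/orP: (leq_total i j) => ij; first exact: main.
by move/esym => h; apply/esym; apply: main h.
Qed.

Lemma sum_geometric (F : fieldType) (z : F) n : z ^+ n = 1 -> z != 1 -> \sum_(t < n) z ^+ t = 0.
Proof.
move=> zn z1; apply/eqP; have := subrX1 z n; rewrite zn subrr => /esym/eqP.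
by rewrite mulf_eq0 subr_eq0 (negbTE z1).
Qed.

Section Fourier.
Variables (R : realType) (V : uniformLieType).
Local Notation C := R[i].
Implicit Types (x y z : V) (f : V -> C).

Lemma sum_quo_inj k (U : nmodType) (F : V -> U) (t : V -> V) : level k F ->
  (forall x y, eqm k (t x) (t y) -> eqm k x y) ->
  \sum_(a : quo V k) F (t (quo_repr a)) = \sum_(a : quo V k) F (quo_repr a).
Proof.
move=> kF tinj; have inj : injective (fun a : quo V k => quo_pi k (t (quo_repr a))).
  by move=> a b /quo_piP /tinj; exact: quo_repr_inj.
rewrite [RHS](reindex_inj inj); apply: eq_bigr => a _; apply: kF.
by apply: eqm_sym; exact: quo_pi_repr.
Qed.

Definition dual2V_level k f := dual2V f /\ (forall x, twoV x -> eqm k.+1 x 0 -> f x = 1).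

Lemma twoV2 x : twoV (x *+ 2).
Proof. by exists x. Qed.

Lemma dual2V_exists_level f : dual2V f -> exists k, dual2V_level k f.
Proof.
move=> df; have [k kP] := dual2V_trivial_near0 df; exists k; split=> // x tx.
by move/(eqm_le (leqnSn k)); exact: kP.
Qed.

Lemma dual2V_level_le j k f : (j <= k)%N -> dual2V_level j f -> dual2V_level k f.
Proof.
move=> jk [df jP]; split=> // x tx x0; apply: jP => //.
by apply: eqm_le x0; rewrite ltnS.
Qed.

Lemma dual2V_levelP k f : (forall x, f x != 0 <-> twoV x) ->
  (forall x y, twoV x -> twoV y -> f (x + y) = f x * f y) ->
  (forall x, twoV x -> eqm k.+1 x 0 -> f x = 1) -> dual2V_level k f.
Proof.
move=> f0 fD lev; split=> //; split=> //.
apply/subspace_continuousP => x tx W /nbhs_singleton Wx.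
apply: filterS (eqm_nbhs k.+1 x) => y /= yx ty; rewrite /from_subspace in Wx *.
suff -> : f y = f x by [].
have tyx : twoV (y - x).
  by case: tx => x' _ <-; case: ty => y' _ <-; exists (y' - x') => //; rewrite mulrnBl.
rewrite -(subrK x y) fD // lev ?mul1r //.
by have := eqmB yx (eqm_refl k.+1 x); rewrite subrr.
Qed.

Section OneCharacter.
Variables (k : nat) (f : V -> C).
Hypothesis kf : dual2V_level k f.

Lemma dual2V_D x y : f ((x + y) *+ 2) = f (x *+ 2) * f (y *+ 2).
Proof. by rewrite mulrnDl; case: kf => [[_ fD _] _]; apply: fD; exact: twoV2. Qed.

Lemma dual2V_eq0 x : ~ twoV x -> f x = 0.
Proof. by move=> tx; apply/eqP/negP => fx; apply: tx; case: kf => [[f0 _ _] _]; apply/f0/negP. Qed.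

Lemma dual2V_1 x : eqm k x 0 -> f (x *+ 2) = 1.
Proof.
move=> x0; case: kf => _; apply; first exact: twoV2.
by have := eqm_mul 1 x0; rewrite mul0rn addn1.
Qed.

Lemma dual2V_is_level : level k (fun x => f (x *+ 2)).
Proof.
move=> x y xy; rewrite -(subrK y x) dual2V_D dual2V_1 ?mul1r //.
by have := eqmB xy (eqm_refl k y); rewrite subrr.
Qed.

Lemma dual2V_levelS : level k.+1 f.
Proof.
move=> x y xy; case: (pselect (twoV y)) => ty; last first.
  rewrite !dual2V_eq0 // => -[z _ zx]; apply: ty.
  have [w xyw] := xy; exists (z - w *+ 2 ^ k) => //.
  by rewrite mulrnBl -mulrnA -expnSr -xyw zx opprB addrC subrK.
have [w xyw] := xy; case: ty => z _ zy; rewrite -zy.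
have -> : x = (z + w *+ 2 ^ k) *+ 2.
  by rewrite mulrnDl -mulrnA -expnSr -xyw zy addrC subrK.
by apply: dual2V_is_level; apply: eqm_addr; apply: eqm_dvd.
Qed.

Lemma dual2V_norm x : (f (x *+ 2))^*%C * f (x *+ 2) = 1.
Proof.
have fX n : f (x *+ n *+ 2) = f (x *+ 2) ^+ n.
  elim: n => [|n IHn]; first by rewrite expr0 dual2V_1 //; exact: eqm_refl.
  by rewrite (mulrS x n) dual2V_D IHn exprS.
have h : f (x *+ 2) ^+ (2 ^ k) = 1 by rewrite -fX dual2V_1 //; exact: eqm_dvd.
have /eqP : `|f (x *+ 2)| ^+ (2 ^ k) = 1 by rewrite -normrX h normr1.
rewrite pexpr_eq1 ?normr_ge0 ?expn_gt0 // => /eqP n1.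
by rewrite mulrC -sqr_normc n1 expr1n.
Qed.

End OneCharacter.

Lemma sum_dual2V_norm k f : dual2V_level k f ->
  \sum_(a : quo V k) (f (quo_repr a *+ 2))^*%C * f (quo_repr a *+ 2) = #|quo V k|%:R.
Proof.
by move=> kf; under eq_bigr => a _ do rewrite (dual2V_norm kf); rewrite sumr_const.
Qed.

(** A translation at which the two characters differ multiplies the sum by a
    number other than 1. *)
Lemma dual2V_orthogonal k f g : dual2V_level k f -> dual2V_level k g -> f <> g ->
  \sum_(a : quo V k) (f (quo_repr a *+ 2))^*%C * g (quo_repr a *+ 2) = 0.
Proof.
move=> kf kg fg.
have [x fgx] : exists x, f (x *+ 2) <> g (x *+ 2).
  apply: contrapT => h; apply: fg; apply/funext => x.
  case: (pselect (twoV x)) => [[y _ <-]|tx].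
    by apply: contrapT => fgy; apply: h; exists y.
  by rewrite (dual2V_eq0 kf) // (dual2V_eq0 kg).
pose F y := (f (y *+ 2))^*%C * g (y *+ 2).
have kF : level k F.
  by move=> y z yz; rewrite /F (dual2V_is_level kf yz) (dual2V_is_level kg yz).
have FD y z : F (y + z) = F y * F z.
  by rewrite /F (dual2V_D kf) (dual2V_D kg) rmorphM /= mulrACA.
have Fx : F x != 1.
  apply/eqP => h; apply: fgx; apply: esym; have := congr1 (fun c => f (x *+ 2) * c) h.
  by rewrite /F mulrA mulr1 [f _ * _]mulrC (dual2V_norm kf) mul1r.
have := @sum_quo_inj k _ F (fun y => y + x) kF.
have tinj y z : eqm k (y + x) (z + x) -> eqm k y z.
  by move=> h; have := eqmB h (eqm_refl k x); rewrite !addrK.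
move=> /(_ tinj); under eq_bigr => a _ do rewrite FD.
rewrite -mulr_suml => /eqP; rewrite -subr_eq0 -{2}[\sum_a _]mulr1 -mulrBr mulf_eq0.
by rewrite subr_eq0 (negbTE Fx) orbF => /eqP.
Qed.

Definition half x : V := xget 0 [set y | y *+ 2 = x].

Lemma half2 x : half (x *+ 2) = x.
Proof.
rewrite /half; case: xgetP => [y _ /= yx|]; first exact: (mulrnI _ yx).
by move=> /(_ x) [].
Qed.

Section Completeness.
Variables (k : nat) (w : C).
Hypothesis w1 : w ^+ (2 ^ k) = 1.
Hypothesis winj : forall i j, (i < 2 ^ k)%N -> (j < 2 ^ k)%N -> w ^+ i = w ^+ j -> i = j.

Definition coord x (i : 'I_(dim V)) : nat := quo_pi k x i.

Lemma coordD x y i : w ^+ coord (x + y) i = w ^+ coord x i * w ^+ coord y i.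
Proof.
rewrite -exprD -[RHS](expr_mod _ w1); congr (_ ^+ _).
rewrite /coord /quo_pi !ffunE /= raddfD /= mxE /=.
have E (z : Z2) : res z k = (`|res z k|%N : int) by rewrite gez0_abs // res_ge0.
by rewrite {1}(E (v2r x 0 i)) (E (v2r y 0 i)) -PoszD -Posz_exp2 modz_nat.
Qed.

(** In coordinates, the characters of (Z / 2^k)^n composed with halving, and
    extended by zero off 2V. *)
Definition basis_char (b : quo V k) x : C :=
  if `[< twoV x >] then \prod_i w ^+ (b i * coord (half x) i) else 0.

Lemma basis_char2 b x : basis_char b (x *+ 2) = \prod_i w ^+ (b i * coord x i).
Proof. by rewrite /basis_char asboolT ?half2 //; exact: twoV2. Qed.

Lemma w_neq0 : w != 0.
Proof.
by apply/eqP => w0; move/eqP: w1; rewrite w0 expr0n expn_eq0 /= eq_sym oner_eq0.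
Qed.

Lemma coord_eqm x y : eqm k x y -> coord x =1 coord y.
Proof. by move=> /quo_piP h i; rewrite /coord h. Qed.

Lemma coord0 i : w ^+ coord 0 i = 1.
Proof.
have := coordD 0 0 i; rewrite addr0 -{1}[w ^+ _]mulr1.
by move/(mulfI (expf_neq0 _ w_neq0)).
Qed.

Lemma basis_char_level b : dual2V_level k (basis_char b).
Proof.
have eq1 x : eqm k x 0 -> basis_char b (x *+ 2) = 1.
  move=> /coord_eqm x0; rewrite basis_char2 big1 // => i _.
  by rewrite x0 mulnC exprM coord0 expr1n.
have fD x y : twoV x -> twoV y -> basis_char b (x + y) = basis_char b x * basis_char b y.
  move=> [x' _ <-] [y' _ <-]; rewrite -mulrnDl !basis_char2 -big_split /=.
  by apply: eq_bigr => i _; rewrite !(mulnC (b i)) !exprM coordD exprMn.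
have lev x : twoV x -> eqm k.+1 x 0 -> basis_char b x = 1.
  move=> [y _ <-]; rewrite -(mul0rn _ 2) -addn1 => /(@eqm_div _ _ 1); exact: eq1.
apply: dual2V_levelP => // x.
rewrite /basis_char; case: asboolP => tx; split=> //; last by rewrite eqxx.
move=> _; by apply/prodf_neq0 => i _; rewrite expf_neq0 // w_neq0.
Qed.

Lemma conj_w_pow n : (w ^+ n)^*%C * w ^+ n = 1.
Proof.
have /eqP : `|w ^+ n| ^+ (2 ^ k) = 1 by rewrite -normrX -exprM mulnC exprM w1 expr1n normr1.
rewrite pexpr_eq1 ?normr_ge0 ?expn_gt0 // => /eqP n1.
by rewrite mulrC -sqr_normc n1 expr1n.
Qed.

Lemma basis_char_dual x y : \sum_b (basis_char b (x *+ 2))^*%C * basis_char b (y *+ 2) =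
  if `[< eqm k x y >] then (2 ^ k)%:R ^+ dim V else 0.
Proof.
pose z i := (w ^+ coord x i)^*%C * w ^+ coord y i.
transitivity (\prod_i \sum_(t < 2 ^ k) z i ^+ t).
  rewrite bigA_distr_bigA /=; apply: eq_bigr => b _.
  rewrite !basis_char2 rmorph_prod -big_split /=; apply: eq_bigr => i _.
  by rewrite /z exprMn -rmorphXn /= -!exprM ![(b i * _)%N]mulnC.
case: asboolP => [xy|nxy].
  rewrite (eq_bigr (fun=> (2 ^ k)%:R)) ?prodr_const ?card_ord // => i _.
  rewrite (eq_bigr (fun=> 1)) ?sumr_const ?card_ord // => t _.
  by rewrite /z (coord_eqm xy) conj_w_pow expr1n.
have [i xyi] : exists i, coord x i <> coord y i.
  apply: contrapT => h; apply: nxy; apply/quo_piP/ffunP => i; apply: val_inj.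
  by apply: contrapT => xyi; apply: h; exists i.
apply/eqP; rewrite (bigD1 i) //= sum_geometric ?mul0r //.
  by rewrite /z exprMn -rmorphXn /= -!exprM ![(_ * 2 ^ k)%N]mulnC !exprM w1 !expr1n rmorph1 mulr1.
apply/eqP => z1; apply: xyi; apply: winj; try exact: ltn_ord.
have := congr1 (fun c => w ^+ coord x i * c) z1.
by rewrite /z mulrA [w ^+ _ * _^*%C]mulrC conj_w_pow mul1r mulr1.
Qed.

End Completeness.

(** The orthogonality [basis_char_dual] in the dual variable recovers each value
    of X from its Fourier coefficients. *)
Lemma fourier_injective k (X : V -> C) : level k X ->
  (forall f, dual2V_level k f ->
     \sum_(a : quo V k) (f (quo_repr a *+ 2))^*%C * X (quo_repr a) = 0) ->
  forall x, X x = 0.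
Proof.
move=> kX X0 x; have [w [w1 winj]] := root_of_unity C k.
have := erefl (\sum_(b : quo V k) basis_char w b (x *+ 2) * \sum_(a : quo V k)
   (basis_char w b (quo_repr a *+ 2))^*%C * X (quo_repr a)).
rewrite [X in X = _ -> _]big1 => [|b _]; last by rewrite X0 ?mulr0 //; exact: basis_char_level.
under eq_bigr => b _ do rewrite mulr_sumr.
rewrite exchange_big (bigD1 (quo_pi k x)) //= [X in _ + X]big1 ?addr0 => [|a ax].
  under eq_bigr => b _ do rewrite mulrA [basis_char _ _ _ * _]mulrC.
  rewrite -mulr_suml basis_char_dual //; case: asboolP => [_|[]]; last exact: quo_pi_repr.
  move/esym/eqP; rewrite mulf_eq0 expf_eq0 pnatr_eq0 expn_eq0 /= andbF /= => /eqP <-.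
  by apply: kX; apply: eqm_sym; exact: quo_pi_repr.
under eq_bigr => b _ do rewrite mulrA [basis_char _ _ _ * _]mulrC.
rewrite -mulr_suml basis_char_dual //; case: asboolP => [h|_]; last by rewrite mul0r.
by case/eqP: ax; rewrite -[a]quo_reprK; apply/quo_piP.
Qed.

End Fourier.

(** * Orbit idempotents and representations *)

Section OrbitIdempotents.
Variables (R : realType) (V : uniformLieType) (G : topGroupType).
Variables (exp : V -> G) (log : G -> V).
Hypothesis chart : lie_chart exp log.
Local Notation C := R[i].
Local Notation Ad := (Ad exp log).
Local Notation coAd := (coAd exp log).
Implicit Types (x y z : V) (h : G) (f : V -> C) (rho : crep R G).

Lemma twoV_Ad h x : twoV x -> twoV (Ad h x).
Proof. by case=> y _ <-; rewrite (AdMn chart); exact: twoV2. Qed.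

Lemma coAdM g h f : coAd (g * h)%g f = coAd g (coAd h f).
Proof. by apply/funext => x; rewrite /Defs.coAd invgM (AdM chart). Qed.

Lemma coAd1 f : coAd 1%g f = f.
Proof. by apply/funext => x; rewrite /Defs.coAd invg1 (Ad1 chart). Qed.

Lemma coAd_level k h f : dual2V_level k f -> dual2V_level k (coAd h f).
Proof.
move=> [[f0 fD _] lev]; apply: dual2V_levelP => [x|x y tx ty|x tx x0].
- rewrite /Defs.coAd f0; split; last exact: twoV_Ad.
  by move=> /(twoV_Ad h); rewrite (AdVK chart).
- by rewrite /Defs.coAd (AdD chart) fD //; exact: twoV_Ad.
- apply: lev; first exact: twoV_Ad.
  apply: (eqm_trans (Ad_eqm chart h^-1%g x0)); rewrite -(mulr0n 0) (AdMn chart).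
  by rewrite mulr0n; exact: eqm_refl.
Qed.

Lemma Ad_eqml k g h x : eqm k (log g) (log h) -> eqm k (Ad g x) (Ad h x).
Proof.
move=> gh; rewrite -(logK chart g) -(logK chart h) !(Ad_exp chart).
apply: (mul_eqm chart); last exact: eqmN.
by apply: (mul_eqm chart) => //; exact: eqm_refl.
Qed.

Definition orbit f : set (V -> C) := [set coAd h f | h in [set: G]].

Lemma mem_orbit f : orbit f f.
Proof. by exists 1%g => //; rewrite coAd1. Qed.

Lemma orbit_coAd f g h : orbit f g -> orbit f (coAd h g).
Proof. by case=> h' _ <-; exists (h * h')%g => //; rewrite coAdM. Qed.

Lemma orbit_eq f g : orbit f g -> orbit f = orbit g.
Proof.
case=> h _ <-; apply/seteqP; split=> g'.
  by case=> h' _ <-; exists (h' * h^-1)%g => //; rewrite -coAdM -mulgA mulVg mulg1.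
by case=> h' _ <-; exists (h' * h)%g => //; rewrite coAdM.
Qed.

Lemma orbit_level k f g : dual2V_level k f -> orbit f g -> dual2V_level k g.
Proof. by move=> kf [h _ <-]; exact: coAd_level. Qed.

Lemma orbit_finite k f : dual2V_level k f -> finite_set (orbit f).
Proof.
move=> kf; apply: (@sub_finite_set _ _
   [set coAd (exp (quo_repr a)) f | a in [set: quo V k.+1]]).
  move=> _ [h _ <-]; exists (quo_pi k.+1 (log h)) => //; apply/funext => x.
  apply: (dual2V_levelS kf); apply: Ad_eqml; rewrite !(log_inv chart) (expK chart).
  by apply: eqmN; exact: quo_pi_repr.
by apply: finite_image; exact: finite_finset.
Qed.

Lemma orbitsP Omega : orbits exp log Omega ->
  exists f k, dual2V_level k f /\ Omega = orbit f.
Proof.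
by case=> f df <-; have [k kf] := dual2V_exists_level df; exists f, k.
Qed.

Section OneOrbit.
Variables (k : nat) (f : V -> C).
Hypothesis kf : dual2V_level k f.
Local Notation Omega := (orbit f).
Local Notation members := (fset_set Omega).

Lemma eOmega'E x : eOmega' Omega x = \sum_(g <- members) g x.
Proof. by rewrite /eOmega' fsbig_finite //; exact: orbit_finite kf. Qed.

Lemma mem_members g : g \in members -> Omega g.
Proof. by rewrite in_fset_set ?inE //; exact: orbit_finite kf. Qed.

Lemma eOmega'_Ad h x : eOmega' Omega (Ad h x) = eOmega' Omega x.
Proof.
rewrite /eOmega' (@reindex_fsbig _ _ _ _ _ (coAd h) Omega Omega).
  by apply: eq_fsbigr => g _; rewrite /Defs.coAd (AdK chart).
split=> [g|g1 g2 _ _|g]; first exact: orbit_coAd.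
  by move/(congr1 (coAd h^-1%g)); rewrite -!coAdM mulVg !coAd1.
move=> Og; exists (coAd h^-1%g g); first exact: orbit_coAd.
by rewrite -coAdM mulgV coAd1.
Qed.

Lemma eOmega'_level : level k.+1 (eOmega' Omega).
Proof.
move=> x y xy; rewrite !eOmega'E big_seq [RHS]big_seq; apply: eq_bigr => g /mem_members Og.
exact: (dual2V_levelS (orbit_level kf Og)).
Qed.

Lemma eOmega'_level2 : level k (fun x => eOmega' Omega (x *+ 2)).
Proof. by move=> x y xy; apply: eOmega'_level; have := eqm_mul 1 xy; rewrite addn1. Qed.

Lemma eOmega'_0 x : ~ twoV x -> eOmega' Omega x = 0.
Proof.
move=> tx; rewrite eOmega'E big_seq big1 // => g /mem_members Og.
exact: (dual2V_eq0 (orbit_level kf Og)).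
Qed.

Lemma eOmegaE g : eOmega exp log Omega g = eOmega' Omega (log g).
Proof.
rewrite /eOmega; case: ifPn => // gS; apply/esym; apply: eOmega'_0 => -[x _ xg].
move/negP: gS; apply; rewrite inE; exists (x *+ 2); first exact: twoV2.
by rewrite xg (logK chart).
Qed.

(** The Fourier coefficient of X at f', without normalization. *)
Definition pairing (X : V -> C) f' : C :=
  \sum_(a : quo V k) (f' (quo_repr a *+ 2))^*%C * X (quo_repr a).

Lemma pairing_orbit X g : level k X -> (forall h x, X (Ad h x) = X x) -> Omega g ->
  pairing X g = pairing X f.
Proof.
move=> kX Xi [h _ <-]; rewrite /pairing.
rewrite -(@sum_quo_inj V k _ (fun x => (f (x *+ 2))^*%C * X x) (Ad h^-1%g)).
- by apply: eq_bigr => a _; rewrite Xi /Defs.coAd (AdMn chart).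
- by move=> x y xy; rewrite (dual2V_is_level kf xy) (kX _ _ xy).
- by move=> x y /(Ad_eqm chart h); rewrite !(AdVK chart).
Qed.

Lemma pairing_eOmega X : level k X -> (forall h x, X (Ad h x) = X x) ->
  pairing X (eOmega' Omega) = #|` members|%:R * pairing X f.
Proof.
move=> kX Xi; rewrite /pairing.
under eq_bigr => a _ do rewrite eOmega'E rmorph_sum mulr_suml.
rewrite exchange_big /= big_seq (eq_bigr (fun=> pairing X f)) => [|g /mem_members Og].
  by rewrite -big_seq big_const_seq count_predT iter_addr addr0 mulr_natl.
exact: pairing_orbit.
Qed.

Lemma members_neq0 : #|` members|%:R != 0 :> C.
Proof.
rewrite pnatr_eq0 cardfs_eq0; apply/eqP => m0.
have : f \in members by rewrite in_fset_set ?inE; [exact: mem_orbit|exact: orbit_finite kf].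
by rewrite m0.
Qed.

Lemma pairing_eOmega'_char g : dual2V_level k g ->
  pairing (fun x => eOmega' Omega (x *+ 2)) g = if `[< Omega g >] then #|quo V k|%:R else 0.
Proof.
move=> kg; rewrite /pairing.
under eq_bigr => a _ do rewrite eOmega'E mulr_sumr.
rewrite exchange_big /=; case: asboolP => Og.
  have gm : g \in members by rewrite in_fset_set ?inE //; exact: orbit_finite kf.
  rewrite (bigD1_seq g) ?fset_uniq //= (sum_dual2V_norm kg) big_seq_cond big1 ?addr0 //.
  move=> g' /andP[/mem_members Og' /eqP gg']; apply: dual2V_orthogonal => //.
    exact: orbit_level Og'.
  by move=> h; apply: gg'.
rewrite big_seq big1 // => g' /mem_members Og'; apply: dual2V_orthogonal => //.
  exact: orbit_level Og'.
by move=> h; apply: Og; rewrite h.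
Qed.

End OneOrbit.

Lemma sum_twoV k (U : nmodType) (F : V -> U) : level k.+1 F -> (forall x, ~ twoV x -> F x = 0) ->
  \sum_(a : quo V k.+1) F (quo_repr a) = \sum_(b : quo V k) F (quo_repr b *+ 2).
Proof.
move=> kF F0; pose t (b : quo V k) := quo_pi k.+1 (quo_repr b *+ 2).
pose t' (a : quo V k.+1) := quo_pi k (half (quo_repr a)).
transitivity (\sum_(a : quo V k.+1 | `[< twoV (quo_repr a) >]) F (quo_repr a)).
  rewrite [RHS]big_mkcond; apply: eq_bigr => a _; case: asboolP => // ta.
  exact: F0.
have mul2 x y : eqm k x y -> eqm k.+1 (x *+ 2) (y *+ 2).
  by move=> /(eqm_mul 1); rewrite addn1.
rewrite (reindex_onto t t') => [|a /asboolP [y _ yE]]; last first.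
  rewrite -[RHS]quo_reprK -yE /t /t' -yE half2; apply/quo_piP/mul2.
  exact: quo_pi_repr.
apply: eq_big => [b|b _]; last by apply: kF; exact: quo_pi_repr.
have [y yE] := quo_pi_repr k.+1 (quo_repr b *+ 2 : V).
have tE : quo_repr (t b) = (quo_repr b + y *+ 2 ^ k) *+ 2.
  by rewrite mulrnDl -mulrnA -expnSr -yE /t addrC subrK.
rewrite /t' tE half2 asboolT; last exact: twoV2.
rewrite /=; apply/eqP; rewrite -[RHS]quo_reprK; apply/quo_piP.
by apply: eqm_addr; apply: eqm_dvd.
Qed.

End OrbitIdempotents.

(** * The action of the orbit idempotents on irreducible representations *)

Section OrbitAction.
Variables (R : realType) (V : uniformLieType) (G : topGroupType).
Variables (exp : V -> G) (log : G -> V) (mu : probability (borel G) R).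
Hypothesis chart : lie_chart exp log.
Hypothesis haar : is_haar mu.
Local Notation C := R[i].
Local Notation Ad := (Ad exp log).
Local Notation orbit := (orbit exp log).
Implicit Types (x y z : V) (h : G) (f : V -> C) (rho : crep R G).

Definition rep_level k rho := forall x, eqm k.+1 x 0 -> rho (exp x) = 1%:M.

Lemma rep_exists_level rho : exists k, rep_level k rho.
Proof.
have [k kP] := rep_trivial_near0 chart rho; exists k => x x0; apply: kP.
exact: eqm_le x0.
Qed.

Lemma rep_level_le j k rho : (j <= k)%N -> rep_level j rho -> rep_level k rho.
Proof. by move=> jk jP x x0; apply: jP; apply: eqm_le x0; rewrite ltnS. Qed.

Lemma rep_glevelS k rho : rep_level k rho -> glevel log k.+1 (fun g => rho g).
Proof. exact: (rep_glevel chart). Qed.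

(** The character of rho on G^2, transported to V. *)
Definition rchar2 rho x : C := rchar rho (exp (x *+ 2)).

Lemma eqm2 k x y : eqm k x y -> eqm k.+1 (x *+ 2) (y *+ 2).
Proof. by move=> /(eqm_mul 1); rewrite addn1. Qed.

Lemma rchar2_level k rho : rep_level k rho -> level k (rchar2 rho).
Proof.
move=> rk x y /eqm2 xy; rewrite /rchar2 /rchar; congr (\tr _).
by apply: (rep_glevelS rk); rewrite !(expK chart).
Qed.

Lemma rchar2_Ad rho h x : rchar2 rho (Ad h x) = rchar2 rho x.
Proof.
rewrite /rchar2 -(AdMn chart) (exp_Ad chart) /rchar !rmxM mxtrace_mulC mulmxA.
by rewrite rmx_mulVg mul1mx.
Qed.

Lemma rchar2_0 rho : rchar2 rho 0 = (rdim rho)%:R.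
Proof. by rewrite /rchar2 mul0rn (exp0 chart) /rchar rmx1 mxtrace1. Qed.

Section OneOrbit.
Variables (k : nat) (f : V -> C) (rho : crep R G).
Hypothesis kf : dual2V_level k f.
Hypothesis rk : rep_level k rho.
Local Notation Omega := (orbit f).
Local Notation M := (rep_op mu (eOmega exp log Omega) rho).

Definition op_sum : 'M[C]_(rdim rho) := \sum_(b : quo V k)
  (eOmega' Omega (quo_repr b *+ 2))^*%C *: rho (exp (quo_repr b *+ 2)).

Lemma rep_opE : M = (mass log mu k.+1)%:C%C *: op_sum.
Proof.
apply/matrixP => i j; rewrite !mxE.
have e0 x : ~ twoV x -> (eOmega' Omega x)^*%C * rho (exp x) i j = 0.
  by move=> tx; rewrite (eOmega'_0 chart kf tx) rmorph0 mul0r.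
rewrite (@cintegral_glevel _ _ _ exp log mu chart haar k.+1); last first.
  move=> g h gh; rewrite !(eOmegaE chart kf) (eOmega'_level chart kf gh).
  by rewrite (rep_glevelS rk gh).
congr (_ * _); rewrite summxE.
under eq_bigr => a _ do rewrite (eOmegaE chart kf) (expK chart).
rewrite (@sum_twoV V k _ (fun x => (eOmega' Omega x)^*%C * rho (exp x) i j)) //.
  by apply: eq_bigr => b _; rewrite !mxE.
move=> x y xy; rewrite (eOmega'_level chart kf xy).
by rewrite (rep_glevelS rk (g := exp x) (h := exp y)) // !(expK chart).
Qed.

Lemma mass_neq0 : (mass log mu k.+1)%:C%C != 0 :> C.
Proof. by have := mass_gt0 chart haar k.+1; rewrite -ltcR => /gt_eqF ->. Qed.

Lemma op_sum_level : level k
  (fun x => (eOmega' Omega (x *+ 2))^*%C *: rho (exp (x *+ 2))).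
Proof.
move=> x y xy; rewrite (eOmega'_level2 chart kf xy); congr (_ *: _).
by apply: (rep_glevelS rk); rewrite !(expK chart); exact: eqm2.
Qed.

Lemma op_sum_central h : op_sum *m rho h = rho h *m op_sum.
Proof.
rewrite -{1}[op_sum](sum_quo_inj op_sum_level (t := Ad h)); last first.
  by move=> x y /(Ad_eqm chart h^-1%g); rewrite !(AdK chart).
rewrite mulmx_suml mulmx_sumr; apply: eq_bigr => b _.
rewrite -(AdMn chart) (eOmega'_Ad chart) -scalemxAl -scalemxAr; congr (_ *: _).
by rewrite (exp_Ad chart) -!rmxM -mulgA mulVg mulg1.
Qed.

Lemma op_sum_scalar : irreducible_rep rho -> exists a, op_sum = a%:M.
Proof. by move=> irr; apply: schur_scalar irr _; exact: op_sum_central. Qed.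

Lemma trace_op_sum : \tr op_sum = pairing k (rchar2 rho) (eOmega' Omega).
Proof.
by rewrite raddf_sum; apply: eq_bigr => b _ /=; rewrite mxtraceZ.
Qed.

(** Whether the orbit idempotent acts nontrivially is read off from one
    Fourier coefficient of the character. *)
Lemma rep_op_eq0 : irreducible_rep rho -> (M == 0) = (pairing k (rchar2 rho) f == 0).
Proof.
move=> irr; rewrite rep_opE scaler_eq0 (negbTE mass_neq0) /=.
have [a aE] := op_sum_scalar irr.
have := trace_op_sum; rewrite (pairing_eOmega chart kf (rchar2_level rk) (rchar2_Ad rho)).
rewrite aE mxtrace_scalar => h.
have d0 : (rdim rho)%:R != 0 :> C by rewrite pnatr_eq0 -lt0n; exact: irr.1.
apply/idP/idP => [/eqP a0|/eqP p0].
  have : \tr (a%:M : 'M[C]_(rdim rho)) = 0 by rewrite a0 mxtrace0.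
  rewrite mxtrace_scalar h => /eqP; rewrite mulf_eq0.
  by rewrite (negbTE (members_neq0 chart kf)).
move: h; rewrite p0 mulr0 -[a *+ _]mulr_natr => /eqP.
by rewrite mulf_eq0 (negbTE d0) orbF => /eqP ->; rewrite raddf0.
Qed.

End OneOrbit.

(** Distinct orbits give orthogonal idempotents for the convolution of V, hence
    for that of G, since the group law may be replaced by the addition under
    the sum. *)
Lemma rep_op_orthogonal k f1 f2 rho : dual2V_level k f1 -> dual2V_level k f2 ->
  rep_level k rho -> irreducible_rep rho -> orbit f1 <> orbit f2 ->
  rep_op mu (eOmega exp log (orbit f1)) rho = 0 \/
  rep_op mu (eOmega exp log (orbit f2)) rho = 0.
Proof.
move=> k1 k2 rk irr o12.
rewrite (rep_opE k1 rk) (rep_opE k2 rk).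
have [a1 E1] := op_sum_scalar k1 rk irr; have [a2 E2] := op_sum_scalar k2 rk irr.
suff : a1 * a2 = 0.
  by move/eqP; rewrite mulf_eq0 E1 E2 => /orP[]/eqP ->; [left|right];
    rewrite raddf0 scaler0.
have d0 : (rdim rho)%:R != 0 :> C by rewrite pnatr_eq0 -lt0n; exact: irr.1.
apply: (mulIf d0); rewrite mul0r mulr_natr -mxtrace_scalar scalar_mxM -E1 -E2.
pose c1 x := (eOmega' (orbit f1) (x *+ 2))^*%C.
pose c2 x := (eOmega' (orbit f2) (x *+ 2))^*%C.
have c1k : level k c1 by move=> x y xy; rewrite /c1 (eOmega'_level2 chart k1 xy).
have c2k : level k c2 by move=> x y xy; rewrite /c2 (eOmega'_level2 chart k2 xy).
have Xk := rchar2_level rk.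
transitivity (\sum_(a : quo V k) \sum_(b : quo V k)
   c1 (quo_repr a) * c2 (quo_repr b) * rchar2 rho (hmul chart (quo_repr a) (quo_repr b))).
  rewrite mulmx_suml raddf_sum; apply: eq_bigr => a _.
  rewrite mulmx_sumr raddf_sum; apply: eq_bigr => b _ /=.
  rewrite -scalemxAl -scalemxAr !mxtraceZ mulrA; congr (_ * _).
  by rewrite /rchar2 /rchar -hmulE (logK chart) rmxM.
rewrite (sum_hmul chart c1k c2k Xk); last 2 first.
- by move=> h x; rewrite /c1 -(AdMn chart) (eOmega'_Ad chart).
- by move=> h x; rewrite /c2 -(AdMn chart) (eOmega'_Ad chart).
transitivity (\sum_(a : quo V k) \sum_(b : quo V k)
   c1 (quo_repr a) * c2 (quo_repr b - quo_repr a) * rchar2 rho (quo_repr b)).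
  apply: eq_bigr => a _.
  rewrite -(@sum_quo_inj V k _ (fun y => c1 (quo_repr a) * c2 (y - quo_repr a) * rchar2 rho y)
     (fun y => quo_repr a + y)).
  - by apply: eq_bigr => b _; rewrite [quo_repr a + _]addrC addrK.
  - by move=> x y xy; rewrite (Xk _ _ xy) (c2k _ _ (eqmB xy (eqm_refl k (quo_repr a)))).
  - by move=> x y h; have := eqmB h (eqm_refl k (quo_repr a)); rewrite ![quo_repr a + _]addrC !addrK.
rewrite exchange_big big1 // => b _ /=; rewrite -mulr_suml.
rewrite (_ : \sum_(a : quo V k) _ = 0) ?mul0r //.
under eq_bigr => a _ do rewrite /c1 /c2 (eOmega'E chart k1) (eOmega'E chart k2) !rmorph_sum mulr_suml.
rewrite exchange_big /= big_seq big1 // => g1 /(mem_members chart k1) O1.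
under eq_bigr => a _ do rewrite mulr_sumr.
rewrite exchange_big /= big_seq big1 // => g2 /(mem_members chart k2) O2.
have kg1 := orbit_level chart k1 O1; have kg2 := orbit_level chart k2 O2.
have g12 : g1 <> g2.
  move=> g12; apply: o12; rewrite (orbit_eq chart O1) g12.
  by rewrite (orbit_eq chart O2).
transitivity ((g2 (quo_repr b *+ 2))^*%C *
   \sum_(a : quo V k) (g1 (quo_repr a *+ 2))^*%C * g2 (quo_repr a *+ 2)).
  rewrite mulr_sumr; apply: eq_bigr => a _; rewrite mulrCA; congr (_ * _).
  have := dual2V_D kg2 (quo_repr b - quo_repr a) (quo_repr a); rewrite subrK => ->.
  by rewrite rmorphM /= -mulrA (dual2V_norm kg2) mulr1.
by rewrite (dual2V_orthogonal kg1 kg2 g12) mulr0.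
Qed.

(** The orbit idempotent acts by a nonzero scalar and absorbs translations by
    exp (2^(k+1) V), so this subgroup acts trivially. *)
Lemma rep_op_level k f rho : dual2V_level k f -> irreducible_rep rho ->
  rep_op mu (eOmega exp log (orbit f)) rho != 0 -> rep_level k rho.
Proof.
move=> kf irr M0 z z0; have [k' rk'] := rep_exists_level rho.
pose K := maxn k k'; have rK : rep_level K rho by apply: rep_level_le rk'; rewrite leq_maxr.
have Kf : dual2V_level K f by apply: dual2V_level_le kf; rewrite leq_maxl.
move: M0; rewrite (rep_opE Kf rK) scaler_eq0 negb_or => /andP[_].
have [a aE] := op_sum_scalar Kf rK irr.
(* Translation by exp z = exp (2 z') is x |-> hmul z' x in the coordinate exp (2 x). *)
have [w zE] := eqm0P z0; pose z' := w *+ 2 ^ k.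
have z'E : z = z' *+ 2 by rewrite zE expnSr mulrnA.
have inv : rho (exp z) *m op_sum K f rho = op_sum K f rho.
  rewrite -{2}[op_sum K f rho](sum_quo_inj (op_sum_level Kf rK) (t := hmul chart z')); last first.
    move=> x y /eqm2; rewrite -!hmulE => /(log_mull_eqm chart (exp (z' *+ 2))^-1%g).
    by rewrite !mulKg !(expK chart) -addn1 => /(@eqm_div _ _ 1).
  rewrite mulmx_sumr; apply: eq_bigr => b _; rewrite -scalemxAr -hmulE (logK chart) rmxM -z'E.
  congr (_ *: _); congr (conjc _); apply: esym.
  apply: (eOmega'_level chart kf).
  apply: (@eqm_trans _ _ (log (exp 0 * exp (quo_repr b *+ 2))%g)).
    by apply: (mul_eqm chart) => //; exact: eqm_refl.
  by rewrite (exp0 chart) mul1g (expK chart); exact: eqm_refl.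
rewrite aE => a0.
have a_neq0 : a != 0 by apply: contraNneq a0 => ->; rewrite raddf0.
move: inv; rewrite aE mul_mx_scalar -[a%:M]scalemx1 => /(scalerI a_neq0).
by [].
Qed.

Lemma iso_rchar rho sigma h : iso_rep rho sigma -> rchar rho h = rchar sigma h.
Proof.
case=> P [Q [PQ QP E]]; rewrite /rchar -[rho h]mul1mx -QP -mulmxA E mxtrace_mulC.
by rewrite -mulmxA PQ mulmx1.
Qed.

Lemma iso_rchar2 rho sigma : iso_rep rho sigma -> rchar2 rho = rchar2 sigma.
Proof. by move=> h; apply/funext => x; exact: iso_rchar. Qed.

Lemma rep_op_iso k f rho sigma : dual2V_level k f -> irreducible_rep rho ->
  irreducible_rep sigma -> iso_rep rho sigma ->
  rep_op mu (eOmega exp log (orbit f)) rho != 0 ->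
  rep_op mu (eOmega exp log (orbit f)) sigma != 0.
Proof.
move=> kf irr1 irr2 iso.
have [j rj] := rep_exists_level rho; have [l sl] := rep_exists_level sigma.
pose K := maxn k (maxn j l).
have Kf : dual2V_level K f by apply: dual2V_level_le kf; rewrite leq_maxl.
have rK : rep_level K rho by apply: rep_level_le rj; rewrite /K; lia.
have sK : rep_level K sigma by apply: rep_level_le sl; rewrite /K; lia.
by rewrite (rep_op_eq0 Kf rK irr1) (rep_op_eq0 Kf sK irr2) (iso_rchar2 iso).
Qed.

(** The Fourier coefficients of a nonzero character do not all vanish. *)
Lemma exists_orbit rho : irreducible_rep rho -> exists f, dual2V f /\
  rep_op mu (eOmega exp log (orbit f)) rho != 0.
Proof.
move=> irr; have [k rk] := rep_exists_level rho.
apply: contrapT => none; have /eqP := rchar2_0 rho.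
have -> : rchar2 rho 0 = 0.
  apply: (fourier_injective (rchar2_level rk)) => f kf; apply/eqP.
  rewrite -[X in X == 0]/(pairing k (rchar2 rho) f) -(rep_op_eq0 kf rk irr).
  by apply: contrapT => /negP h; apply: none; exists f; split=> //; exact: kf.1.
by rewrite eq_sym pnatr_eq0 => /eqP d0; have := irr.1; rewrite d0.
Qed.

(** A character minus the multiple of e_Omega with the same Fourier coefficient
    on Omega has no Fourier coefficients at all: off Omega both vanish, as the
    other orbit idempotents annihilate the representation. *)
Lemma character_formula k f rho : dual2V_level k f -> rep_level k rho ->
  irreducible_rep rho -> rep_op mu (eOmega exp log (orbit f)) rho != 0 ->
  exists c, forall x, rchar2 rho x = c * eOmega' (orbit f) (x *+ 2).
Proof.
move=> kf rk irr M0; pose c := pairing k (rchar2 rho) f / #|quo V k|%:R.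
have Q0 : #|quo V k|%:R != 0 :> C.
  by rewrite pnatr_eq0 -lt0n; apply/card_gt0P; exists (quo_pi k 0).
exists c => x; apply/eqP; rewrite -subr_eq0; apply/eqP.
apply: (@fourier_injective R V k (fun x => rchar2 rho x - c * eOmega' (orbit f) (x *+ 2))).
  by move=> y z yz; rewrite (rchar2_level rk yz) (eOmega'_level2 chart kf yz).
move=> g kg.
transitivity (pairing k (rchar2 rho) g - c * pairing k (fun x => eOmega' (orbit f) (x *+ 2)) g).
  rewrite /pairing mulr_sumr -sumrB; apply: eq_bigr => a _.
  by rewrite mulrBr [in RHS]mulrCA.
rewrite (pairing_eOmega'_char chart kf kg); case: asboolP => Og.
  rewrite (pairing_orbit chart kf (rchar2_level rk) (rchar2_Ad rho) Og).
  by rewrite /c mulfVK // subrr.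
rewrite mulr0 subr0; apply/eqP; rewrite -(rep_op_eq0 kg rk irr).
have o12 : orbit f <> orbit g by move=> o12; apply: Og; rewrite o12; exact: mem_orbit.
have [M00|->] := rep_op_orthogonal kf kg rk irr o12; last by rewrite eqxx.
by rewrite M00 eqxx in M0.
Qed.

End OrbitAction.

Theorem theorem2p8 (R : realType) (V : uniformLieType) (G : topGroupType)
    (exp : V -> G) (log : G -> V) (mu : probability (borel G) R) :
  profinite G -> lie_chart exp log -> is_haar mu ->
  ((forall Omega, orbits exp log Omega ->
      finite_set (Ghat_orbit exp log mu Omega)) /\
   (trivIset (orbits exp log) (Ghat_orbit exp log mu) /\
    \bigcup_(Omega in orbits exp log) Ghat_orbit exp log mu Omega
      = Ghat R G)) /\
  (forall (Omega : set (V -> R[i])) (rho : crep R G),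
     orbits exp log Omega -> irreducible_rep rho ->
     Ghat_orbit exp log mu Omega (iso_class rho) ->
     exists c : R[i], forall h, Gsq exp h ->
       rchar rho h = c * eOmega exp log Omega h).
Proof.
move=> _ chart haar; split; [split; [|split]|].
- move=> _ /(orbitsP) [f [k [kf ->]]].
  apply: sub_finite_set (finite_irreducible R chart k.+1).
  move=> _ [rho [irr M0] <-]; exists rho => //; split=> //.
  exact: (rep_op_level chart haar kf irr M0).
- move=> _ _ /orbitsP [f1 [k1 [kf1 ->]]] /orbitsP [f2 [k2 [kf2 ->]]].
  move=> [_ [[rho [irr1 M1] <-] [sigma [irr2 M2] /esym/iso_class_iso iso]]].
  apply: contrapT => o12.
  have M3 := rep_op_iso chart haar kf2 irr2 irr1 (iso_rep_sym iso) M2.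
  have [j rj] := rep_exists_level chart rho.
  pose K := maxn j (maxn k1 k2).
  have Kf1 : dual2V_level K f1 by apply: dual2V_level_le kf1; rewrite /K; lia.
  have Kf2 : dual2V_level K f2 by apply: dual2V_level_le kf2; rewrite /K; lia.
  have rK : rep_level exp K rho by apply: rep_level_le rj; rewrite /K; lia.
  have [E|E] := rep_op_orthogonal chart haar Kf1 Kf2 rK irr1 o12.
    by rewrite E eqxx in M1.
  by rewrite E eqxx in M3.
- apply/seteqP; split=> [c | c].
    by case=> Omega _ [rho [irr _] <-]; exists rho.
  case=> rho irr <-.
  have [f [df M0]] := exists_orbit chart haar irr.
  by exists (orbit exp log f); [exists f|exists rho].
move=> _ rho /orbitsP [f [k [kf ->]]] irr [sigma [irr2 M2] /iso_class_iso iso].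
have [j rj] := rep_exists_level chart rho.
pose K := maxn j k.
have Kf : dual2V_level K f by apply: dual2V_level_le kf; rewrite /K; lia.
have rK : rep_level exp K rho by apply: rep_level_le rj; rewrite /K; lia.
have M1 := rep_op_iso chart haar kf irr2 irr iso M2.
have [c cE] := character_formula chart haar Kf rK irr M1.
exists c => _ [_ [x _ <-] <-].
by rewrite (eOmegaE chart kf) (expK chart) -cE.
Qed.
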